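(* Let $n\ge3$ and let $\omega:[0,\infty)\to(0,\infty)$ be a smooth solution of $$4s^{2}\omega(s)\omega''(s)=2(n-2)\omega(s)(\omega(s)-1)+s\omega'(s)\bigl(2s\omega'(s)-s-2(n-2)\bigr)$$ with $\omega(0)=1$ and $\omega'(0)<0$. Then $\omega$ defines a rotationally symmetric expanding gradient soliton $(\mathbb{R}^n,g,f)$, where $g=\frac{da^2}{\omega(a^2)}+a^2g_{S^{n-1}}$ in polar coordinates $(a,\theta)\in(0,\infty)\times S^{n-1}$ and $f=f(a^2)$ is determined by $$4f'(s)s\omega(s)=s+2\bigl((n-2)-\omega'(s)s-(n-2)\omega(s)\bigr)$$ up to an additive constant, which is fixed by requiring $|\nabla f|^2+R=f$. This soliton has positive sectional curvature and is asymptotically conical as a soliton.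
   Context: An expanding gradient soliton $(M^n,g,f)$ is a smooth Riemannian manifold with a smooth function $f$ such that $2\,\mathrm{Ric}_g+g=\mathscr{L}_{\nabla f}(g)$ (Lie derivative). Write $X=\nabla f$ and let $R$ be the scalar curvature. The quantity $|\nabla f|^2+R-f$ is then constant, and the paper assumes throughout that $|\nabla f|^2+R=f$. Solutions $\omega$ of the ODE $$4s^{2}\omega(s)\omega''(s)=2(n-2)\omega(s)(\omega(s)-1)+s\omega'(s)\bigl(2s\omega'(s)-s-2(n-2)\bigr)$$ with $\omega(0)=1$, $\omega'(0)<0$, when maximally extended as positive solutions, are defined on all of $[0,\infty)$. Here rotationally symmetric means that the standard action of $SO(n)$ on $\mathbb{R}^n$ is by isometries of $g$ preserving $f$. In $f(a^2)$ and $\omega(a^2)$, the functions $f,\omega$ of one variable are evaluated at $s=a^2$, and primes denote derivatives in $s$. For $\alpha\in[0,1)$ let $g_\alpha=dr^2+(1-\alpha)r^2g_{S^{n-1}}$ be the conical metric on $\mathbb{R}^n\setminus\{0\}$, with $g_{S^{n-1}}$ the round metric on the unit sphere. The soliton $(M,g,f)$ is asymptotically conical as a soliton if there is a map $F:(r_0,\infty)_r\times (S^{n-1})_\theta\to M$ such that: (1) $F$ is a diffeomorphism onto its image, and $M\setminus F((r_0,\infty)\times S^{n-1})$ is compact; (2) $f(F(r,\theta))=r^2/4$ and $\frac{\partial F}{\partial r}=\sqrt{f}\,\frac{X}{|X|^2}$; (3) $F^*(g)=g_\alpha+k$ for some $\alpha\in[0,1)$ and some $(0,2)$-tensor $k$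 with $|\nabla^jk|=O(r^{-3\epsilon-j})$ as $r\to\infty$ for some $\epsilon>0$ and $j=0,1,2$ (norms and derivatives with respect to $g_\alpha$). *)

(* Defs.v *)
From mathcomp Require Import all_boot all_order all_algebra.
From mathcomp Require Import all_classical all_reals all_analysis.
Import Order.TTheory GRing.Theory Num.Theory.
Import numFieldNormedType.Exports.

Set Implicit Arguments.
Unset Strict Implicit.
Unset Printing Implicit Defensive.

Local Open Scope classical_set_scope.
Local Open Scope ring_scope.

Section HalfLine.
Context {R : realType}.
Implicit Types (u : R -> R) (s : R).

(* Calculus on [0, +oo[: difference quotients use points of [0, +oo[ only, so
   the derivative is one-sided at 0 and the usual one at s > 0, and the values
   of u on negative numbers play no role. *)
Definition half_nbhs s : set_system R := within [set t | 0 <= t] s^'.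

Definition diff_quotient u s : R -> R := fun t => (u t - u s) / (t - s).

Definition half_derive u : R -> R :=
  fun s => lim (diff_quotient u s @ half_nbhs s).

Definition half_smooth u : Prop :=
  forall k s, 0 <= s -> cvg (diff_quotient (iter k half_derive u) s @ half_nbhs s).

End HalfLine.

(* Riemannian geometry in the global coordinates of R^n = 'rV[R]_n.  A field of
   bilinear forms is a matrix-valued function g, with g x i j the value on the
   coordinate fields e_i, e_j at x.  The library norm on 'rV[R]_n is the sup
   norm, hence the separate Euclidean norm. *)
Section Coordinates.
Context {R : realType} {n : nat}.
Local Notation pt := 'rV[R]_n.
Implicit Types (U : set pt) (x y u v w : pt) (i j k l m : 'I_n).
Implicit Types (g : pt -> 'M[R]_n) (f : pt -> R) (X : pt -> pt) (F : pt -> pt).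

Definition enorm x : R := Num.sqrt (\sum_i x 0 i ^+ 2).

Definition partial i f : pt -> R := fun x => 'D_(delta_mx 0 i) f x.

(* C^oo on U, for U open. *)
Definition smooth_on U f : Prop :=
  forall (s : seq 'I_n) x, U x -> differentiable (foldr partial f s) x.

Definition smooth_map_on U F : Prop :=
  forall i, smooth_on U (fun x => F x 0 i).

Definition diffeo_onto_image U F : Prop :=
  [/\ smooth_map_on U F, open (F @` U) &
      exists G : pt -> pt, smooth_map_on (F @` U) G /\
        forall x, U x -> G (F x) = x].

Definition riemannian_metric g : Prop :=
  [/\ forall i j, smooth_on setT (fun x => g x i j),
      forall x, (g x)^T = g x &
      forall x v, v != 0 -> 0 < (v *m g x *m v^T) 0 0].

(* The Jacobian acts on row vectors from the right. *)
Definition pullback F g : pt -> 'M[R]_n :=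
  fun x => jacobian F x *m g (F x) *m (jacobian F x)^T.

Definition christoffel g l i j : pt -> R := fun x =>
  2^-1 * \sum_m invmx (g x) l m *
    (partial i (fun y => g y j m) x + partial j (fun y => g y i m) x
     - partial m (fun y => g y i j) x).

(* R(e_i, e_j) e_k = \sum_l (riemann g l i j k) e_l, where
   R(X, Y) Z = D_X D_Y Z - D_Y D_X Z - D_[X, Y] Z. *)
Definition riemann g l i j k : pt -> R := fun x =>
  partial i (christoffel g l j k) x - partial j (christoffel g l i k) x
  + \sum_m (christoffel g l i m x * christoffel g m j k x
            - christoffel g l j m x * christoffel g m i k x).

Definition ricci g : pt -> 'M[R]_n := fun x =>
  \matrix_(j, k) \sum_i riemann g i i j k x.

Definition scalar_curvature g : pt -> R := fun x =>
  \sum_j \sum_k invmx (g x) j k * ricci g x j k.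

Definition inner g x u v : R := (u *m g x *m v^T) 0 0.

Definition curvature_op g x u v w : pt :=
  \row_l \sum_i \sum_j \sum_k
    riemann g l i j k x * u 0 i * v 0 j * w 0 k.

Definition sectional g x u v : R :=
  inner g x (curvature_op g x u v v) u /
  (inner g x u u * inner g x v v - inner g x u v ^+ 2).

Definition positive_sectional_curvature g : Prop :=
  forall x u v, row_free (col_mx u v) -> 0 < sectional g x u v.

Definition grad g f : pt -> pt := fun x =>
  \row_i \sum_j invmx (g x) i j * partial j f x.

Definition lie_derivative X g : pt -> 'M[R]_n := fun x =>
  \matrix_(i, j) \sum_k
    (X x 0 k * partial k (fun y => g y i j) x
     + g x k j * partial i (fun y => X y 0 k) x
     + g x i k * partial j (fun y => X y 0 k) x).

Definition expanding_gradient_soliton g f : Prop :=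
  [/\ riemannian_metric g, smooth_on setT f &
      forall x, 2 *: ricci g x + g x = lie_derivative (grad g f) g x].

Definition normalized_potential g f : Prop :=
  forall x, inner g x (grad g f x) (grad g f x) + scalar_curvature g x = f x.

(* SO(n) acts on row vectors by x |-> x *m A. *)
Definition rotationally_symmetric g f : Prop :=
  forall A : 'M[R]_n, A *m A^T = 1%:M -> \det A = 1 ->
    forall x, pullback (fun y => y *m A) g x = g x /\ f (x *m A) = f x.

Definition unit_sphere : set pt := [set x | enorm x = 1].

Definition direction x : pt := (enorm x)^-1 *: x.

(* dr^2, and the round metric of the unit sphere (induced by the Euclidean
   metric) pulled back along x |-> x / |x|; meaningful for x != 0. *)
Definition dr2 : pt -> 'M[R]_n := fun x =>
  \matrix_(i, j) (partial i enorm x * partial j enorm x).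

Definition round_metric : pt -> 'M[R]_n := pullback direction (fun=> 1%:M).

Definition conical_metric (alpha : R) : pt -> 'M[R]_n := fun x =>
  dr2 x + ((1 - alpha) * enorm x ^+ 2) *: round_metric x.

(* Covariant tensor fields of rank q, by their components T x I. *)
Definition tensor (q : nat) := pt -> {ffun 'I_q -> 'I_n} -> R.

Definition tensor_of_form (k : pt -> 'M[R]_n) : tensor 2 :=
  fun x I => k x (I ord0) (I ord_max).

(* (D T)(e_m, e_{J_1}, ..., e_{J_q}) = (D_{e_m} T)(e_{J_1}, ..., e_{J_q}). *)
Definition covariant_derivative g q (T : tensor q) : tensor q.+1 :=
  fun x I =>
    let m := I ord0 in
    let J := [ffun p : 'I_q => I (lift ord0 p)] in
    partial m (fun y => T y J) x
    - \sum_(p < q) \sum_l christoffel g l m (J p) x *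
        T x [ffun p' => if p' == p then l else J p'].

Fixpoint iter_covariant_derivative g q (T : tensor q) (j : nat) :
    tensor (j + q)%N :=
  match j return tensor (j + q)%N with
  | 0%N => T
  | j'.+1 =>
      covariant_derivative g (@iter_covariant_derivative g q T j')
  end.
Arguments iter_covariant_derivative g {q} T j.

Definition tensor_norm g q (T : tensor q) x : R :=
  Num.sqrt (\sum_(I : {ffun 'I_q -> 'I_n}) \sum_(J : {ffun 'I_q -> 'I_n})
    (\prod_(p < q) invmx (g x) (I p) (J p)) * T x I * T x J).

(* A map F on (r0, +oo) x S^(n-1), read on {|y| > r0} through the polar
   coordinates y = r theta. *)
Definition polar_map (F : R -> pt -> pt) : pt -> pt :=
  fun y => F (enorm y) (direction y).

Definition exterior (r0 : R) : set pt := [set y | r0 < enorm y].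

Definition asymptotically_conical g f : Prop :=
  exists (r0 : R) (F : R -> pt -> pt),
  [/\ 0 <= r0,
      diffeo_onto_image (exterior r0) (polar_map F),
      compact (~` (polar_map F @` exterior r0)),
      forall (r : R) theta, r0 < r -> unit_sphere theta ->
        f (F r theta) = r ^+ 2 / 4 /\
        let X := grad g f (F r theta) in
        is_derive r (1 : R) (fun t : R => F t theta)
          ((Num.sqrt (f (F r theta)) / inner g (F r theta) X X) *: X) &
      exists alpha eps : R,
        [/\ 0 <= alpha < 1, 0 < eps &
            let galpha := conical_metric alpha in
            let k := fun y => pullback (polar_map F) g y - galpha y in
            forall j : nat, (j <= 2)%N ->
              exists C r1 : R, forall y, r1 < enorm y ->
                tensor_norm galpha
                  (iter_covariant_derivative galpha (tensor_of_form k) j) y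
                <= C * enorm y `^ (- (3 * eps) - j%:R)]].

End Coordinates.

Section RotationallySymmetricSolitons.
Context {R : realType}.

Definition omega_ode (n : nat) (omega : R -> R) : Prop :=
  forall s, 0 <= s ->
    let w := omega s in
    let w' := half_derive omega s in
    let w'' := half_derive (half_derive omega) s in
    4 * s ^+ 2 * w * w'' =
      2 * (n%:R - 2) * w * (w - 1)
      + s * w' * (2 * s * w' - s - 2 * (n%:R - 2)).

Definition potential_ode (n : nat) (omega phi : R -> R) : Prop :=
  forall s, 0 <= s ->
    4 * half_derive phi s * s * omega s =
      s + 2 * ((n%:R - 2) - half_derive omega s * s - (n%:R - 2) * omega s).

Definition radial (n : nat) (phi : R -> R) : 'rV[R]_n -> R :=
  fun x => phi (enorm x ^+ 2).

(* The metric da^2 / omega(a^2) + a^2 g_{S^(n-1)} on R^n minus the origin. *)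
Definition polar_metric (n : nat) (omega : R -> R) : 'rV[R]_n -> 'M[R]_n :=
  fun x => (omega (enorm x ^+ 2))^-1 *: dr2 x
           + enorm x ^+ 2 *: round_metric x.

End RotationallySymmetricSolitons.

(* Main.v *)
Require Import Defs.
From mathcomp Require Import all_boot all_order all_algebra.
From mathcomp Require Import all_classical all_reals all_analysis.
From mathcomp Require Import ring lra.
Import Order.TTheory GRing.Theory Num.Theory.
Import numFieldNormedType.Exports.
Local Open Scope classical_set_scope.
Local Open Scope ring_scope.

Set Implicit Arguments.
Unset Strict Implicit.
Unset Printing Implicit Defensive.

(* With s = |x|^2 and q = (1 - omega) / s, which is smooth at s = 0 by Hadamard's
   lemma, the metric is g = 1 + (q / omega) x^T x with inverse 1 - q x^T x, so it is
   smooth on all of R^n and its curvature is an explicit expression in q and q'.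
   Written for q and divided by s^2, the equation of omega is exactly the component
   of the soliton equation along x^T x; the component along the identity determines
   grad f.  The potential is then read off from |grad f|^2 + R = f.

   Positivity: omega' cannot vanish for the first time, by the equation, so omega is
   decreasing; the curvatures q of the planes tangent to the spheres and - omega' of
   the planes containing the radial direction are positive, and every sectional
   curvature is a positive combination of them.

   Asymptotics: maximum principles for - s^2 omega' and for - s^2 omega' / omega bound
   both quantities, so omega tends to a limit l > 0 at rate 1 / s.  Since omega'' is
   damped by - omega' / (4 omega), every derivative of omega gains one order of decay.
   Inverting f along rays gives the end F; the radial and tangential components of
   F^* g - g_(1 - l) are functions of s of order -1, that is O(r^-2), and the same
   symbol calculus on R^n controls the covariant derivatives. *)

(** Cartesian coordinates and functions of [|x|^2] avoid the singularity of polar coordinates at the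
    origin. The price is that one-variable functions are differentiated one-sidedly at [s = 0], and
    that identities obtained by cancelling powers of [s] have to be extended to [s = 0] by
    continuity.

    The potential is not found by integration: the right-hand side of [f = |grad f|^2 + R] is made
    explicit in [q] and [q'] and taken as the definition, and its derivative is then shown to
    produce the gradient that the soliton equation demands.

    Two maximum principles are needed because a bound on [s^2 omega'] makes [omega] converge but
    does not exclude the limit 0; a bound on the logarithmic derivative does. The damping comes from
    the term [- s^2 omega'] of the equation, which after division by [4 s^2 omega] keeps a
    coefficient that does not decay.

    The gradient of [f] is a positive multiple of [x], so the flow lines of the end are rays and the
    end covers everything except the origin. *)

Section DerivationRules.
Context {R : realType} {V : normedModType R}.
Implicit Types (f g : V -> R) (x v : V) (a b : R).

Lemma is_derive_addf f g x v a b : is_derive x v f a -> is_derive x v g b ->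
  is_derive x v (fun y => f y + g y) (a + b).
Proof. exact: is_deriveD. Qed.

Lemma is_derive_oppf f x v a : is_derive x v f a -> is_derive x v (fun y => - f y) (- a).
Proof. exact: is_deriveN. Qed.

Lemma is_derive_mulf f g x v a b : is_derive x v f a -> is_derive x v g b ->
  is_derive x v (fun y => f y * g y) (a * g x + f x * b).
Proof.
move=> df dg; have := is_deriveM df dg; rewrite (_ : f * g = fun y => f y * g y) //.
by move=> /is_derive_eq; apply; rewrite /GRing.scale /=; ring.
Qed.

Lemma is_derive_invf f x v a : f x != 0 -> is_derive x v f a ->
  is_derive x v (fun y => (f y)^-1) (- a / f x ^+ 2).
Proof.
move=> fx [df <-]; apply: DeriveDef; first exact: derivableV.
by rewrite deriveV // /GRing.scale /=; field.
Qed.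

Lemma is_derive_expf n f x v a : is_derive x v f a ->
  is_derive x v (fun y => f y ^+ n) (n%:R * f x ^+ n.-1 * a).
Proof.
move=> df; have := is_deriveX n df; rewrite (_ : f ^+ n = fun y => f y ^+ n) //.
by apply/funext => y; elim: n => //= n IH; rewrite !exprS -IH.
Qed.

Lemma is_derive_cstf c x v : is_derive x v (fun=> c : R) 0.
Proof. exact: is_derive_cst. Qed.

Lemma is_derive_eqf f x v a b : is_derive x v f a -> a = b -> is_derive x v f b.
Proof. by move=> h <-. Qed.

End DerivationRules.

Lemma is_derive_idf (R : realType) (x v : R) : is_derive x v (fun y : R => y) v.
Proof. exact: is_derive_id. Qed.

Ltac derive_rules := lazymatch goal with
  | |- is_derive _ _ (fun y => _ + _) _ => notypeclasses refine (is_derive_addf _ _); derive_rules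
  | |- is_derive _ _ (fun y => - _) _ => notypeclasses refine (is_derive_oppf _); derive_rules
  | |- is_derive _ _ (fun y => _ * _) _ => notypeclasses refine (is_derive_mulf _ _); derive_rules
  | |- is_derive _ _ (fun y => _ ^+ _) _ => notypeclasses refine (is_derive_expf _ _); derive_rules
  | |- is_derive _ _ (fun y => _ ^-1) _ => notypeclasses refine (is_derive_invf _ _); [|derive_rules]
  | |- is_derive _ _ GRing.inv _ => notypeclasses refine (is_derive_invf (f := fun y => y) _ _); [|derive_rules]
  | |- is_derive _ _ (GRing.mul ?a) _ =>
      notypeclasses refine (is_derive_mulf (f := fun=> a) (g := fun y => y) _ _); derive_rules
  | |- is_derive _ _ (fun y => y) _ => notypeclasses refine (is_derive_idf _ _)
  | |- is_derive _ _ (fun y => ?c) _ => notypeclasses refine (is_derive_cstf _ _ _)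
  | H : is_derive ?x ?v ?f _ |- is_derive ?x ?v ?f _ => exact: H
  | H : is_derive ?x ?v ?f _ |- is_derive ?x ?v (fun y => ?f y) _ => exact: H
  | |- _ => idtac
  end.

Ltac derive_step := notypeclasses refine (is_derive_eqf _ _); [derive_rules|].

(** * Calculus on the half line *)

Section HalfLineCalculus.
Context {R : realType}.
Implicit Types (u v : R -> R) (s t l : R).

Definition is_half_derive u s l : Prop := diff_quotient u s @ half_nbhs s --> l.

Lemma is_half_deriveP u s l : is_half_derive u s l <->
  forall e, 0 < e -> exists2 d, 0 < d & forall t, 0 <= t -> t != s ->
    `|s - t| < d -> `|l - (u t - u s) / (t - s)| < e.
Proof.
split=> [/cvgrPdist_lt h e e0|h].
  have /nbhs_ballP[d /= d0 hd] := h _ e0; exists d => // t t0 ts st.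
  exact: hd.
apply/cvgrPdist_lt => e /h [d d0 hd]; apply/nbhs_ballP; exists d => //= t st ts t0.
exact: hd.
Qed.

Lemma is_deriveP u s l : is_derive s 1 u l <->
  forall e, 0 < e -> exists2 d, 0 < d & forall t, t != s ->
    `|s - t| < d -> `|l - (u t - u s) / (t - s)| < e.
Proof.
split=> [[/cvg_ex[l' H] <-] e e0|h].
  have -> : 'D_1 u s = l' by apply: cvg_lim H.
  move/cvgrPdist_lt : H => /(_ _ e0) /nbhs_ballP[d /= d0 hd]; exists d => // t ts st.
  have := hd (t - s); rewrite /ball /= sub0r opprB => /(_ st).
  by rewrite subr_eq0 => /(_ ts); rewrite [_ *: (1 : R)]mulr1 subrK [_ *: _]mulrC.
have H : (fun h => h^-1 *: ((u \o shift s) (h *: (1 : R)) - u s)) @ (0 : R)^' --> l.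
  apply/cvgrPdist_lt => e /h [d d0 hd]; apply/nbhs_ballP; exists d => //= t.
  rewrite /ball /= sub0r normrN => td t0.
  have := hd (t + s); rewrite -subr_eq0 addrK => /(_ t0).
  rewrite opprD addrCA subrr addr0 normrN => /(_ td).
  by rewrite [_ *: (1 : R)]mulr1 [_ *: _]mulrC.
apply: DeriveDef; first by apply/cvg_ex; exists l.
exact: cvg_lim H.
Qed.

Lemma half_nbhs_proper s : 0 <= s -> ProperFilter (half_nbhs s).
Proof.
move=> s0; rewrite /half_nbhs; apply: Build_ProperFilter_ex => P.
rewrite /within => /nbhs_ballP[d /= d0 hd]; exists (s + d / 2).
apply: hd => //.
- by rewrite /ball /= opprD addrA subrr sub0r normrN gtr0_norm ?gtr_pMr//; lra.
- by rewrite -subr_eq0 addrAC subrr add0r gt_eqF //; lra.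
- by rewrite /=; lra.
Qed.

Lemma is_half_derive_val u s l : 0 <= s -> is_half_derive u s l -> half_derive u s = l.
Proof. by move=> s0 h; have := half_nbhs_proper s0 => ?; apply: cvg_lim. Qed.

(** Continuing [u] by its tangent line at [s] over the negative numbers turns the one-sided
    derivative into a two-sided one. *)
Lemma is_half_derive_extend u s l : 0 <= s -> is_half_derive u s l ->
  exists v, is_derive s 1 v l /\ forall t, 0 <= t -> v t = u t.
Proof.
move=> s0 /is_half_deriveP h; pose v t := if 0 <= t then u t else u s + l * (t - s).
have vE t : 0 <= t -> v t = u t by rewrite /v => ->.
exists v; split=> //; apply/is_deriveP => e e0; have [d d0 hd] := h _ e0.
exists d => // t ts st; rewrite /v s0; case: ifPn => t0; first exact: hd.
by rewrite addrAC subrr add0r mulfK ?subr_eq0// subrr normr0.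
Qed.

Lemma is_derive_half u s l : is_derive s 1 u l -> is_half_derive u s l.
Proof.
move=> /is_deriveP h; apply/is_half_deriveP => e /h[d d0 hd].
by exists d => // t _; exact: hd.
Qed.

Lemma eq_is_half_derive u v s l : 0 <= s -> (forall t, 0 <= t -> u t = v t) ->
  is_half_derive u s l -> is_half_derive v s l.
Proof.
move=> s0 uv /is_half_deriveP h; apply/is_half_deriveP => e /h[d d0 hd].
by exists d => // t t0; rewrite -!uv //; exact: hd.
Qed.

(** No differentiability is required: the difference quotients are sampled at nonnegative points
    only, so the two image filters coincide, and with them their limits. *)
Lemma eq_half_derive u v s : 0 <= s -> (forall t, 0 <= t -> u t = v t) ->
  half_derive u s = half_derive v s.
Proof.
have sub a b : 0 <= s -> (forall t, 0 <= t -> a t = b t) ->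
    diff_quotient a s @ half_nbhs s `<=` diff_quotient b s @ half_nbhs s.
  move=> s0 ab A /nbhs_ballP[d /= d0 hd]; apply/nbhs_ballP; exists d => //= t st ts t0.
  by rewrite /diff_quotient -!ab //; exact: hd.
move=> s0 uv; rewrite /half_derive; congr (lim _).
by rewrite eqEsubset; split; apply: sub => // t t0; rewrite uv.
Qed.

Lemma cvg_half_derive u s : 0 <= s -> cvg (diff_quotient u s @ half_nbhs s) ->
  is_half_derive u s (half_derive u s).
Proof. by move=> s0; have := half_nbhs_proper s0 => ?; rewrite /is_half_derive. Qed.

Lemma is_half_derive_gt0 u s l : 0 < s -> is_half_derive u s l -> is_derive s 1 u l.
Proof.
move=> s0 /is_half_deriveP h; apply/is_deriveP => e /h[d d0 hd].
exists (Num.min d s); first by rewrite lt_min d0.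
move=> t ts; rewrite lt_min => /andP[td tlt]; apply: hd => //.
by have := ler_norm (s - t); lra.
Qed.

(* The usual differentiation rules are inherited from the whole line through
   [is_half_derive_extend]. *)
Lemma is_half_derive2 (op : R -> R -> R) (dop : R -> R -> R -> R -> R) u v s l m :
  0 <= s ->
  (forall f g : R -> R, f s = u s -> g s = v s -> is_derive s 1 f l -> is_derive s 1 g m ->
     is_derive s 1 (fun t => op (f t) (g t)) (dop (f s) (g s) l m)) ->
  is_half_derive u s l -> is_half_derive v s m ->
  is_half_derive (fun t => op (u t) (v t)) s (dop (u s) (v s) l m).
Proof.
move=> s0 H /(is_half_derive_extend s0)[f [df fu]] /(is_half_derive_extend s0)[g [dg gv]].
have := H f g (fu _ s0) (gv _ s0) df dg; rewrite !fu // !gv // => /is_derive_half.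
by apply: eq_is_half_derive => // t t0; rewrite fu // gv.
Qed.

Lemma is_half_deriveD u v s l m : 0 <= s -> is_half_derive u s l -> is_half_derive v s m ->
  is_half_derive (fun t => u t + v t) s (l + m).
Proof.
by move=> s0; apply: (@is_half_derive2 (fun a b => a + b) (fun _ _ l m => l + m)).
Qed.

Lemma is_half_deriveM u v s l m : 0 <= s -> is_half_derive u s l -> is_half_derive v s m ->
  is_half_derive (fun t => u t * v t) s (l * v s + u s * m).
Proof.
move=> s0; apply: (@is_half_derive2 (fun a b => a * b) (fun a b l m => l * b + a * m)) => //.
move=> f g _ _ df dg.
have := is_deriveM df dg; rewrite (_ : f * g = fun t => f t * g t) //.
move=> /is_derive_eq; apply.
by rewrite /GRing.scale /=; ring.
Qed.

Lemma is_half_derive_cst c s : 0 <= s -> is_half_derive (fun=> c) s 0.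
Proof. by move=> s0; apply: is_derive_half; exact: is_derive_cst. Qed.

Lemma is_half_derive_id s : 0 <= s -> is_half_derive id s 1.
Proof. by move=> s0; apply: is_derive_half; exact: is_derive_id. Qed.

Lemma is_half_deriveV u s l : 0 <= s -> u s != 0 -> is_half_derive u s l ->
  is_half_derive (fun t => (u t)^-1) s (- l * (u s)^-1 * (u s)^-1).
Proof.
move=> s0 us ul.
have := @is_half_derive2 (fun a _ => a^-1) (fun a _ l _ => - l * a^-1 * a^-1) u u s l l s0.
apply=> // f g fu _ df _; have fs0 : f s != 0 by rewrite fu.
have [df1 df2] := df.
apply: DeriveDef; first exact: derivableV.
rewrite deriveV // derive_val /GRing.scale /=.
by field.
Qed.

Lemma is_half_derive_continuous u s l : 0 <= s -> is_half_derive u s l ->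
  forall e, 0 < e -> exists2 d, 0 < d & forall t, 0 <= t -> `|s - t| < d -> `|u s - u t| < e.
Proof.
move=> s0 /(is_half_derive_extend s0)[f [df fu]] e e0.
have [/derivable1_diffP/differentiable_continuous cf _] := df.
move/cvgrPdist_lt : cf => /(_ _ e0) /nbhs_ballP[d /= d0 hd].
by exists d => // t t0 st; rewrite -!fu //; exact: hd.
Qed.

End HalfLineCalculus.

(** * Smoothness up to the end point 0, and division by [s] *)

Section HalfSmooth.
Context {R : realType}.
Implicit Types (u v : R -> R) (s t l : R).

(** Finite-order version of [half_smooth]: the closure properties go by induction on the order,
    lowering it by one for each derivative. *)
Fixpoint half_C k u : Prop := if k is k'.+1 then
  (forall s, 0 <= s -> is_half_derive u s (half_derive u s)) /\ half_C k' (half_derive u)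
  else True.

Lemma half_smoothE u : half_smooth u <-> forall k, half_C k u.
Proof.
split=> [h k|].
  elim: k u h => //= k IH u h; split; first by move=> s s0; apply: cvg_half_derive (h 0%N _ s0).
  by apply: IH => j s s0; rewrite -iterSr; exact: h.
move=> h k s s0; elim: k u h => [|k IH] u h /=.
  by have [H _] := h 1%N; apply/cvg_ex; exists (half_derive u s); exact: H.
by have := IH (half_derive u); rewrite -iterSr; apply => j; have [] := h j.+1.
Qed.

Lemma half_smooth_derive u s : 0 <= s -> half_smooth u -> is_half_derive u s (half_derive u s).
Proof. by move=> s0 /half_smoothE/(_ 1%N)[h _]; exact: h. Qed.

Lemma half_smooth_half_derive u : half_smooth u -> half_smooth (half_derive u).
Proof. by move=> /half_smoothE h; apply/half_smoothE => k; have [] := h k.+1. Qed.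

Lemma half_smooth_is_derive u s : 0 < s -> half_smooth u -> is_derive s 1 u (half_derive u s).
Proof. by move=> s0 h; apply: is_half_derive_gt0 => //; exact: half_smooth_derive (ltW s0) h. Qed.

Lemma half_CS k u : half_C k.+1 u -> half_C k u.
Proof. by elim: k u => // k IH u [h1 h2]; split=> //; exact: IH. Qed.

Lemma eq_half_C k u v : (forall t, 0 <= t -> u t = v t) -> half_C k u -> half_C k v.
Proof.
elim: k u v => // k IH u v uv [h1 h2]; split.
  move=> s s0; rewrite -(eq_half_derive s0 uv); apply: eq_is_half_derive uv _ => //.
  exact: h1.
by apply: IH h2 => t t0; exact: eq_half_derive.
Qed.

Lemma half_C_step k u v : (forall s, 0 <= s -> is_half_derive u s (v s)) ->
  half_C k v -> half_C k.+1 u.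
Proof.
move=> uv hv; split; first by move=> s s0; rewrite (is_half_derive_val s0 (uv _ s0)); exact: uv.
by apply: eq_half_C hv => t t0; rewrite (is_half_derive_val t0 (uv _ t0)).
Qed.

Lemma half_CD k u v : half_C k u -> half_C k v -> half_C k (fun t => u t + v t).
Proof.
elim: k u v => // k IH u v [u1 u2] [v1 v2].
apply: half_C_step (IH _ _ u2 v2) => s s0.
by apply: is_half_deriveD => //; [exact: u1|exact: v1].
Qed.

Lemma half_CM k u v : half_C k u -> half_C k v -> half_C k (fun t => u t * v t).
Proof.
elim: k u v => // k IH u v hu hv; have [u1 u2] := hu; have [v1 v2] := hv.
apply: half_C_step; last first.
  apply: half_CD; first exact: IH u2 (half_CS hv).
  exact: IH (half_CS hu) v2.
by move=> s s0; apply: is_half_deriveM => //; [exact: u1|exact: v1].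
Qed.

Lemma half_C_cst k c : half_C k (fun=> c).
Proof.
elim: k c => // k IH c; apply: half_C_step (IH 0) => s s0; exact: is_half_derive_cst.
Qed.

Lemma half_CV k u : (forall s, 0 <= s -> u s != 0) -> half_C k u -> half_C k (fun t => (u t)^-1).
Proof.
move=> u0; elim: k u u0 => // k IH u u0 hu; have [u1 u2] := hu.
apply: half_C_step; last first.
  apply: half_CM; last exact: IH u0 (half_CS hu).
  apply: half_CM; last exact: IH u0 (half_CS hu).
  exact: half_CM (half_C_cst _ (-1)) u2.
move=> s s0; rewrite /= mulN1r; apply: is_half_deriveV => //; [exact: u0|exact: u1].
Qed.

Lemma half_smoothD u v : half_smooth u -> half_smooth v -> half_smooth (fun t => u t + v t).
Proof. by move=> /half_smoothE hu /half_smoothE hv; apply/half_smoothE => k; exact: half_CD. Qed.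

Lemma half_smoothM u v : half_smooth u -> half_smooth v -> half_smooth (fun t => u t * v t).
Proof. by move=> /half_smoothE hu /half_smoothE hv; apply/half_smoothE => k; exact: half_CM. Qed.

Lemma half_smoothV u : (forall s, 0 <= s -> u s != 0) -> half_smooth u ->
  half_smooth (fun t => (u t)^-1).
Proof. by move=> u0 /half_smoothE hu; apply/half_smoothE => k; exact: half_CV. Qed.

Lemma half_smooth_cst c : half_smooth (fun=> c : R).
Proof. by apply/half_smoothE => k; exact: half_C_cst. Qed.

Lemma half_smooth_id : half_smooth (id : R -> R).
Proof.
apply/half_smoothE => -[//|k]; apply: half_C_step (half_C_cst k 1) => s s0.
exact: is_half_derive_id.
Qed.

Lemma eq_half_smooth u v : (forall t, 0 <= t -> u t = v t) -> half_smooth u -> half_smooth v.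
Proof. by move=> uv /half_smoothE hu; apply/half_smoothE => k; exact: eq_half_C (hu k). Qed.

Lemma half_smooth_cvg0 u : half_smooth u -> u x @[x --> 0^'+] --> u 0.
Proof.
move=> hu; apply/cvgrPdist_lt => e e0.
have [d d0 hd] := is_half_derive_continuous (lexx 0) (half_smooth_derive (lexx 0) hu) e0.
near=> x; apply: hd; first by near: x; exact: nbhs_right_ge.
rewrite sub0r normrN gtr0_norm; first by near: x; exact: nbhs_right_lt.
by near: x; exact: nbhs_right_gt.
Unshelve. all: by end_near. Qed.

(** Asking only for right continuity at the left end point makes the mean value theorem available
    from 0, where only one-sided information is at hand. *)
Lemma MVT_right u (du : R -> R) a b : a < b -> u x @[x --> a^'+] --> u a ->
  (forall x, a < x -> x <= b -> is_derive x 1 u (du x)) ->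
  exists c, [/\ a < c, c < b & u b - u a = du c * (b - a)].
Proof.
move=> ab ua dub.
have cu x : a < x -> x <= b -> u @ x --> u x.
  move=> ax xb; apply/differentiable_continuous/derivable1_diffP.
  by have [] := dub _ ax xb.
have [||c] := @MVT R u du a b ab; last first.
- by rewrite in_itv /= => /andP[ac cb] ->; exists c.
- apply/continuous_within_itvP => //; split => //.
  + by move=> x; rewrite in_itv /= => /andP[x0 xt]; exact: cu (ltW _).
  + by apply: cvg_at_left_filter; exact: cu.
- by move=> x; rewrite in_itv /= => /andP[x0 /ltW]; exact: dub.
Qed.

(** By the mean value theorem, difference quotients at 0 are values of [du] at intermediate points,
    hence share its limit. *)
Lemma half_derive_limit u (du : R -> R) l : (forall s, 0 < s -> is_derive s 1 u (du s)) ->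
  u x @[x --> 0^'+] --> u 0 -> du x @[x --> 0^'+] --> l -> is_half_derive u 0 l.
Proof.
move=> dud cu /cvgrPdist_lt cdu; apply/is_half_deriveP => e /cdu/nbhs_ballP[d /= d0 hd].
exists d => // t t0 tn0; rewrite sub0r normrN => td; rewrite subr0.
have {}t0 : 0 < t by rewrite lt_neqAle eq_sym tn0.
have [c [c0 ct ->]] : exists c, [/\ 0 < c, c < t & u t - u 0 = du c * (t - 0)].
  by apply: MVT_right => // x x0 _; exact: dud.
rewrite subr0 mulfK //; apply: hd => //.
rewrite /ball /= sub0r normrN gtr0_norm //.
by apply: lt_trans ct _; rewrite gtr0_norm in td.
Qed.

(* If [w = v'] then [t w' + (k+2) w = u'], so the singular equation satisfied by
   [v] is inherited by its derivatives, with [k] incremented. *)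
Lemma half_C_singular j k u v : half_smooth u ->
  (forall s, 0 < s -> is_derive s 1 v ((u s - k.+1%:R * v s) / s)) ->
  v x @[x --> 0^'+] --> v 0 -> half_C j v.
Proof.
elim: j k u v => // j IH k u v hu dv cv.
pose u' := half_derive u; have hu' : half_smooth u' := half_smooth_half_derive hu.
(* The value at 0 is the one that [t w' + (k+2) w = u'] forces there. *)
pose w s := if s == 0 then u' 0 / k.+2%:R else (u s - k.+1%:R * v s) / s.
have wE s : 0 < s -> w s = (u s - k.+1%:R * v s) / s by move=> s0; rewrite /w gt_eqF.
have k2 : (k.+2%:R : R) != 0 by rewrite pnatr_eq0.
have cw : w x @[x --> 0^'+] --> w 0.
  apply/cvgrPdist_lt => e e0.
  have /cvgrPdist_lt/(_ _ e0)/nbhs_ballP[d /= d0 hd] := half_smooth_cvg0 hu'.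
  apply/nbhs_ballP; exists d => //= s; rewrite /ball /= sub0r normrN => sd s0.
  rewrite gtr0_norm // in sd.
  (* With the integrating factor [t ^+ k.+2], this is [t ^+ k.+2 * (w t - w 0)] for [t > 0], and the
     derivative no longer contains [w]. The mean value theorem then turns continuity of [u'] at 0
     into continuity of [w]. *)
  pose H (t : R) := t ^+ k.+1 * (u t - k.+1%:R * v t) - w 0 * t ^+ k.+2.
  have dH t : 0 < t -> is_derive t 1 H (t ^+ k.+1 * (u' t - u' 0)).
    move=> t0; have du := half_smooth_is_derive t0 hu; have dvt := dv _ t0.
    apply: is_derive_eqf.
      rewrite /H.
derive_rules.
    rewrite /w eqxx /=.
    have -> : (t ^+ k.+2 = t ^+ k * t * t) by rewrite !exprSr.
    rewrite !exprSr -!natr1 -/u'; field.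
    by have k0 := ler0n R k; rewrite gt_eqF //= gt_eqF //; lra.
  have H0 : H 0 = 0 by rewrite /H !expr0n /= !mul0r mulr0 subr0.
  have cH : H x @[x --> 0^'+] --> H 0.
    rewrite /H; apply: cvgB; apply: cvgM.
    - apply: cvg_at_right_filter; exact: exprn_continuous.
    - apply: cvgB; first exact: half_smooth_cvg0.
      by apply: cvgM => //; exact: cvg_cst.
    - exact: cvg_cst.
    - apply: cvg_at_right_filter; exact: exprn_continuous.
  have [c [c0 cs]] : exists c, [/\ 0 < c, c < s & H s - H 0 = c ^+ k.+1 * (u' c - u' 0) * (s - 0)].
    by apply: (@MVT_right H (fun c => c ^+ k.+1 * (u' c - u' 0))) => // x x0 _; exact: dH.
  rewrite H0 !subr0 => Hs.
  have uc : `|u' c - u' 0| < e.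
    rewrite distrC; apply: hd => //.
    by rewrite /ball /= sub0r normrN gtr0_norm //; exact: lt_trans cs sd.
  have -> : w 0 - w s = - H s / s ^+ k.+2.
    by rewrite /H (wE _ s0) !exprS; field; rewrite ?expf_neq0 gt_eqF.
  rewrite normrM normrN normfV (gtr0_norm (exprn_gt0 _ s0)) ltr_pdivrMr ?exprn_gt0 //.
  rewrite Hs !normrM (gtr0_norm s0) (gtr0_norm (exprn_gt0 _ c0)) (exprSr s) mulrA ltr_pM2r //.
  rewrite mulrC; apply: ltr_pM => //; rewrite ?exprn_ge0 ?ltW //.
  by rewrite ltr_pXn2r // nnegrE ltW.
have dvw s : 0 <= s -> is_half_derive v s (w s).
  rewrite le_eqVlt => /orP[/eqP<-|s0]; last by rewrite wE //; apply: is_derive_half; exact: dv.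
  by apply: (@half_derive_limit v w) => // t t0; rewrite wE //; exact: dv.
apply: half_C_step dvw _; apply: (IH k.+1 u' w hu' _ cw) => s s0.
have du := half_smooth_is_derive s0 hu; have dvt := dv _ s0.
apply: (@near_eq_is_derive _ _ _ (fun s => (u s - k.+1%:R * v s) / s)).
  near=> t; rewrite wE //; near: t; exact: lt_nbhsr.
apply: is_derive_eqf; first by derive_rules; exact: lt0r_neq0.
by rewrite /= wE // -/u' -!natr1; field; rewrite gt_eqF.
Unshelve. all: by end_near. Qed.

Lemma half_smooth_singular u v : half_smooth u ->
  (forall s, 0 < s -> is_derive s 1 v ((u s - v s) / s)) ->
  v x @[x --> 0^'+] --> v 0 -> half_smooth v.
Proof.
move=> hu dv cv; apply/half_smoothE => j; apply: (@half_C_singular j 0 u v) => // s s0.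
by rewrite mul1r; exact: dv.
Qed.

Definition hadamard u : R -> R := fun s => if s == 0 then half_derive u 0 else (u s - u 0) / s.

(** The quotient [h = (u - u 0) / s] solves [s h' + h = u'], a singular equation whose right-hand
    side is smooth. *)
Lemma half_smooth_hadamard u : half_smooth u -> half_smooth (hadamard u).
Proof.
move=> hu; apply: (@half_smooth_singular (half_derive u) (hadamard u)) => [|s s0|].
- exact: half_smooth_half_derive.
-
  have du := half_smooth_is_derive s0 hu.
  apply: (@near_eq_is_derive _ _ _ (fun s => (u s - u 0) / s)).
    near=> t; rewrite /hadamard gt_eqF //; near: t; exact: lt_nbhsr.
  apply: is_derive_eqf.
    derive_rules.
    exact: lt0r_neq0.
  by rewrite /hadamard gt_eqF //; field; rewrite gt_eqF.
have /is_half_deriveP h := half_smooth_derive (lexx 0) hu.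
apply/cvgrPdist_lt => e /h[d d0 hd]; apply/nbhs_ballP; exists d => //= s.
rewrite /ball /= => sd s0; have := hd s (ltW s0).
by rewrite gt_eqF // sd /hadamard eqxx gt_eqF // subr0 => /(_ isT isT).
Unshelve. all: by end_near. Qed.

Lemma hadamardE u s : u s = u 0 + s * hadamard u s.
Proof. by rewrite /hadamard; case: eqP => [->|/eqP s0]; [rewrite mul0r addr0|field]. Qed.

End HalfSmooth.

(** * Smooth functions on R^n *)

Section Chain.
Context {R : realType} {V : normedModType R}.

Lemma differentiable_compf (f : V -> R) (w : R -> R) x l : differentiable f x ->
  is_derive (f x) 1 w l -> differentiable (fun y => w (f y)) x.
Proof.
move=> df [/derivable1_diffP dw _]; exact: (differentiable_comp df dw).
Qed.

Lemma is_derive_compf (f : V -> R) (w : R -> R) x v a l : differentiable f x ->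
  is_derive x v f a -> is_derive (f x) 1 w l -> is_derive x v (fun y => w (f y)) (l * a).
Proof.
move=> df [_ <-] dwl; have dwf := differentiable_compf df dwl.
have [dw <-] := dwl; have dw' := dw; move/derivable1_diffP in dw'.
apply: DeriveDef; first exact: diff_derivable.
rewrite deriveE // (_ : (fun y => w (f y)) = w \o f) // (diff_comp df dw') /=.
by rewrite (deriv1E dw) derive1E -deriveE // mulrC.
Qed.

Lemma is_derive_affine (f : V -> R) (x v : V) (c : R) :
  (forall h : R, f (h *: v + x) = f x + h * c) -> is_derive x v f c.
Proof.
move=> fE.
have H : (fun h => h^-1 *: ((f \o shift x) (h *: v) - f x)) @ (0 : R)^' --> c.
  apply: (@cvg_trans _ ((fun=> c) @ (0 : R)^')); last exact: cvg_cst.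
  apply: near_eq_cvg; near=> h.
  have h0 : h != 0 by near: h; exact: nbhs_dnbhs_neq.
  by rewrite /= fE addrAC subrr add0r [_ *: _]mulrA mulVf // mul1r.
apply: DeriveDef; first by apply/cvg_ex; exists c.
exact: cvg_lim H.
Unshelve. all: by end_near. Qed.

End Chain.

Section Radial.
Context {R : realType} {n : nat}.
Local Notation pt := 'rV[R]_n.
Implicit Types (x y : pt) (i j k : 'I_n) (u : R -> R).

Lemma enorm_ge0 x : 0 <= enorm x. Proof. exact: sqrtr_ge0. Qed.

Lemma enorm_sqr x : enorm x ^+ 2 = \sum_i x 0 i ^+ 2.
Proof. by rewrite sqr_sqrtr // sumr_ge0 // => i _; exact: sqr_ge0. Qed.

Lemma enorm_sqr_ge0 x : 0 <= enorm x ^+ 2. Proof. exact: sqr_ge0. Qed.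

Lemma enorm_eq0 x : (enorm x == 0) = (x == 0).
Proof.
rewrite -sqrf_eq0 enorm_sqr psumr_eq0; last by move=> i _; exact: sqr_ge0.
apply/allP/eqP => [h|-> i _]; last by rewrite mxE expr0n /=.
apply/rowP => i; rewrite mxE; apply/eqP; rewrite -sqrf_eq0.
by apply: h; rewrite mem_index_enum.
Qed.

Lemma enorm_gt0 x : (0 < enorm x) = (x != 0).
Proof. by rewrite lt_neqAle enorm_ge0 andbT eq_sym enorm_eq0. Qed.

Lemma enormZ (a : R) x : enorm (a *: x) = `|a| * enorm x.
Proof.
apply/eqP; rewrite -(@eqrXn2 _ 2) ?mulr_ge0 ?enorm_ge0 ?normr_ge0 //.
rewrite exprMn !enorm_sqr real_normK ?num_real // mulr_sumr; apply/eqP.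
by apply: eq_bigr => i _; rewrite mxE exprMn.
Qed.

Lemma differentiable_coordf j x : differentiable (fun y : pt => y 0 j) x.
Proof. exact: differentiable_coord. Qed.

Lemma is_derive_coord i j x : is_derive x (delta_mx 0 i) (fun y : pt => y 0 j) (i == j)%:R.
Proof. by apply: is_derive_affine => h; rewrite !mxE eqxx /= addrC eq_sym. Qed.

Lemma differentiable_enorm_sqr x : differentiable (fun y : pt => enorm y ^+ 2) x.
Proof.
rewrite (_ : (fun y => _) = \sum_i (fun y : pt => y 0 i * y 0 i)); last first.
  by apply/funext => y; rewrite enorm_sqr fct_sumE; apply: eq_bigr => i _; rewrite expr2.
apply: differentiable_sum => i; apply: differentiableM; exact: differentiable_coord.
Qed.

Lemma is_derive_enorm_sqr i x : is_derive x (delta_mx 0 i) (fun y : pt => enorm y ^+ 2) (2 * x 0 i).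
Proof.
rewrite (_ : (fun y => _) = \sum_i (fun y : pt => y 0 i * y 0 i)); last first.
  by apply/funext => y; rewrite enorm_sqr fct_sumE; apply: eq_bigr => j _; rewrite expr2.
apply: is_derive_eqf.
  apply: is_derive_sum => j; exact: is_derive_mulf (is_derive_coord i j x) (is_derive_coord i j x).
rewrite /= (bigD1 i) //= eqxx big1 ?addr0 ?mul1r ?mulr1 ?mulr_natl ?mulr2n //.
by move=> j ij; rewrite eq_sym (negPf ij) mul0r mulr0 addr0.
Qed.

Lemma radial_extend u x l : is_half_derive u (enorm x ^+ 2) l ->
  exists2 v : R -> R, is_derive (enorm x ^+ 2) 1 v l & radial u = (fun y : pt => v (enorm y ^+ 2)).
Proof.
move=> /(is_half_derive_extend (enorm_sqr_ge0 x))[v [dv vu]]; exists v => //.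
by apply/funext => y; rewrite /radial vu // enorm_sqr_ge0.
Qed.

Lemma differentiable_radial u x l : is_half_derive u (enorm x ^+ 2) l ->
  differentiable (radial u : pt -> R) x.
Proof.
move=> /radial_extend[v dv ->].
exact: (differentiable_compf (differentiable_enorm_sqr x) dv).
Qed.

Lemma is_derive_radial u x l i : is_half_derive u (enorm x ^+ 2) l ->
  is_derive x (delta_mx 0 i) (radial u) (l * (2 * x 0 i)).
Proof.
move=> /radial_extend[v dv ->].
exact: (is_derive_compf (differentiable_enorm_sqr x) (is_derive_enorm_sqr i x) dv).
Qed.

End Radial.

Section SmoothFunctions.
Context {R : realType} {n : nat}.
Local Notation pt := 'rV[R]_n.
Implicit Types (x y : pt) (i j : 'I_n) (u : R -> R) (U : set pt) (f g : pt -> R).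

Lemma near_open_eq U f g x : open U -> U x -> (forall y, U y -> f y = g y) ->
  \forall y \near x, f y = g y.
Proof. by move=> oU Ux fg; apply: filterS fg _; apply: open_nbhs_nbhs; split. Qed.

Lemma eq_partial U f g x i : open U -> U x -> (forall y, U y -> f y = g y) ->
  partial i f x = partial i g x.
Proof. by move=> oU Ux fg; apply: near_eq_derive; exact: near_open_eq fg. Qed.

Lemma eq_differentiable U f g x : open U -> U x -> (forall y, U y -> f y = g y) ->
  differentiable f x -> differentiable g x.
Proof.
move=> oU Ux fg df; have dfc := diff_continuous df.
have fgx : f x = g x := fg _ Ux.
(* The differential of [f] also serves for [g] since the remainders agree near 0; uniqueness then
   identifies it as the differential of [g]. *)
have E : g \o shift x = cst (g x) + 'd f x +o_ (0 : pt) id.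
  apply/eqaddoP => e e0; have [_ /eqaddoP/(_ e e0) h] := (diff_locallyP x f).1 df.
  have := near_open_eq oU Ux fg; rewrite (near_shift 0) subr0 => fg0.
  near=> y.
  have -> : (g \o shift x - (cst (g x) + 'd f x)) y = (f \o shift x - (cst (f x) + 'd f x)) y.
    by rewrite /= !fctE /= fgx; congr (_ - _); apply/esym; near: y.
  by near: y; exact: h.
have dE := diff_unique dfc E.
by apply/diff_locallyP; rewrite dE.
Unshelve. all: by end_near. Qed.

Fixpoint C_on k U f : Prop := (forall x, U x -> differentiable f x) /\
  if k is k'.+1 then forall i, C_on k' U (partial i f) else True.

(** The fold applies the last index of the list first, so the induction peels indices off with
    [rcons]. *)
Lemma smooth_onE U f : smooth_on U f <-> forall k, C_on k U f.
Proof.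
split=> [h k|].
  elim: k f h => [|k IH] f h; split=> //; [exact: (h [::])|exact: (h [::])|].
  by move=> i; apply: IH => s; have := h (rcons s i); rewrite foldr_rcons.
move=> h s; elim/last_ind: s f h => [|s i IH] f h; first by have [] := h 0%N.
by rewrite foldr_rcons; apply: IH => k; have [_] := h k.+1; apply.
Qed.

Lemma C_onS k U f : C_on k.+1 U f -> C_on k U f.
Proof. by elim: k f => [|k IH] f [h1 h2]; split=> // i; exact: IH (h2 i). Qed.

Lemma eq_C_on k U f g : open U -> (forall y, U y -> f y = g y) -> C_on k U f -> C_on k U g.
Proof.
move=> oU; elim: k f g => [|k IH] f g fg [h1 h2].
  by split=> // x Ux; apply: eq_differentiable fg _ => //; exact: h1.
split; first by move=> x Ux; apply: eq_differentiable fg _ => //; exact: h1.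
by move=> i; apply: IH (h2 i) => y Uy; exact: eq_partial fg.
Qed.

Lemma C_on_step k U f (df : 'I_n -> pt -> R) : open U ->
  (forall x, U x -> differentiable f x) ->
  (forall i x, U x -> is_derive x (delta_mx 0 i) f (df i x)) ->
  (forall i, C_on k U (df i)) -> C_on k.+1 U f.
Proof.
move=> oU h1 h2 h3; split=> // i; apply: eq_C_on (h3 i) => // y Uy.
by have [_] := h2 i y Uy.
Qed.

Lemma C_on_derive k U f i x : C_on k U f -> U x -> is_derive x (delta_mx 0 i) f (partial i f x).
Proof. by case: k => [|k] [h _] Ux; apply/derivableP/diff_derivable/h. Qed.

Lemma C_on_differentiable k U f x : C_on k U f -> U x -> differentiable f x.
Proof. by case: k => [|k] [h _]; exact: h. Qed.

Lemma C_on_cst k U (c : R) : C_on k U (fun=> c).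
Proof.
elim: k c => [|k IH] c; split=> // i.
rewrite (_ : partial i _ = fun=> 0) //; apply/funext => x.
by have [_] := is_derive_cstf c x (delta_mx 0 i).
Qed.

Lemma C_onD k U f g : open U -> C_on k U f -> C_on k U g -> C_on k U (fun y => f y + g y).
Proof.
move=> oU; elim: k f g => [|k IH] f g hf hg.
  split=> // x Ux; apply: differentiableD; [exact: C_on_differentiable hf Ux|exact: C_on_differentiable hg Ux].
apply: (@C_on_step _ _ _ (fun i y => partial i f y + partial i g y)) => //.
- move=> x Ux; apply: differentiableD; [exact: C_on_differentiable hf Ux|exact: C_on_differentiable hg Ux].
- by move=> i x Ux; apply: is_derive_addf; [exact: C_on_derive hf Ux|exact: C_on_derive hg Ux].
- by move=> i; apply: IH; [case: hf => _; exact|case: hg => _; exact].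
Qed.

Lemma C_onM k U f g : open U -> C_on k U f -> C_on k U g -> C_on k U (fun y => f y * g y).
Proof.
move=> oU; elim: k f g => [|k IH] f g hf hg.
  split=> // x Ux; apply: differentiableM; [exact: C_on_differentiable hf Ux|exact: C_on_differentiable hg Ux].
apply: (@C_on_step _ _ _ (fun i y => partial i f y * g y + f y * partial i g y)) => //.
- move=> x Ux; apply: differentiableM; [exact: C_on_differentiable hf Ux|exact: C_on_differentiable hg Ux].
- by move=> i x Ux; apply: is_derive_mulf; [exact: C_on_derive hf Ux|exact: C_on_derive hg Ux].
- have [_ hf'] := hf; have [_ hg'] := hg => i.
  by apply: C_onD => //; [exact: IH (hf' i) (C_onS hg)|exact: IH (C_onS hf) (hg' i)].
Qed.

Lemma C_onV k U f : open U -> (forall x, U x -> f x != 0) -> C_on k U f ->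
  C_on k U (fun y => (f y)^-1).
Proof.
move=> oU f0; elim: k => [|k IH] hf.
  split=> // x Ux; apply: differentiableV; [exact: C_on_differentiable hf Ux|exact: f0].
apply: (@C_on_step _ _ _ (fun i y => (-1 * partial i f y) * ((f y)^-1 * (f y)^-1))) => //.
- by move=> x Ux; apply: differentiableV; [exact: C_on_differentiable hf Ux|exact: f0].
- move=> i x Ux; apply: is_derive_eqf.
    apply: is_derive_invf (f0 _ Ux) _; exact: C_on_derive hf Ux.
  by rewrite expr2 invfM mulN1r.
- have [_ hf'] := hf => i; have fV := IH (C_onS hf).
  apply: C_onM => //; last exact: C_onM.
  by apply: C_onM => //; [exact: C_on_cst|exact: hf'].
Qed.

Lemma C_on_coord k U j : C_on k U (fun y : pt => y 0 j).
Proof.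
have dc x : differentiable (fun y : pt => y 0 j) x by exact: differentiable_coord.
case: k => [|k]; split=> // i.
rewrite (_ : partial i _ = fun=> (i == j)%:R); first exact: C_on_cst.
by apply/funext => x; have [_] := is_derive_coord i j x.
Qed.

(** The partial derivatives of a radial function are [2 x_i] times another radial function, so
    smoothness in [s] up to 0 suffices even at the origin. *)
Lemma C_on_radial k U u : open U -> half_smooth u -> C_on k U (radial u).
Proof.
move=> oU; elim: k u => [|k IH] u hu.
  split=> // x _; apply: differentiable_radial; apply: half_smooth_derive hu.
  exact: enorm_sqr_ge0.
apply: (@C_on_step _ _ _ (fun i y => radial (half_derive u) y * (2 * y 0 i))) => //.
- move=> x _; apply: differentiable_radial; apply: half_smooth_derive hu.
  exact: enorm_sqr_ge0.
- move=> i x Ux; apply: is_derive_radial; apply: half_smooth_derive hu.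
  exact: enorm_sqr_ge0.
- move=> i; apply: C_onM => //; first by apply: IH; exact: half_smooth_half_derive.
  by apply: C_onM => //; [exact: C_on_cst|exact: C_on_coord].
Qed.

Lemma is_derive_sqrt (a : R) : 0 < a -> is_derive a 1 Num.sqrt (2^-1 * (Num.sqrt a)^-1).
Proof. by move=> a0; apply: is_derive_eqf; [exact: is_derive1_sqrt|rewrite invfM]. Qed.

Lemma C_on_sqrt k U f : open U -> (forall x, U x -> 0 < f x) -> C_on k U f ->
  C_on k U (fun y => Num.sqrt (f y)).
Proof.
move=> oU f0; elim: k => [|k IH] hf.
  split=> // x Ux; apply: differentiable_compf (is_derive_sqrt (f0 _ Ux)).
  exact: C_on_differentiable hf _.
have df x : U x -> differentiable f x by move=> Ux; exact: C_on_differentiable hf Ux.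
apply: (@C_on_step _ _ _ (fun i y => 2^-1 * (Num.sqrt (f y))^-1 * partial i f y)) => //.
- by move=> x Ux; apply: differentiable_compf (is_derive_sqrt (f0 _ Ux)); exact: df.
- move=> i x Ux; apply: is_derive_compf (is_derive_sqrt (f0 _ Ux)); first exact: df.
  exact: C_on_derive hf Ux.
- have [_ hf'] := hf => i; apply: C_onM => //; last exact: hf'.
  apply: C_onM => //; first exact: C_on_cst.
  apply: C_onV => //; last exact: IH (C_onS hf).
  by move=> x Ux; rewrite gt_eqF // sqrtr_gt0 f0.
Qed.

End SmoothFunctions.

Section SmoothOn.
Context {R : realType} {n : nat}.
Local Notation pt := 'rV[R]_n.
Implicit Types (x y : pt) (i j : 'I_n) (u : R -> R) (U : set pt) (f g : pt -> R).

Lemma smooth_on_cst U (c : R) : smooth_on U (fun=> c).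
Proof. by apply/smooth_onE => k; exact: C_on_cst. Qed.

Lemma smooth_onD U f g : open U -> smooth_on U f -> smooth_on U g ->
  smooth_on U (fun y => f y + g y).
Proof. by move=> oU /smooth_onE hf /smooth_onE hg; apply/smooth_onE => k; exact: C_onD. Qed.

Lemma smooth_onM U f g : open U -> smooth_on U f -> smooth_on U g ->
  smooth_on U (fun y => f y * g y).
Proof. by move=> oU /smooth_onE hf /smooth_onE hg; apply/smooth_onE => k; exact: C_onM. Qed.

Lemma smooth_onV U f : open U -> (forall x, U x -> f x != 0) -> smooth_on U f ->
  smooth_on U (fun y => (f y)^-1).
Proof. by move=> oU f0 /smooth_onE hf; apply/smooth_onE => k; exact: C_onV. Qed.

Lemma smooth_on_sqrt U f : open U -> (forall x, U x -> 0 < f x) -> smooth_on U f ->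
  smooth_on U (fun y => Num.sqrt (f y)).
Proof. by move=> oU f0 /smooth_onE hf; apply/smooth_onE => k; exact: C_on_sqrt. Qed.

Lemma smooth_on_coord U j : smooth_on U (fun y : pt => y 0 j).
Proof. by apply/smooth_onE => k; exact: C_on_coord. Qed.

Lemma smooth_on_radial U u : open U -> half_smooth u -> smooth_on U (radial u).
Proof. by move=> oU hu; apply/smooth_onE => k; exact: C_on_radial. Qed.

Lemma eq_smooth_on U f g : open U -> (forall y, U y -> f y = g y) ->
  smooth_on U f -> smooth_on U g.
Proof. by move=> oU fg /smooth_onE hf; apply/smooth_onE => k; exact: eq_C_on (hf k). Qed.

End SmoothOn.

(** * The functions of one variable *)

Section HalfLineRules.
Context {R : realType}.
Implicit Types (u v : R -> R) (s t l : R).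

Lemma is_half_deriveN u s l : 0 <= s -> is_half_derive u s l ->
  is_half_derive (fun t => - u t) s (- l).
Proof.
move=> s0 du.
apply: (@is_half_derive2 _ (fun a _ => - a) (fun _ _ l _ => - l) u u s l l s0 _ du du).
Qed.

Lemma is_half_deriveX k u s l : 0 <= s -> is_half_derive u s l ->
  is_half_derive (fun t => u t ^+ k) s (k%:R * u s ^+ k.-1 * l).
Proof.
move=> s0 du.
apply: (@is_half_derive2 _ (fun a _ => a ^+ k) (fun a _ l _ => k%:R * a ^+ k.-1 * l)
  u u s l l s0 _ du du).
by move=> f g _ _ df _; exact: is_derive_expf.
Qed.

Lemma is_half_derive_eq u s l l' : is_half_derive u s l -> l = l' -> is_half_derive u s l'.
Proof. by move=> h <-. Qed.

Lemma half_smoothN u : half_smooth u -> half_smooth (fun t => - u t).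
Proof.
move=> hu; apply: (@eq_half_smooth _ (fun t => -1 * u t)) => [t _|]; first by rewrite mulN1r.
exact: (@half_smoothM _ (fun=> -1) u (@half_smooth_cst _ (-1)) hu).
Qed.

Lemma half_smoothX k u : half_smooth u -> half_smooth (fun t => u t ^+ k).
Proof.
move=> hu; elim: k => [|k IH].
  by apply: (@eq_half_smooth _ (fun=> 1)) => //; exact: half_smooth_cst.
apply: (@eq_half_smooth _ (fun t => u t * u t ^+ k)) => [t _|]; first by rewrite exprS.
exact: half_smoothM.
Qed.

(** This extends to [s = 0] the identities obtained by cancelling a power of [s]. *)
Lemma half_smooth_eq0 u : half_smooth u -> (forall s, 0 < s -> u s = 0) -> u 0 = 0.
Proof.
move=> /half_smooth_cvg0 cu u0; rewrite -(cvg_lim (@Rhausdorff R) cu).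
apply: (cvg_lim (@Rhausdorff R)).
apply: (@cvg_trans _ ((fun=> 0 : R) @ (0 : R)^'+)); last exact: cvg_cst.
by apply: near_eq_cvg; near=> x; rewrite u0 //; near: x; exact: nbhs_right_gt.
Unshelve. all: by end_near. Qed.

End HalfLineRules.

Ltac half_rules := lazymatch goal with
  | |- is_half_derive (fun y => _ + _) _ _ => notypeclasses refine (is_half_deriveD _ _ _); [assumption| |]; half_rules
  | |- is_half_derive (fun y => - _) _ _ => notypeclasses refine (is_half_deriveN _ _); [assumption|]; half_rules
  | |- is_half_derive (fun y => _ * _) _ _ => notypeclasses refine (is_half_deriveM _ _ _); [assumption| |]; half_rules
  | |- is_half_derive (fun y => _ ^+ _) _ _ => notypeclasses refine (@is_half_deriveX _ _ _ _ _ _ _); [assumption|]; half_rules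
  | |- is_half_derive (fun y => _ ^-1) _ _ => notypeclasses refine (is_half_deriveV _ _ _); [assumption| |half_rules]
  | |- is_half_derive (GRing.mul ?a) _ _ =>
      notypeclasses refine (@is_half_deriveM _ (fun=> a) (fun y => y) _ _ _ _ _ _); [assumption| |]; half_rules
  | |- is_half_derive (fun y => y) _ _ => notypeclasses refine (is_half_derive_id _); assumption
  | |- is_half_derive (fun y => ?c) _ _ => notypeclasses refine (is_half_derive_cst _ _); assumption
  | H : is_half_derive ?f ?x _ |- is_half_derive ?f ?x _ => exact: H
  | H : is_half_derive ?f ?x _ |- is_half_derive (fun y => ?f y) ?x _ => exact: H
  | |- _ => idtac
  end.

Ltac half_smooth_rules := lazymatch goal with
  | |- half_smooth (fun y => _ + _) => refine (@half_smoothD _ _ _ _ _); half_smooth_rules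
  | |- half_smooth (fun y => - _) => refine (@half_smoothN _ _ _); half_smooth_rules
  | |- half_smooth (fun y => _ * _) => refine (@half_smoothM _ _ _ _ _); half_smooth_rules
  | |- half_smooth (fun y => _ ^+ _) => refine (@half_smoothX _ _ _ _); half_smooth_rules
  | |- half_smooth (fun y => _ ^-1) => refine (@half_smoothV _ _ _ _); [|half_smooth_rules]
  | |- half_smooth (GRing.mul ?a) =>
      refine (@half_smoothM _ (fun=> a) (fun y => y) _ _); half_smooth_rules
  | |- half_smooth (fun y => y) => exact (@half_smooth_id _)
  | |- half_smooth (fun y => ?c) => exact (@half_smooth_cst _ c)
  | |- _ => try assumption
  end.

Section SolitonFunctions.
Context {R : realType} (n : nat) (omega : R -> R).

(* [curv] is [(1 - omega) / s], smooth up to [s = 0]: it is the sectional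
   curvature of the planes tangent to the spheres.  In Cartesian coordinates the
   metric is [1 + metric_coef x^T x] and [grad f = grad_coef x]; the normalization
   [|grad f|^2 + R = f] is used as a closed formula for the potential. *)
Definition curv : R -> R := fun s => - hadamard omega s.
Definition dcurv : R -> R := half_derive curv.
Definition ddcurv : R -> R := half_derive dcurv.
Definition metric_coef : R -> R := fun s => curv s / omega s.
Definition grad_coef : R -> R := fun s => 2^-1 + (n%:R - 1) * curv s + s * dcurv s.
Definition scal_coef : R -> R := fun s => (n%:R - 1) * (n%:R * curv s + 2 * s * dcurv s).
Definition soliton_potential : R -> R := fun s => grad_coef s ^+ 2 * s / omega s + scal_coef s.

Context (omega_smooth : half_smooth omega)
  (omega_gt0 : forall s : R, 0 <= s -> 0 < omega s)
  (omega_eq : omega_ode n omega) (omega0 : omega 0 = 1).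
Implicit Types (s : R).

Lemma omega_neq0 s : 0 <= s -> omega s != 0.
Proof. by move=> s0; rewrite gt_eqF // omega_gt0. Qed.

Lemma curv_smooth : half_smooth curv.
Proof. by apply: half_smoothN; exact: half_smooth_hadamard. Qed.

Lemma dcurv_smooth : half_smooth dcurv.
Proof. exact: half_smooth_half_derive curv_smooth. Qed.

Lemma ddcurv_smooth : half_smooth ddcurv.
Proof. exact: half_smooth_half_derive dcurv_smooth. Qed.

Lemma omegaE s : omega s = 1 - s * curv s.
Proof. by rewrite /curv mulrN opprK -[in RHS]omega0 -hadamardE. Qed.

Lemma is_half_derive_curv s : 0 <= s -> is_half_derive curv s (dcurv s).
Proof. by move=> s0; exact: half_smooth_derive curv_smooth. Qed.

Lemma is_half_derive_dcurv s : 0 <= s -> is_half_derive dcurv s (ddcurv s).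
Proof. by move=> s0; exact: half_smooth_derive dcurv_smooth. Qed.

Lemma is_half_derive_omega s : 0 <= s -> is_half_derive omega s (- curv s - s * dcurv s).
Proof.
move=> s0; apply: (@eq_is_half_derive _ (fun s => 1 - s * curv s)) => // [t _|].
  by rewrite -omegaE.
have dq := is_half_derive_curv s0.
by apply: is_half_derive_eq; first half_rules; rewrite /=; ring.
Qed.

Lemma half_derive_omega s : 0 <= s -> half_derive omega s = - curv s - s * dcurv s.
Proof. by move=> s0; apply: is_half_derive_val => //; exact: is_half_derive_omega. Qed.

Lemma half_derive2_omega s : 0 <= s ->
  half_derive (half_derive omega) s = - 2 * dcurv s - s * ddcurv s.
Proof.
move=> s0; apply: is_half_derive_val => //.
apply: (@eq_is_half_derive _ (fun s => - curv s - s * dcurv s)) => // [t t0|].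
  by rewrite half_derive_omega.
have dq := is_half_derive_curv s0; have dq' := is_half_derive_dcurv s0.
by apply: is_half_derive_eq; first half_rules; rewrite /=; ring.
Qed.

(* The equation for [omega = 1 - s q], divided by [s ^+ 2]; at [s = 0] it holds
   by continuity. *)
Lemma curv_ode s : 0 <= s ->
  - 4 * omega s * (2 * dcurv s + s * ddcurv s) =
  2 * (n%:R - 2) * (curv s ^+ 2 + dcurv s)
  + (curv s + s * dcurv s) * (2 * curv s + 2 * s * dcurv s + 1).
Proof.
pose F s := 2 * (n%:R - 2) * (curv s ^+ 2 + dcurv s)
  + (curv s + s * dcurv s) * (2 * curv s + 2 * s * dcurv s + 1)
  + 4 * omega s * (2 * dcurv s + s * ddcurv s).
have hq := curv_smooth; have hq' := dcurv_smooth; have hq'' := ddcurv_smooth.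
have hF : half_smooth F by rewrite /F; half_smooth_rules.
have F0 t : 0 < t -> F t = 0.
  move=> t0; have := omega_eq (ltW t0); rewrite /= half_derive_omega ?half_derive2_omega ?ltW //.
  have ot : omega t - 1 = - (t * curv t) by rewrite [omega t]omegaE; ring.
  move=> /eqP; rewrite -subr_eq0 => /eqP E; apply: (@mulfI _ (t ^+ 2)).
    by rewrite expf_neq0 // gt_eqF.
  rewrite mulr0 -[RHS]oppr0 -[in RHS]E ot /F.
  have := omegaE t; move: (omega t) => w wE; ring: wE.
move=> s0; have : F s = 0.
  move: s0; rewrite le_eqVlt => /orP[/eqP<-|]; last exact: F0.
  exact: half_smooth_eq0 hF F0.
by rewrite /F => E; lra.
Qed.

Lemma metric_coef_smooth : half_smooth metric_coef.
Proof.
have hq := curv_smooth; rewrite /metric_coef; half_smooth_rules; exact: omega_neq0.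
Qed.

Lemma grad_coef_smooth : half_smooth grad_coef.
Proof. by have hq := curv_smooth; have hq' := dcurv_smooth; rewrite /grad_coef; half_smooth_rules. Qed.

Lemma scal_coef_smooth : half_smooth scal_coef.
Proof. by have hq := curv_smooth; have hq' := dcurv_smooth; rewrite /scal_coef; half_smooth_rules. Qed.

Lemma soliton_potential_smooth : half_smooth soliton_potential.
Proof.
have hp := grad_coef_smooth; have hs := scal_coef_smooth.
by rewrite /soliton_potential; half_smooth_rules; exact: omega_neq0.
Qed.

Lemma is_half_derive_metric_coef s : 0 <= s ->
  is_half_derive metric_coef s ((dcurv s + curv s ^+ 2) / omega s ^+ 2).
Proof.
move=> s0; have dq := is_half_derive_curv s0; have dw := is_half_derive_omega s0.
have w0 := omega_neq0 s0.
apply: is_half_derive_eq; first by rewrite /metric_coef; half_rules.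
rewrite /=; apply: (@mulIf _ (omega s ^+ 2)); first exact: expf_neq0.
transitivity (dcurv s * omega s + curv s ^+ 2 + s * curv s * dcurv s); first by field.
by rewrite divfK ?expf_neq0 // omegaE; ring.
Qed.

Lemma is_half_derive_grad_coef s : 0 <= s ->
  is_half_derive grad_coef s (n%:R * dcurv s + s * ddcurv s).
Proof.
move=> s0; have dq := is_half_derive_curv s0; have dq' := is_half_derive_dcurv s0.
by apply: is_half_derive_eq; [rewrite /grad_coef; half_rules|rewrite /=; ring].
Qed.

Lemma is_half_derive_scal_coef s : 0 <= s ->
  is_half_derive scal_coef s ((n%:R - 1) * ((n%:R + 2) * dcurv s + 2 * s * ddcurv s)).
Proof.
move=> s0; have dq := is_half_derive_curv s0; have dq' := is_half_derive_dcurv s0.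
by apply: is_half_derive_eq; [rewrite /scal_coef; half_rules|rewrite /=; ring].
Qed.

(** The inverse metric multiplies [x] by [omega], so this derivative is exactly the one that makes
    the gradient equal to [grad_coef] times [x]. Once [curv_ode] removes the second derivative of
    [curv], a polynomial identity remains. *)
Lemma is_half_derive_soliton_potential s : 0 <= s ->
  is_half_derive soliton_potential s (grad_coef s / (2 * omega s)).
Proof.
move=> s0; have dp := is_half_derive_grad_coef s0; have ds := is_half_derive_scal_coef s0.
have dw := is_half_derive_omega s0; have w0 := omega_neq0 s0.
apply: is_half_derive_eq; first by rewrite /soliton_potential; half_rules.
rewrite /=; apply: (@mulIf _ (4 * omega s ^+ 2)).
  by rewrite mulf_neq0 // ?expf_neq0 // pnatr_eq0.
have E := curv_ode s0; have wE := omegaE s.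
set p := grad_coef s.
transitivity (4 * omega s * (2 * p * (n%:R * dcurv s + s * ddcurv s) * s + p ^+ 2)
  + 4 * p ^+ 2 * s * (curv s + s * dcurv s)
  + 4 * omega s ^+ 2 * (n%:R - 1) * ((n%:R + 2) * dcurv s + 2 * s * ddcurv s)); first by field.
rewrite (_ : p / _ * _ = 2 * p * omega s); last by field.
rewrite {}/p /grad_coef.
move: w0 E wE; move: (omega s) (curv s) (dcurv s) (ddcurv s) => w q q1 q2 w0 E wE.
set p := 2^-1 + (n%:R - 1) * q + s * q1.
(* The second derivative enters only through this product, so the equation is solved for it without
   dividing by [s], which may be 0. *)
have {}E : 4 * w * (s * q2) = - 8 * w * q1 - (2 * (n%:R - 2) * (q ^+ 2 + q1)
  + (q + s * q1) * (2 * q + 2 * s * q1 + 1)) by lra.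
transitivity (2 * p * s * (4 * w * (s * q2)) + 2 * w * (n%:R - 1) * (4 * w * (s * q2))
  + 4 * w * (2 * p * n%:R * q1 * s + p ^+ 2) + 4 * p ^+ 2 * s * (q + s * q1)
  + 4 * w ^+ 2 * (n%:R - 1) * (n%:R + 2) * q1); first by ring.
by rewrite E wE /p; field.
Qed.

(* The component of the soliton equation along [x^T x]. *)
Lemma soliton_radial_eq s : 0 <= s ->
  2 * ((n%:R - 1) * (dcurv s + curv s ^+ 2) - dcurv s * omega s) + curv s =
  grad_coef s * (2 * s * (dcurv s + curv s ^+ 2) / omega s + 4 * curv s)
  + 4 * (n%:R * dcurv s + s * ddcurv s).
Proof.
move=> s0; have w0 := omega_neq0 s0; apply: (mulfI w0); rewrite /grad_coef.
have E := curv_ode s0; have wE := omegaE s.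
transitivity ((2^-1 + (n%:R - 1) * curv s + s * dcurv s) * (2 * s * (dcurv s + curv s ^+ 2) + 4 * omega s * curv s)
  + 4 * omega s * (n%:R * dcurv s + s * ddcurv s)); last by field.
move: w0 E wE; move: (omega s) (curv s) (dcurv s) (ddcurv s) => w q q1 q2 w0 E wE.
have {}E : 4 * w * (s * q2) = - 8 * w * q1 - (2 * (n%:R - 2) * (q ^+ 2 + q1)
  + (q + s * q1) * (2 * q + 2 * s * q1 + 1)) by lra.
by rewrite [4 * w * (_ + _)]mulrDr E wE; field.
Qed.

Context (hn : (3 <= n)%N) (domega0 : half_derive omega 0 < 0).

Let n3 : 3 <= n%:R :> R. Proof. by rewrite (ler_nat R 3). Qed.

Lemma omega_MVT s : 0 < s ->
  exists c, [/\ 0 < c, c < s & omega s - 1 = half_derive omega c * s].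
Proof.
move=> s0; have [|x x0 _|c [c0 cs]] := @MVT_right R omega (half_derive omega) 0 s s0.
- exact: half_smooth_cvg0.
- exact: half_smooth_is_derive.
- by rewrite omega0 subr0 => E; exists c.
Qed.

(* At a first zero [s1] of [omega'] one has [omega s1 < 1], so the equation gives
   [omega'' s1 < 0], while [omega' < 0] before [s1] forces [omega'' s1 >= 0]. *)
Lemma domega_lt0 s : 0 <= s -> half_derive omega s < 0.
Proof.
set y := half_derive omega; have hy : half_smooth y := half_smooth_half_derive omega_smooth.
have cy t : 0 <= t -> is_half_derive y t (half_derive y t).
  by move=> t0; exact: half_smooth_derive hy.
move=> s0; rewrite ltNge; apply/negP => ys.
pose S := [set t | 0 <= t /\ 0 <= y t].
have hS : has_inf S by split; [exists s|exists 0 => t []].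
pose s1 := inf S.
have s1_le t : S t -> s1 <= t by move=> St; apply: ge_inf => //; case: hS.
have s1_ge0 : 0 <= s1 by apply: lb_le_inf; [case: hS|move=> t []].
have y_lt t : 0 <= t -> t < s1 -> y t < 0.
  move=> t0 ts1; rewrite ltNge; apply/negP => yt.
  by have := s1_le t (conj t0 yt); rewrite leNgt ts1.
have ys1_ge0 : 0 <= y s1.
  (* A negative value would persist near [s1], but [S] has points arbitrarily close to its
     infimum. *)
  rewrite leNgt; apply/negP => ys1; have e0 : 0 < - y s1 by lra.
  have [d d0 hd] := is_half_derive_continuous s1_ge0 (cy _ s1_ge0) e0.
  have [e [e_ge0 ye] es1] := inf_adherent d0 hS.
  have s1e := s1_le e (conj e_ge0 ye).
  have := hd e e_ge0; rewrite distrC ger0_norm ?subr_ge0 // ltrBlDl => /(_ es1).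
  by rewrite ltr_norml => /andP[]; lra.
have s1_gt0 : 0 < s1.
  rewrite lt_neqAle s1_ge0 andbT; apply/eqP => E; move: ys1_ge0; rewrite -E leNgt.
  by rewrite /y domega0.
have ys1 : y s1 = 0.
  apply/eqP; rewrite eq_le ys1_ge0 andbT leNgt; apply/negP => ys1.
  have [d d0 hd] := is_half_derive_continuous s1_ge0 (cy _ s1_ge0) ys1.
  pose t := s1 - Num.min d s1 / 2.
  have m0 : 0 < Num.min d s1 by rewrite lt_min d0.
  have md : Num.min d s1 <= d by rewrite ge_min lexx.
  have ms : Num.min d s1 <= s1 by rewrite ge_min lexx orbT.
  have t0 : 0 <= t by rewrite /t; lra.
  have ts : t < s1 by rewrite /t; lra.
  have := hd t t0; rewrite gtr0_norm ?subr_gt0 //.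
  have -> : s1 - t < d by rewrite /t; lra.
  by move=> /(_ isT); rewrite ltr_norml => /andP[]; have := y_lt t t0 ts; lra.
have w1 : omega s1 < 1.
  have [c [c0 cs E]] := omega_MVT s1_gt0.
  have := y_lt c (ltW c0) cs; rewrite /y; nra.
have L_lt0 : half_derive y s1 < 0.
  have := omega_eq s1_ge0; rewrite /= -/y ys1 !mulr0 mul0r addr0 => E.
  have w0 := omega_gt0 s1_ge0; have s2 : 0 < s1 ^+ 2 by exact: exprn_gt0.
  have a0 : 0 < 4 * s1 ^+ 2 * omega s1 by rewrite !mulr_gt0.
  rewrite -(pmulr_rlt0 _ a0) E pmulr_rlt0; first by lra.
  have h3 := n3; have h2 : 0 < n%:R - 2 :> R by lra.
  by rewrite !mulr_gt0.
(* Difference quotients from the left of [s1] have negative numerator and denominator, hence are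
   positive, yet they would tend to a negative number. *)
have /is_half_deriveP := cy _ s1_ge0.
move=> /(_ (- half_derive y s1)) []; first by lra.
move=> d d0 hd.
pose t := s1 - Num.min d s1 / 2.
have m0 : 0 < Num.min d s1 by rewrite lt_min d0.
have md : Num.min d s1 <= d by rewrite ge_min lexx.
have ms : Num.min d s1 <= s1 by rewrite ge_min lexx orbT.
have t0 : 0 <= t by rewrite /t; lra.
have ts : t < s1 by rewrite /t; lra.
have := hd t t0; rewrite lt_eqF // gtr0_norm ?subr_gt0 //.
have -> : s1 - t < d by rewrite /t; lra.
move=> /(_ isT isT); rewrite ys1 subr0 ltr_norml => /andP[+ _].
have : 0 < y t / (t - s1).
  by rewrite -mulrNN -invrN divr_gt0 // ?oppr_gt0 ?y_lt // subr_lt0.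
lra.
Qed.

Lemma omega_lt1 s : 0 < s -> omega s < 1.
Proof.
move=> s0; have [c [c0 cs E]] := omega_MVT s0.
by have := domega_lt0 (ltW c0); nra.
Qed.

Lemma omega_le1 s : 0 <= s -> omega s <= 1.
Proof. by rewrite le_eqVlt => /orP[/eqP<-|/omega_lt1/ltW//]; rewrite omega0. Qed.

Lemma curv_gt0 s : 0 <= s -> 0 < curv s.
Proof.
rewrite le_eqVlt => /orP[/eqP<-|s0].
  by have := domega_lt0 (lexx 0); rewrite half_derive_omega // mul0r subr0; lra.
have : 0 < s * curv s by have := omega_lt1 s0; have := omegaE s; lra.
by rewrite pmulr_rgt0.
Qed.

Lemma curv_radial_gt0 s : 0 <= s -> 0 < curv s + s * dcurv s.
Proof. by move=> s0; have := domega_lt0 s0; rewrite half_derive_omega //; lra. Qed.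

(** Regroup [grad_coef] as [1/2 + (n - 2) q + (q + s q')]: both curvature terms are positive. *)
Lemma grad_coef_ge s : 0 <= s -> 2^-1 <= grad_coef s.
Proof.
move=> s0; rewrite /grad_coef; have := curv_gt0 s0; have := curv_radial_gt0 s0; have := n3; nra.
Qed.

Lemma scal_coef_gt0 s : 0 <= s -> 0 < scal_coef s.
Proof.
move=> s0; rewrite /scal_coef; have := curv_gt0 s0; have := curv_radial_gt0 s0; have := n3 => h1 h2 h3.
by rewrite mulr_gt0 //; nra.
Qed.

End SolitonFunctions.

(** * Curvature of the soliton metric *)

Section Deltas.
Context {R : realType} {n : nat}.
Implicit Types (i j k l m : 'I_n).

Lemma sum_deltal i (F : 'I_n -> R) : \sum_j (i == j)%:R * F j = F i.
Proof.
rewrite (bigD1 i) //= eqxx mul1r big1 ?addr0 // => j; rewrite eq_sym => /negPf->.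
by rewrite mul0r.
Qed.

(** [x] is an eigenvector of [1 + a x^T x]; this collapses the index sums in the Christoffel symbols
    and in gradients. *)
Lemma sum_delta_sqr (x : 'rV[R]_n) i (a b : R) :
  \sum_m ((i == m)%:R + a * (x 0 i * x 0 m)) * (b * x 0 m) = b * (1 + a * enorm x ^+ 2) * x 0 i.
Proof.
under eq_bigr do rewrite mulrDl.
rewrite big_split /= sum_deltal.
have -> : \sum_m a * (x 0 i * x 0 m) * (b * x 0 m) = (a * b * x 0 i) * \sum_m x 0 m ^+ 2.
  by rewrite mulr_sumr; apply: eq_bigr => m _; ring.
by rewrite -enorm_sqr; ring.
Qed.

Lemma partialE (f : 'rV[R]_n -> R) x i (c : R) : is_derive x (delta_mx 0 i) f c -> partial i f x = c.
Proof. by move=> [_ <-]. Qed.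

Lemma invmx_eq (A B : 'M[R]_n) : A *m B = 1%:M -> invmx A = B.
Proof.
move=> AB; have [uA _] := mulmx1_unit AB.
by rewrite -[invmx A]mulmx1 -AB mulmxA mulVmx // mul1mx.
Qed.

Lemma outer_entry (x : 'rV[R]_n) i j : (x^T *m x) i j = x 0 i * x 0 j.
Proof. by rewrite mxE big_ord1 mxE. Qed.

Lemma outer_sqr (x : 'rV[R]_n) : x *m x^T = (enorm x ^+ 2)%:M.
Proof.
by apply/matrixP => i j; rewrite !ord1 !mxE enorm_sqr eqxx; apply: eq_bigr => k _; rewrite mxE expr2.
Qed.

(** The matrices [a + b x^T x] form a commutative algebra, in which all inverses and pull-backs of
    radial metrics are computed. *)
Lemma outer_mul (x : 'rV[R]_n) (a b c d : R) :
  (a%:M + b *: (x^T *m x)) *m (c%:M + d *: (x^T *m x)) =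
  (a * c)%:M + (a * d + b * c + b * d * enorm x ^+ 2) *: (x^T *m x).
Proof.
rewrite mulmxDl !mulmxDr !mul_scalar_mx mul_mx_scalar -scalemxAl -scalemxAr.
rewrite mulmxA -(mulmxA x^T) outer_sqr mul_mx_scalar -scalemxAl !scalerA -scale_scalar_mx.
by rewrite -!addrA; congr (_ + _); rewrite !addrA -!scalerDl; congr (_ *: _); ring.
Qed.

End Deltas.

Section SolitonGeometry.
Context {R : realType} (n : nat) (omega : R -> R).
Local Notation pt := 'rV[R]_n.
Implicit Types (x y u v : pt) (i j k l m : 'I_n).

Definition soliton_metric : pt -> 'M[R]_n :=
  fun x => 1%:M + metric_coef omega (enorm x ^+ 2) *: (x^T *m x).

(** This is [omega] times the derivative of [metric_coef], the coefficient of [x_l x_i x_j] in the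
    Christoffel symbols. *)
Definition christoffel_coef : R -> R := fun s => (dcurv omega s + curv omega s ^+ 2) / omega s.

Context (omega_smooth : half_smooth omega)
  (omega_gt0 : forall s : R, 0 <= s -> 0 < omega s)
  (omega_eq : omega_ode n omega) (omega0 : omega 0 = 1).

Local Notation q := (curv omega).
Local Notation q' := (dcurv omega).
Local Notation h := (metric_coef omega).
Local Notation A := christoffel_coef.
Local Notation N x := (enorm x ^+ 2).
Local Notation g := soliton_metric.

Let Nge0 x : 0 <= N x. Proof. exact: enorm_sqr_ge0. Qed.
Let wN0 x : omega (N x) != 0. Proof. exact: omega_neq0. Qed.

Lemma soliton_metricE x i j : g x i j = (i == j)%:R + h (N x) * (x 0 i * x 0 j).
Proof. by rewrite !mxE big_ord1 mxE. Qed.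

(** The left side is the eigenvalue of the metric in the radial direction. *)
Lemma omega_metric_coef s : 0 <= s -> 1 + h s * s = (omega s)^-1.
Proof.
move=> s0; have w0 := omega_neq0 omega_gt0 s0; rewrite /metric_coef.
by apply: (mulIf w0); rewrite mulVf // mulrDl mul1r {1}[omega s]omegaE //; field.
Qed.

Lemma soliton_metric_inv x : invmx (g x) = 1%:M + (- q (N x)) *: (x^T *m x).
Proof.
apply: invmx_eq; rewrite /soliton_metric outer_mul mulr1.
rewrite (_ : _ + _ + _ = 0) ?scale0r ?addr0 //.
have w0 := wN0 x; rewrite /metric_coef.
apply: (mulIf w0); rewrite mul0r; transitivity (q (N x) * (1 - N x * q (N x) - omega (N x))).
  by field.
by rewrite -omegaE // subrr mulr0.
Qed.

Lemma soliton_metric_invE x l m : invmx (g x) l m = (l == m)%:R + (- q (N x)) * (x 0 l * x 0 m).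
Proof. by rewrite soliton_metric_inv !mxE big_ord1 mxE. Qed.

Lemma is_derive_soliton_metric x i j k : is_derive x (delta_mx 0 k) (fun y => g y i j)
  ((q' (N x) + q (N x) ^+ 2) / omega (N x) ^+ 2 * (2 * x 0 k) * (x 0 i * x 0 j)
   + h (N x) * ((k == i)%:R * x 0 j + x 0 i * (k == j)%:R)).
Proof.
rewrite (_ : (fun y => g y i j) = (fun y => (i == j)%:R + radial h y * (y 0 i * y 0 j))); last first.
  by apply/funext => y; rewrite soliton_metricE.
have dh := is_derive_radial k (is_half_derive_metric_coef omega_smooth omega_gt0 omega0 (Nge0 x)).
have di := is_derive_coord k i x; have dj := is_derive_coord k j x.
by apply: is_derive_eqf; first derive_rules; rewrite /= /radial /GRing.scale /=; ring.
Qed.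

Lemma soliton_christoffel l i j : christoffel g l i j =
  fun x => x 0 l * (radial A x * (x 0 i * x 0 j) + radial q x * (i == j)%:R).
Proof.
apply/funext => x; rewrite /christoffel /radial.
set d := (q' (N x) + q (N x) ^+ 2) / omega (N x) ^+ 2.
under eq_bigr => m _.
  rewrite !(partialE (is_derive_soliton_metric x _ _ _)) soliton_metric_invE -/d.
  rewrite (_ : _ - _ = 2 * (d * (x 0 i * x 0 j) + h (N x) * (i == j)%:R) * x 0 m); last first.
    by rewrite ![m == _]eq_sym [j == i]eq_sym; ring.
  over.
rewrite sum_delta_sqr /d /A /metric_coef.
have w0 := wN0 x; have -> : 1 + - q (N x) * N x = omega (N x) by rewrite [RHS]omegaE //; ring.
by field.
Qed.

Lemma christoffel_coef_smooth : half_smooth A.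
Proof.
have hq := curv_smooth omega_smooth; have hq' := dcurv_smooth omega_smooth.
by rewrite /christoffel_coef; half_smooth_rules; exact: omega_neq0.
Qed.

(** The terms with the derivative of [A] are symmetric in [i] and [j] and cancel, so no second
    derivative of [q] survives. *)
Lemma soliton_riemann l i j k x : riemann g l i j k x =
  (i == l)%:R * (A (N x) * (x 0 j * x 0 k) + q (N x) * (j == k)%:R)
  - (j == l)%:R * (A (N x) * (x 0 i * x 0 k) + q (N x) * (i == k)%:R)
  + q' (N x) * x 0 l * (x 0 i * (j == k)%:R - x 0 j * (i == k)%:R).
Proof.
rewrite /riemann !soliton_christoffel.
have dA i' := is_derive_radial i' (half_smooth_derive (Nge0 x) christoffel_coef_smooth).
have dq i' := is_derive_radial i' (is_half_derive_curv omega_smooth (Nge0 x)).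
have dG i' l' j' k' : is_derive x (delta_mx 0 i')
    (fun y => y 0 l' * (radial A y * (y 0 j' * y 0 k') + radial q y * (j' == k')%:R))
    ((i' == l')%:R * (A (N x) * (x 0 j' * x 0 k') + q (N x) * (j' == k')%:R)
     + x 0 l' * (half_derive A (N x) * (2 * x 0 i') * (x 0 j' * x 0 k')
        + A (N x) * ((i' == j')%:R * x 0 k' + x 0 j' * (i' == k')%:R)
        + q' (N x) * (2 * x 0 i') * (j' == k')%:R)).
  have dAi := dA i'; have dqi := dq i'.
  have dl := is_derive_coord i' l' x; have dj := is_derive_coord i' j' x.
  have dk := is_derive_coord i' k' x.
  by apply: is_derive_eqf; first derive_rules; rewrite /= /radial /GRing.scale /=; ring.
rewrite !(partialE (dG _ _ _ _)).
have sumG i' j' : \sum_m christoffel g l i' m x * christoffel g m j' k x =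
    x 0 l * (A (N x) * (x 0 j' * x 0 k) + q (N x) * (j' == k)%:R) *
      ((A (N x) * N x + q (N x)) * x 0 i').
  set B := A (N x) * (x 0 j' * x 0 k) + q (N x) * (j' == k)%:R.
  transitivity (\sum_m (x 0 l * B * x 0 i' * A (N x) * x 0 m ^+ 2
      + (i' == m)%:R * (x 0 l * B * q (N x) * x 0 m))).
    by apply: eq_bigr => m _; rewrite !soliton_christoffel /radial /B; ring.
  by rewrite big_split /= -mulr_sumr -enorm_sqr sum_deltal; ring.
rewrite sumrB !sumG.
(* This is [A omega = q' + q^2] with [omega = 1 - s q]; it reduces the quadratic Christoffel terms
   to [q']. *)
have E : A (N x) * N x * q (N x) - A (N x) + q (N x) ^+ 2 + q' (N x) = 0.
  have w0 := wN0 x; apply: (mulIf w0); rewrite mul0r /A.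
  transitivity ((q' (N x) + q (N x) ^+ 2) * (omega (N x) - (1 - N x * q (N x)))).
    by field.
  by rewrite -omegaE // subrr mulr0.
apply/eqP; rewrite -subr_eq0.
rewrite (_ : _ - _ = (A (N x) * N x * q (N x) - A (N x) + q (N x) ^+ 2 + q' (N x)) *
  (x 0 l * (x 0 i * (j == k)%:R - x 0 j * (i == k)%:R))); first by rewrite E mul0r.
by rewrite [j == i]eq_sym; ring.
Qed.

Lemma soliton_ricciE x j k : ricci g x j k =
  ((n%:R - 1) * q (N x) + N x * q' (N x)) * (j == k)%:R
  + ((n%:R - 1) * A (N x) - q' (N x)) * (x 0 j * x 0 k).
Proof.
rewrite mxE; set B := A (N x) * (x 0 j * x 0 k) + q (N x) * (j == k)%:R.
transitivity (\sum_i (B - (j == i)%:R * (A (N x) * (x 0 i * x 0 k) + q (N x) * (i == k)%:R)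
   + (q' (N x) * (j == k)%:R * x 0 i ^+ 2 - (k == i)%:R * (q' (N x) * x 0 i * x 0 j)))).
  by apply: eq_bigr => i _; rewrite soliton_riemann eqxx [i == k]eq_sym -/B /=; ring.
rewrite big_split /= !sumrB sumr_const card_ord !sum_deltal -mulr_sumr -enorm_sqr -mulr_natl.
by rewrite /B; ring.
Qed.

Lemma soliton_scalar_curvature x : scalar_curvature g x = scal_coef n omega (N x).
Proof.
rewrite /scalar_curvature.
set a := (n%:R - 1) * q (N x) + N x * q' (N x); set b := (n%:R - 1) * A (N x) - q' (N x).
transitivity (\sum_j (a + b * x 0 j ^+ 2 - q (N x) * a * x 0 j ^+ 2
    - q (N x) * b * N x * x 0 j ^+ 2)).
  apply: eq_bigr => j _.
  transitivity (\sum_k ((j == k)%:R * (a * (j == k)%:R + b * (x 0 j * x 0 k))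
      - (j == k)%:R * (q (N x) * a * (x 0 j * x 0 k))
      - q (N x) * b * x 0 j ^+ 2 * x 0 k ^+ 2)).
    by apply: eq_bigr => k _; rewrite soliton_metric_invE soliton_ricciE -/a -/b; ring.
  by rewrite !sumrB !sum_deltal -mulr_sumr -enorm_sqr eqxx /=; ring.
rewrite !sumrB big_split /= sumr_const card_ord -!mulr_sumr -!enorm_sqr -mulr_natl.
have w0 := wN0 x.
transitivity (n%:R * a + N x * (b * omega (N x)) - q (N x) * a * N x).
  by rewrite [omega (N x)]omegaE //; ring.
have -> : b * omega (N x) = (n%:R - 1) * (q' (N x) + q (N x) ^+ 2) - q' (N x) * omega (N x).
  by rewrite /b /A; field.
by rewrite [omega (N x)]omegaE // /a /scal_coef; ring.
Qed.

End SolitonGeometry.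

(** * The soliton equation and the normalization of the potential *)

Section SolitonEquation.
Context {R : realType} (n : nat) (omega : R -> R).
Local Notation pt := 'rV[R]_n.
Implicit Types (x y u v : pt) (i j k l m : 'I_n).
Context (omega_smooth : half_smooth omega)
  (omega_gt0 : forall s : R, 0 <= s -> 0 < omega s)
  (omega_eq : omega_ode n omega) (omega0 : omega 0 = 1).

Local Notation q := (curv omega).
Local Notation q' := (dcurv omega).
Local Notation h := (metric_coef omega).
Local Notation A := (christoffel_coef omega).
Local Notation p := (grad_coef n omega).
Local Notation N x := (enorm x ^+ 2).
Local Notation g := (@soliton_metric R n omega).

Let Nge0 x : 0 <= N x. Proof. exact: enorm_sqr_ge0. Qed.
Let wN0 x : omega (N x) != 0. Proof. exact: omega_neq0. Qed.

Lemma outer_quadratic (a : R) x u v :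
  (u *m (1%:M + a *: (x^T *m x)) *m v^T) 0 0 = (u *m v^T) 0 0 + a * ((u *m x^T) 0 0 * (v *m x^T) 0 0).
Proof.
rewrite mulmxDr mulmx1 mulmxDl mxE; congr (_ + _).
rewrite -scalemxAr -scalemxAl mxE mulmxA -(mulmxA (u *m x^T)); congr (_ * _).
by rewrite mxE big_ord1; congr (_ * _); rewrite -[x in LHS]trmxK -trmx_mul mxE.
Qed.

Lemma inner_soliton_metric x u v :
  inner g x u v = (u *m v^T) 0 0 + h (N x) * ((u *m x^T) 0 0 * (v *m x^T) 0 0).
Proof. exact: outer_quadratic. Qed.

Lemma dot_self x : (x *m x^T) 0 0 = N x.
Proof. by rewrite outer_sqr mxE eqxx. Qed.

(** Stated for an arbitrary radial function because the uniqueness of the potential compares the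
    gradients of two candidates. *)
Lemma grad_radial_soliton (psi : R -> R) (l : R) x :
  is_half_derive psi (N x) l -> grad g (radial psi) x = (2 * l * omega (N x)) *: x.
Proof.
move=> dpsi; apply/rowP => i; rewrite !mxE.
have dp j : partial j (radial psi) x = 2 * l * x 0 j.
  by rewrite (partialE (is_derive_radial j dpsi)); ring.
under eq_bigr => j _ do rewrite dp soliton_metric_invE //.
rewrite sum_delta_sqr; congr (_ * _ * _).
by rewrite [RHS]omegaE //; ring.
Qed.

Lemma grad_soliton_potential x : grad g (radial (soliton_potential n omega)) x = p (N x) *: x.
Proof.
rewrite (grad_radial_soliton (is_half_derive_soliton_potential _ _ _ _ _)) //.
by congr (_ *: _); have w0 := wN0 x; field.
Qed.

Lemma soliton_metric_quad_gt0 x u : 0 <= h (N x) -> u != 0 -> 0 < inner g x u u.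
Proof.
move=> h0 u0; rewrite inner_soliton_metric dot_self ltr_pwDl ?exprn_gt0 ?enorm_gt0 //.
by rewrite mulr_ge0 // -expr2 sqr_ge0.
Qed.

Lemma metric_coef_gt0 s : 0 <= s -> 0 < q s -> 0 < h s.
Proof. by move=> s0 q0; rewrite /metric_coef divr_gt0 // omega_gt0. Qed.

Lemma soliton_metric_riemannian : (forall s, 0 <= s -> 0 < q s) -> riemannian_metric g.
Proof.
move=> q0; split.
- move=> i j; have -> : (fun x => g x i j) =
      (fun x => (i == j)%:R + radial h x * (x 0 i * x 0 j)).
    by apply/funext => x; rewrite soliton_metricE.
  apply: smooth_onD; [exact: openT|exact: smooth_on_cst|].
  apply: smooth_onM; [exact: openT| |apply: smooth_onM; [exact: openT|..]; exact: smooth_on_coord].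
  by apply: smooth_on_radial; [exact: openT|exact: metric_coef_smooth].
- move=> x; rewrite /soliton_metric linearD /= linearZ /= trmx_mul trmxK.
  by rewrite tr_scalar_mx.
- by move=> x v v0; apply: soliton_metric_quad_gt0 => //; exact/ltW/metric_coef_gt0/q0.
Qed.

Lemma soliton_lie_derivative x i j :
  lie_derivative (grad g (radial (soliton_potential n omega))) g x i j =
  2 * p (N x) * (i == j)%:R +
  (p (N x) * (2 * N x * ((q' (N x) + q (N x) ^+ 2) / omega (N x) ^+ 2) + 4 * h (N x))
   + 4 * (n%:R * q' (N x) + N x * ddcurv omega (N x)) / omega (N x)) * (x 0 i * x 0 j).
Proof.
rewrite mxE; set X := grad _ _.
have XE : X = fun y => p (N y) *: y by apply/funext => y; exact: grad_soliton_potential.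
set d := (q' (N x) + q (N x) ^+ 2) / omega (N x) ^+ 2.
set dp := n%:R * q' (N x) + N x * ddcurv omega (N x).
have dX l k : partial l (fun y => X y 0 k) x = dp * (2 * x 0 l) * x 0 k + p (N x) * (l == k)%:R.
  apply: partialE; rewrite XE.
  rewrite (_ : (fun y => _) = (fun y => radial p y * y 0 k)); last by apply/funext => y; rewrite mxE.
  have dpl := is_derive_radial l (is_half_derive_grad_coef omega_smooth (Nge0 x)).
  have dk := is_derive_coord l k x.
  by apply: is_derive_eqf; first derive_rules; rewrite /= /radial /GRing.scale /= -/dp; ring.
have hp : 1 + h (N x) * N x = (omega (N x))^-1 by exact: omega_metric_coef.
transitivity (\sum_k (p (N x) * d * 2 * (x 0 i * x 0 j) * x 0 k ^+ 2
    + ((i == k)%:R * (p (N x) * h (N x) * x 0 j * x 0 k + p (N x) * g x k j) +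
      (j == k)%:R * (p (N x) * h (N x) * x 0 i * x 0 k + p (N x) * g x i k))
    + (g x k j * x 0 k * (2 * dp * x 0 i) + g x i k * x 0 k * (2 * dp * x 0 j)))).
  apply: eq_bigr => k _; rewrite !dX (partialE (is_derive_soliton_metric _ _ _ _ _ _ _)) //.
  rewrite -/d XE mxE [k == i]eq_sym [k == j]eq_sym; ring.
(* Contracting the metric with [x] only rescales [x]. *)
have gx k : \sum_m g x k m * x 0 m = (1 + h (N x) * N x) * x 0 k.
  under eq_bigr => m _ do rewrite soliton_metricE -[x 0 m in X in _ * X]mul1r.
  by rewrite sum_delta_sqr mul1r.
rewrite !big_split /= -mulr_sumr -enorm_sqr !sum_deltal -!mulr_suml gx.
under [\sum_m g x m j * _]eq_bigr => m _.
  rewrite soliton_metricE eq_sym [x 0 m * x 0 j]mulrC -soliton_metricE.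
  over.
rewrite gx !soliton_metricE hp.
by have w0 := wN0 x; field.
Qed.

Lemma soliton_equation x :
  2 *: ricci g x + g x = lie_derivative (grad g (radial (soliton_potential n omega))) g x.
Proof.
apply/matrixP => i j; rewrite soliton_lie_derivative [LHS]mxE [X in X + _]mxE soliton_ricciE //.
rewrite soliton_metricE.
have w0 := wN0 x.
(* The component along the identity; [grad_coef] is defined so that it holds. *)
have pE : 2 * p (N x) = 2 * ((n%:R - 1) * q (N x) + N x * q' (N x)) + 1.
  by rewrite /grad_coef; field.
have E := soliton_radial_eq omega_smooth omega_gt0 omega_eq omega0 (Nge0 x).
have {}E : 2 * ((n%:R - 1) * A (N x) - q' (N x)) + h (N x) =
    p (N x) * (2 * N x * ((q' (N x) + q (N x) ^+ 2) / omega (N x) ^+ 2) + 4 * h (N x))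
    + 4 * (n%:R * q' (N x) + N x * ddcurv omega (N x)) / omega (N x).
  apply: (mulIf w0).
  transitivity (2 * ((n%:R - 1) * (q' (N x) + q (N x) ^+ 2) - q' (N x) * omega (N x)) + q (N x)).
    by rewrite /christoffel_coef /metric_coef; field.
  by rewrite E /metric_coef; field.
by rewrite pE -E; ring.
Qed.

Lemma soliton_potential_normalized : normalized_potential g (radial (soliton_potential n omega)).
Proof.
move=> x; rewrite grad_soliton_potential inner_soliton_metric linearZ /=.
rewrite -!scalemxAl -!scalemxAr.
have sE (c : R) (M : 'M[R]_1) : (c *: M) 0 0 = c * M 0 0 by rewrite mxE.
rewrite !sE !dot_self soliton_scalar_curvature // /radial /soliton_potential.
congr (_ + _).
have w0 := wN0 x.
transitivity (p (N x) ^+ 2 * N x * (1 + h (N x) * N x)); first by ring.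
by rewrite omega_metric_coef.
Qed.

End SolitonEquation.

(** * Rotational symmetry and the polar form of the metric *)

Section SolitonSymmetry.
Context {R : realType} (n : nat) (omega : R -> R).
Local Notation pt := 'rV[R]_n.
Implicit Types (x y u v : pt) (i j k l m : 'I_n).
Local Notation q := (curv omega).
Local Notation h := (metric_coef omega).
Local Notation N x := (enorm x ^+ 2).
Local Notation g := (@soliton_metric R n omega).

Lemma jacobianE (F : pt -> pt) (J : 'M[R]_n) x :
  (forall j, differentiable (fun y => F y 0 j) x) ->
  (forall i j, is_derive x (delta_mx 0 i) (fun y => F y 0 j) (J i j)) -> jacobian F x = J.
Proof.
move=> dF FJ; have dFx : differentiable F x.
  rewrite (_ : F = \sum_j (fun y => F y 0 j *: delta_mx 0 j)); last first.
    by apply/funext => y; rewrite fct_sumE [LHS]row_sum_delta.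
  by apply: differentiable_sum => j; exact: differentiableZl.
apply/matrixP => i j; rewrite mxE -deriveE // derive_mx; last exact: diff_derivable.
by rewrite mxE; have [_ ->] := FJ i j.
Qed.

Lemma enorm_orthogonal (B : 'M[R]_n) x : B *m B^T = 1%:M -> enorm (x *m B) = enorm x.
Proof.
move=> BB; apply/eqP; rewrite -(@eqrXn2 _ 2) ?enorm_ge0 //.
rewrite -(dot_self x) -(dot_self (x *m B)).
by rewrite trmx_mul mulmxA -(mulmxA x) BB mulmx1.
Qed.

Lemma jacobian_mulmx (B : 'M[R]_n) x : jacobian (fun y : pt => y *m B) x = B.
Proof.
have e j : (fun y : pt => (y *m B) 0 j) = \sum_k (fun y : pt => y 0 k * B k j).
  by apply/funext => y; rewrite mxE fct_sumE.
apply: jacobianE => [j|i j]; rewrite e.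
  apply: differentiable_sum => k; apply: differentiableM; [exact: differentiable_coordf|].
  exact: differentiable_cst.
apply: is_derive_eqf.
  apply: is_derive_sum => k; have dk := is_derive_coord i k x.
  exact: is_derive_mulf dk (is_derive_cstf _ _ _).
rewrite /= -[RHS](sum_deltal i (fun k => B k j)); apply: eq_bigr => k _.
by rewrite mulr0 addr0.
Qed.

Lemma soliton_rotationally_symmetric (psi : R -> R) : rotationally_symmetric g (radial psi).
Proof.
move=> B BB _ x; rewrite /radial enorm_orthogonal //; split=> //.
rewrite /pullback jacobian_mulmx /soliton_metric enorm_orthogonal //.
rewrite mulmxDr mulmx1 mulmxDl BB -scalemxAr -scalemxAl trmx_mul; congr (_ + _ *: _).
by rewrite !mulmxA BB mul1mx -(mulmxA _ B) BB mulmx1.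
Qed.

Lemma is_derive_enorm i x : x != 0 -> is_derive x (delta_mx 0 i) (enorm : pt -> R) (x 0 i / enorm x).
Proof.
move=> x0; have Nx : 0 < N x by rewrite exprn_gt0 // enorm_gt0.
rewrite (_ : (enorm : pt -> R) = (fun y => Num.sqrt (enorm y ^+ 2))); last first.
  by apply/funext => y; rewrite sqrtr_sqr ger0_norm // enorm_ge0.
apply: is_derive_eqf.
  exact: is_derive_compf (differentiable_enorm_sqr x) (is_derive_enorm_sqr i x) (is_derive_sqrt Nx).
rewrite sqrtr_sqr ger0_norm ?enorm_ge0 //; field.
by rewrite enorm_eq0.
Qed.

Lemma differentiable_enorm x : x != 0 -> differentiable (enorm : pt -> R) x.
Proof.
move=> x0; have Nx : 0 < N x by rewrite exprn_gt0 // enorm_gt0.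
rewrite (_ : (enorm : pt -> R) = (fun y => Num.sqrt (enorm y ^+ 2))); last first.
  by apply/funext => y; rewrite sqrtr_sqr ger0_norm // enorm_ge0.
exact: differentiable_compf (differentiable_enorm_sqr x) (is_derive_sqrt Nx).
Qed.

Lemma dr2E x : x != 0 -> dr2 x = (N x)^-1 *: (x^T *m x).
Proof.
move=> x0; apply/matrixP => i j; rewrite mxE !(partialE (is_derive_enorm _ x0)) mxE outer_entry.
by field; rewrite enorm_eq0.
Qed.

Lemma jacobian_direction x : x != 0 ->
  jacobian direction x = (enorm x)^-1%:M + (- (enorm x ^- 3)) *: (x^T *m x).
Proof.
move=> x0; have nx0 : enorm x != 0 by rewrite enorm_eq0.
have e j : (fun y : pt => direction y 0 j) = (fun y : pt => (enorm y)^-1 * y 0 j).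
  by apply/funext => y; rewrite mxE.
apply: jacobianE => [j|i j]; rewrite e.
  apply: differentiableM; last exact: differentiable_coordf.
  by apply: differentiableV => //; exact: differentiable_enorm.
have dN := is_derive_enorm i x0; have dj := is_derive_coord i j x.
apply: is_derive_eqf.
  exact: is_derive_mulf (is_derive_invf nx0 dN) dj.
rewrite !mxE big_ord1 mxE -mulr_natl.
have -> : (enorm x)^-1 *+ (i == j) = (i == j)%:R * (enorm x)^-1 by rewrite mulr_natl.
by field.
Qed.

(** The Jacobian of [direction] is [1 / |x|] times the orthogonal projection off [x], which is
    symmetric and idempotent. *)
Lemma round_metricE x : x != 0 ->
  round_metric x = (N x)^-1 *: (1%:M - (N x)^-1 *: (x^T *m x)).
Proof.
move=> x0; have nx0 : enorm x != 0 by rewrite enorm_eq0.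
rewrite /round_metric /pullback jacobian_direction // mulmx1.
rewrite linearD /= linearZ /= trmx_mul trmxK tr_scalar_mx outer_mul.
rewrite scalerBr scalerA -scalemx1 scale_scalar_mx; congr (_ + _).
  by rewrite mulr1 scale_scalar_mx mulr1 expr2 invfM.
by rewrite -scaleNr; congr (_ *: _); field.
Qed.

Lemma soliton_metric_polar x : (forall s, 0 <= s -> 0 < omega s) -> omega 0 = 1 ->
  x != 0 -> g x = polar_metric omega x.
Proof.
move=> w_gt0 omega0 x0; have nx0 : N x != 0 by rewrite expf_neq0 // enorm_eq0.
rewrite /polar_metric dr2E // round_metricE // /soliton_metric.
rewrite scalerA scalerA mulfV // scale1r addrCA -scalerBl; congr (_ + _ *: _).
rewrite -(omega_metric_coef w_gt0 omega0) ?enorm_sqr_ge0 //.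
by rewrite mulrDl mul1r mulfK // addrAC subrr add0r.
Qed.

End SolitonSymmetry.

(** * Sectional curvature *)

Section SectionalCurvature.
Context {R : realType} (n : nat) (omega : R -> R).
Local Notation pt := 'rV[R]_n.
Implicit Types (x y u v : pt) (i j k l m : 'I_n).

Definition dot u v : R := \sum_i u 0 i * v 0 i.

Lemma dotE u v : (u *m v^T) 0 0 = dot u v.
Proof. by rewrite mxE; apply: eq_bigr => i _; rewrite mxE. Qed.

Lemma dotC u v : dot u v = dot v u.
Proof. by apply: eq_bigr => i _; rewrite mulrC. Qed.

Lemma dot_linear (a : R) u v w : dot (a *: u + v) w = a * dot u w + dot v w.
Proof. by rewrite mulr_sumr -big_split; apply: eq_bigr => i _; rewrite !mxE /=; ring. Qed.

Lemma dot0l u : dot 0 u = 0.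
Proof. by rewrite /dot big1 // => i _; rewrite mxE mul0r. Qed.

Lemma dotxx x : dot x x = enorm x ^+ 2.
Proof. by rewrite -dotE dot_self. Qed.

Lemma dot_comb3 (a b c : R) u v w z :
  dot (a *: u + b *: v + c *: w) z = a * dot u z + b * dot v z + c * dot w z.
Proof.
rewrite -addrA dot_linear dot_linear -[c *: w]addr0 dot_linear dot0l; ring.
Qed.

Lemma dot_comb2_sqr (a b : R) u v :
  dot (a *: u + b *: v) (a *: u + b *: v) =
  a ^+ 2 * dot u u + 2 * a * b * dot u v + b ^+ 2 * dot v v.
Proof.
have E w : dot (a *: u + b *: v) w = a * dot u w + b * dot v w.
  by rewrite -[b *: v]addr0 !dot_linear dot0l addr0.
by rewrite E (dotC u) (dotC v) !E (dotC v u); ring.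
Qed.

Lemma dotxx_ge0 x : 0 <= dot x x.
Proof. by rewrite dotxx sqr_ge0. Qed.

(** The vector [z], which is [u.u] times the part of [v] orthogonal to [u], is nonzero by
    independence, and [z.z] is [u.u] times the Gram determinant. *)
Lemma gram2_gt0 u v : row_free (col_mx u v) -> 0 < dot u u * dot v v - dot u v ^+ 2.
Proof.
move=> free_uv.
have indep (a b : R) : a *: u + b *: v = 0 -> a = 0 /\ b = 0.
  move=> E; have : row_mx a%:M b%:M *m col_mx u v = 0 :> pt.
    by rewrite mul_row_col !mul_scalar_mx.
  move=> /eqP; rewrite mulmx_free_eq0 // => /eqP/(congr1 (fun M : 'M[R]_(1, 1 + 1) => (lsubmx M, rsubmx M))).
  rewrite row_mxKl row_mxKr !linear0 => -[/matrixP/(_ 0 0) + /matrixP/(_ 0 0)].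
  by rewrite !mxE.
have U0 : 0 < dot u u.
  rewrite lt_neqAle dotxx_ge0 andbT eq_sym dotxx sqrf_eq0 enorm_eq0; apply/eqP => u0.
  by have [] := indep 1 0; rewrite ?u0 ?scaler0 ?scale0r ?addr0 // => /eqP; rewrite oner_eq0.
pose z := dot u u *: v + (- dot u v) *: u.
have z0 : z != 0.
  apply/eqP => z0; have [] := indep (- dot u v) (dot u u); first by rewrite addrC.
  by move=> _ E; rewrite E ltxx in U0.
have : 0 < dot z z by rewrite dotxx exprn_gt0 // enorm_gt0.
have -> : dot z z = dot u u * (dot u u * dot v v - dot u v ^+ 2).
  by rewrite /z dot_comb2_sqr (dotC v u); ring.
by rewrite pmulr_rgt0.
Qed.

(** Nonnegativity of the Gram determinant of [x], [u], [v]. Cramer's rule gives [z] as [D] times the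
    part of [x] orthogonal to [u] and [v], and [z.z] is nonnegative. *)
Lemma gram3_ge0 x u v : 0 < dot u u * dot v v - dot u v ^+ 2 ->
  dot v x ^+ 2 * dot u u - 2 * dot u x * dot v x * dot u v + dot u x ^+ 2 * dot v v <=
  dot x x * (dot u u * dot v v - dot u v ^+ 2).
Proof.
set U := dot u u; set V := dot v v; set W := dot u v; set a := dot u x; set b := dot v x.
set D := U * V - W ^+ 2 => D0.
pose z := D *: x + (- (a * V - b * W)) *: u + (- (b * U - a * W)) *: v.
have zu : dot z u = 0.
  by rewrite dot_comb3 (dotC x u) (dotC v u) -/U -/W -/a /D; ring.
have zv : dot z v = 0.
  by rewrite dot_comb3 (dotC x v) -/V -/W -/b /D; ring.
have := dotxx_ge0 z.
rewrite {1}/z dot_comb3 (dotC u) (dotC v) zu zv !mulr0 !addr0 (dotC x) dot_comb3 -/a -/b.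
rewrite pmulr_rge0 // => h; rewrite -subr_ge0.
rewrite (_ : _ - _ = D * dot x x + - (a * V - b * W) * a + - (b * U - a * W) * b) //; ring.
Qed.

Context (omega_smooth : half_smooth omega)
  (omega_gt0 : forall s : R, 0 <= s -> 0 < omega s)
  (omega_eq : omega_ode n omega) (omega0 : omega 0 = 1).

Local Notation q := (curv omega).
Local Notation q' := (dcurv omega).
Local Notation h := (metric_coef omega).
Local Notation A := (christoffel_coef omega).
Local Notation N x := (enorm x ^+ 2).
Local Notation g := (@soliton_metric R n omega).

Let Nge0 x : 0 <= N x. Proof. exact: enorm_sqr_ge0. Qed.
Let wN0 x : omega (N x) != 0. Proof. exact: omega_neq0. Qed.

Lemma soliton_curvature_op x u v : curvature_op g x u v v =
  (A (N x) * dot v x ^+ 2 + q (N x) * dot v v) *: u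
  + (- (A (N x) * dot u x * dot v x + q (N x) * dot u v)) *: v
  + (q' (N x) * (dot u x * dot v v - dot v x * dot u v)) *: x.
Proof.
apply/rowP => l; rewrite !mxE.
set a := A _; set c := q _; set d := q' _; set b := dot v x.
have sumk i j : \sum_k riemann g l i j k x * u 0 i * v 0 j * v 0 k =
    u 0 i * v 0 j * ((l == i)%:R * (a * x 0 j * b + c * v 0 j)
      - (l == j)%:R * (a * x 0 i * b + c * v 0 i)
      + d * x 0 l * (x 0 i * v 0 j - x 0 j * v 0 i)).
  transitivity (\sum_k (u 0 i * v 0 j * ((l == i)%:R * a * x 0 j - (l == j)%:R * a * x 0 i) * (v 0 k * x 0 k)
     + (j == k)%:R * (u 0 i * v 0 j * ((l == i)%:R * c + d * x 0 l * x 0 i) * v 0 k)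
     - (i == k)%:R * (u 0 i * v 0 j * ((l == j)%:R * c + d * x 0 l * x 0 j) * v 0 k))).
    apply: eq_bigr => k _; rewrite soliton_riemann // -/a -/c -/d [i == l]eq_sym [j == l]eq_sym.
    by ring.
  by rewrite sumrB big_split /= -mulr_sumr -/(dot v x) -/b !sum_deltal; ring.
have sumj i : \sum_j \sum_k riemann g l i j k x * u 0 i * v 0 j * v 0 k =
    u 0 i * ((l == i)%:R * (a * b ^+ 2 + c * dot v v)
      - v 0 l * (a * x 0 i * b + c * v 0 i)
      + d * x 0 l * (x 0 i * dot v v - b * v 0 i)).
  under eq_bigr => j _ do rewrite sumk.
  transitivity (\sum_j (u 0 i * ((l == i)%:R * a * b - d * x 0 l * v 0 i) * (v 0 j * x 0 j)
     + u 0 i * ((l == i)%:R * c + d * x 0 l * x 0 i) * (v 0 j * v 0 j)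
     - (l == j)%:R * (u 0 i * v 0 j * (a * x 0 i * b + c * v 0 i)))).
    by apply: eq_bigr => j _; ring.
  rewrite sumrB big_split /= -!mulr_sumr -/(dot v x) -/b -/(dot v v) sum_deltal; ring.
under eq_bigr => i _ do rewrite sumj.
transitivity (\sum_i ((l == i)%:R * (u 0 i * (a * b ^+ 2 + c * dot v v))
   + (d * x 0 l * dot v v - v 0 l * a * b) * (u 0 i * x 0 i)
   - (v 0 l * c + d * x 0 l * b) * (u 0 i * v 0 i))).
  by apply: eq_bigr => i _; ring.
rewrite sumrB big_split /= -!mulr_sumr -/(dot u x) -/(dot u v) sum_deltal; ring.
Qed.

(** With [D] the Gram determinant of [u], [v] and [M = |b u - a v|^2], the sectional curvature is
    [(q D + A M) / (D + h M)], where [0 <= M <= |x|^2 D]. *)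
Lemma soliton_sectional_gt0 : (forall s, 0 <= s -> 0 < q s) ->
  (forall s, 0 <= s -> 0 < q s + s * q' s) -> positive_sectional_curvature g.
Proof.
move=> q_gt0 qr_gt0 x u v /gram2_gt0 D0; have := gram3_ge0 x D0.
rewrite /sectional !inner_soliton_metric soliton_curvature_op // !dotE !dot_comb3 (dotxx x).
rewrite (dotC v u) (dotC x u).
set U := dot u u in D0 *; set V := dot v v in D0 *; set W := dot u v in D0 *.
set a := dot u x; set b := dot v x; set D := _ - _ in D0 *; set M := _ + _ => MD.
have w0 := wN0 x; have w_gt0 := omega_gt0 (Nge0 x).
have h_gt0 : 0 < h (N x) by apply: metric_coef_gt0 => //; exact: q_gt0.
have M0 : 0 <= M.
  have := dotxx_ge0 (b *: u + (- a) *: v); rewrite dot_comb2_sqr -/U -/V -/W.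
  by rewrite (_ : _ + _ + _ = M) // /M; ring.
have qA : q (N x) + N x * A (N x) = (q (N x) + N x * q' (N x)) / omega (N x).
  rewrite /christoffel_coef; apply: (mulIf w0); rewrite divfK //.
  transitivity (q (N x) * omega (N x) + N x * q' (N x) + N x * q (N x) ^+ 2); first by field.
  by rewrite {1}[omega (N x)]omegaE //; ring.
have AE : A (N x) = q' (N x) * (1 + h (N x) * N x) + h (N x) * q (N x).
  by rewrite omega_metric_coef // /christoffel_coef /metric_coef; field.
apply: divr_gt0.
  rewrite (_ : _ + _ = q (N x) * D + A (N x) * M); last by rewrite AE /M /D; ring.
  (* The numerator is affine in [M]: for [A >= 0] it is least at [M = 0], otherwise at
     [M = |x|^2 D], where it is [(q + s q') / omega] times [D]. *)
  have [A0|A0] := lerP 0 (A (N x)).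
    by apply: ltr_pwDl; [exact: mulr_gt0 (q_gt0 _ _) D0|exact: mulr_ge0].
  apply: (@lt_le_trans _ _ ((q (N x) + N x * A (N x)) * D)).
    by rewrite qA mulr_gt0 // divr_gt0 // qr_gt0.
  by rewrite mulrDl lerD2l -mulrA mulrCA ler_nM2l.
rewrite (_ : _ - _ = D + h (N x) * M); last by rewrite /M /D; ring.
by rewrite ltr_pwDl // mulr_ge0 // ltW.
Qed.

End SectionalCurvature.

(** * Symbol classes *)

Section Symbols.
Context {R : realType} {V : normedModType R} {I : Type}.
Implicit Types (u v : V -> R) (N : nat) (m : R) (x : V).

(** The weight lets one calculus serve twice: with the identity on the line, where only [+oo]
    counts, and with the Euclidean norm on R^n. *)
Definition far (w : V -> R) : set_system V := [set P | exists r, forall x, r < w x -> P x].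

Global Instance far_filter w : Filter (far w).
Proof.
split.
- by exists 0.
- move=> P Q [r hr] [s hs]; exists (Num.max r s) => x; rewrite gt_max => /andP[rx sx].
  by split; [exact: hr|exact: hs].
- by move=> P Q PQ [r hr]; exists r => x /hr; exact: PQ.
Qed.

Definition growth w m u : Prop := exists C, \forall x \near far w, `|u x| <= C * w x `^ m.

(* Symbols of order [m]: each derivative along a direction [dir i], up to the
   [N]-th one, gains one order of decay in the weight [w]. *)
Fixpoint sym (w : V -> R) (dir : I -> V) N m u : Prop := growth w m u /\
  if N is N'.+1 then (\forall x \near far w, forall i, derivable u x (dir i)) /\
    forall i, sym w dir N' (m - 1) (fun x => 'D_(dir i) u x)
  else True.

Context (w : V -> R) (dir : I -> V) (w_cont : continuous w).
Local Notation growth_w := (growth w).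
Local Notation symb := (sym w dir).

Lemma far_weight : \forall x \near far w, 1 < w x.
Proof. by exists 1. Qed.

Lemma far_gt0 : \forall x \near far w, 0 < w x.
Proof. by exists 0. Qed.

(** Continuity of the weight makes its superlevel sets open, so equalities that hold far out may be
    differentiated. *)
Lemma far_open (P : set V) : (\forall x \near far w, P x) ->
  \forall x \near far w, \forall y \near x, P y.
Proof.
move=> [r hr]; exists r => x rx.
have /(@w_cont x) wx : \forall z \near w x, r < z by exact: lt_nbhsr.
by apply: (@filterS _ (nbhs x) _ (fun y => r < w y)) => // y; exact: hr.
Qed.

Lemma powRDp a m1 m2 : 0 < a :> R -> a `^ (m1 + m2) = a `^ m1 * a `^ m2.
Proof. by move=> a0; rewrite powRD // (gt_eqF a0) implybT. Qed.

Lemma eq_growth m u v : (\forall x \near far w, u x = v x) -> growth_w m u -> growth_w m v.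
Proof. by move=> uv [C hC]; exists C; near=> x; have <- : u x = v x; near: x.
Unshelve. all: by end_near. Qed.

Lemma near_eq_sym N m u v : (\forall x \near far w, u x = v x) -> symb N m u -> symb N m v.
Proof.
elim: N m u v => [|N IH] m u v uv /= [h1 h2]; first by split=> //; exact: eq_growth h1.
have uv' := far_open uv.
have [h3 h4] := h2; split; [exact: eq_growth h1|split].
  near=> x => i; apply: near_eq_derivable; first by near: x; exact: uv'.
  by move: i; near: x.
move=> i; apply: IH (h4 i); near=> x; apply: near_eq_derive.
by near: x; exact: uv'.
Unshelve. all: by end_near. Qed.

Lemma sym_growth N m u : symb N m u -> growth_w m u.
Proof. by case: N => [|N] []. Qed.

Lemma symS N m u : symb N.+1 m u -> symb N m u.
Proof.
elim: N m u => [|N IH] m u [h1 [h2 h3]]; split=> //; split=> // i; exact/IH/h3.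
Qed.

Lemma sym_step N m u (du : I -> V -> R) : growth_w m u ->
  (\forall x \near far w, forall i, is_derive x (dir i) u (du i x)) ->
  (forall i, symb N (m - 1) (du i)) -> symb N.+1 m u.
Proof.
move=> h1 h2 h3; split=> //; split.
  by near=> x => i; have [] : is_derive x (dir i) u (du i x) by move: i; near: x.
move=> i; apply: near_eq_sym (h3 i); near=> x.
by have [] : is_derive x (dir i) u (du i x) by move: i; near: x.
Unshelve. all: by end_near. Qed.

Lemma sym_derive N m u : symb N.+1 m u ->
  \forall x \near far w, forall i, is_derive x (dir i) u ('D_(dir i) u x).
Proof.
by move=> [_ [h _]]; near=> x => i; apply: derivableP; move: i; near: x.
Unshelve. all: by end_near. Qed.

Lemma growth_ge0 m u : growth_w m u -> exists2 C, 0 <= C & \forall x \near far w, `|u x| <= C * w x `^ m.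
Proof.
move=> [C hC]; exists (Num.max C 0); first by rewrite le_max lexx orbT.
near=> x; apply: (@le_trans _ _ (C * w x `^ m)); first by near: x.
by rewrite ler_wpM2r ?powR_ge0 // le_max lexx.
Unshelve. all: by end_near. Qed.

Lemma growth_le m1 m2 u : m1 <= m2 -> growth_w m1 u -> growth_w m2 u.
Proof.
move=> m12 /growth_ge0[C C0 hC]; exists C; near=> x.
apply: (@le_trans _ _ (C * w x `^ m1)); first by near: x.
by rewrite ler_wpM2l // ler_powR // ltW //; near: x; exact: far_weight.
Unshelve. all: by end_near. Qed.

Lemma sym_le N m1 m2 u : m1 <= m2 -> symb N m1 u -> symb N m2 u.
Proof.
elim: N m1 m2 u => [|N IH] m1 m2 u m12 [h1 h2]; first by split=> //; exact: growth_le h1.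
have [h3 h4] := h2; split; [exact: growth_le h1|split=> // i].
by apply: IH (h4 i); rewrite lerD2r.
Qed.

Lemma growthD m u v : growth_w m u -> growth_w m v -> growth_w m (fun x => u x + v x).
Proof.
move=> [C hC] [D hD]; exists (C + D); near=> x; rewrite mulrDl.
by apply: (le_trans (ler_normD _ _)); apply: lerD; near: x.
Unshelve. all: by end_near. Qed.

Lemma growthM m1 m2 u v : growth_w m1 u -> growth_w m2 v -> growth_w (m1 + m2) (fun x => u x * v x).
Proof.
move=> [C hC] [D hD]; exists (C * D); near=> x.
rewrite normrM powRDp; last by near: x; exact: far_gt0.
by rewrite mulrACA; apply: ler_pM => //; near: x.
Unshelve. all: by end_near. Qed.

Lemma symD N m u v : symb N m u -> symb N m v -> symb N m (fun x => u x + v x).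
Proof.
elim: N m u v => [|N IH] m u v hu hv.
  by split=> //; apply: growthD; [exact: sym_growth hu|exact: sym_growth hv].
apply: (@sym_step _ _ _ (fun i x => 'D_(dir i) u x + 'D_(dir i) v x)).
- by apply: growthD; [exact: sym_growth hu|exact: sym_growth hv].
- near=> x => i; apply: is_derive_addf; move: i; near: x; [exact: sym_derive hu|exact: sym_derive hv].
- by have [_ [_ hu']] := hu; have [_ [_ hv']] := hv => i; exact: IH (hu' i) (hv' i).
Unshelve. all: by end_near. Qed.

Lemma symM N m1 m2 u v : symb N m1 u -> symb N m2 v -> symb N (m1 + m2) (fun x => u x * v x).
Proof.
elim: N m1 m2 u v => [|N IH] m1 m2 u v hu hv.
  by split=> //; apply: growthM; [exact: sym_growth hu|exact: sym_growth hv].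
apply: (@sym_step _ _ _ (fun i x => 'D_(dir i) u x * v x + u x * 'D_(dir i) v x)).
- by apply: growthM; [exact: sym_growth hu|exact: sym_growth hv].
- near=> x => i; apply: is_derive_mulf; move: i; near: x; [exact: sym_derive hu|exact: sym_derive hv].
- have [_ [_ hu']] := hu; have [_ [_ hv']] := hv => i; apply: symD.
    by rewrite addrAC; apply: IH (hu' i) (symS hv).
  by rewrite -addrA; apply: IH (symS hu) (hv' i).
Unshelve. all: by end_near. Qed.

Lemma growth_cst m c : 0 <= m -> growth_w m (fun=> c).
Proof.
move=> m0; apply: (@growth_le 0) => //; exists `|c|; near=> x.
by rewrite powRr0 mulr1.
Unshelve. all: by end_near. Qed.

Lemma sym_zero N m : symb N m (fun=> 0).
Proof.
elim: N m => [|N IH] m; first by split=> //; exists 0; near=> x; rewrite normr0 mul0r.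
apply: (@sym_step _ _ _ (fun _ _ => 0)) => //.
  by exists 0; near=> x; rewrite normr0 mul0r.
by near=> x => i; exact: is_derive_cstf.
Unshelve. all: by end_near. Qed.

Lemma sym_cst N m c : 0 <= m -> symb N m (fun=> c).
Proof.
move=> m0; case: N => [|N]; first by split=> //; exact: growth_cst.
apply: (@sym_step _ _ _ (fun _ _ => 0)); first exact: growth_cst.
  by near=> x => i; exact: is_derive_cstf.
by move=> i; exact: sym_zero.
Unshelve. all: by end_near. Qed.

Lemma symZ N m c u : symb N m u -> symb N m (fun x => c * u x).
Proof. by move=> hu; rewrite -[m]add0r; apply: symM => //; exact: sym_cst. Qed.

Lemma sym_opp N m u : symb N m u -> symb N m (fun x => - u x).
Proof. by move=> /(symZ (-1)); apply: near_eq_sym; near=> x; rewrite mulN1r. Unshelve. all: by end_near. Qed.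

Lemma sym_sum N m (J : Type) (r : seq J) (P : pred J) (u : J -> V -> R) :
  (forall j, symb N m (u j)) -> symb N m (fun x => \sum_(j <- r | P j) u j x).
Proof.
move=> hu; elim: r => [|j r IH].
  by apply: near_eq_sym (sym_zero N m); near=> x; rewrite big_nil.
have [Pj|Pj] := boolP (P j).
  by apply: near_eq_sym (symD (hu j) IH); near=> x; rewrite big_cons Pj.
by apply: near_eq_sym IH; near=> x; rewrite big_cons (negPf Pj).
Unshelve. all: by end_near. Qed.

(** Ellipticity with a positive sign: the reciprocal of such a symbol is a symbol of the opposite
    order. *)
Definition bounded_below m u : Prop :=
  exists2 c, 0 < c & \forall x \near far w, c * w x `^ m <= u x.

Lemma growthV m u : bounded_below m u -> growth_w (- m) (fun x => (u x)^-1).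
Proof.
move=> [c c0 hc]; exists c^-1; near=> x.
have w0 : 0 < w x by near: x; exact: far_gt0.
have cw : 0 < c * w x `^ m by rewrite mulr_gt0 // powR_gt0.
have cu : c * w x `^ m <= u x by near: x.
have u0 : 0 < u x := lt_le_trans cw cu.
by rewrite powRN -invfM gtr0_norm ?invr_gt0 // lef_pV2 // posrE.
Unshelve. all: by end_near. Qed.

Lemma symV N m u : bounded_below m u -> symb N m u -> symb N (- m) (fun x => (u x)^-1).
Proof.
move=> hb; elim: N => [|N IH] hu; first by split=> //; exact: growthV.
apply: (@sym_step _ _ _ (fun i x => - 1 * ('D_(dir i) u x * ((u x)^-1 * (u x)^-1)))).
- exact: growthV.
- have [c c0 hc] := hb; near=> x => i.
  have w0 : 0 < w x by near: x; exact: far_gt0.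
  have cw : 0 < c * w x `^ m by rewrite mulr_gt0 // powR_gt0.
  have cu : c * w x `^ m <= u x by near: x.
  have u0 : u x != 0 by rewrite gt_eqF // (lt_le_trans cw cu).
  apply: is_derive_eqf.
    apply: (is_derive_invf (a := 'D_(dir i) u x)) u0 _; move: i; near: x; exact: sym_derive hu.
  by rewrite expr2 invfM mulN1r mulNr.
- have [_ [_ hu']] := hu; have uV := IH (symS hu) => i; apply: symZ.
  rewrite (_ : - m - 1 = (m - 1) + (- m - m)); last by ring.
  exact: symM (hu' i) (symM uV uV).
Unshelve. all: by end_near. Qed.

End Symbols.

(** * Asymptotics of omega *)

Section Barrier.
Context {R : realType}.
Implicit Types (u v z c e : R -> R) (s t : R).

Lemma is_derive_cvg_right v s l : is_derive s 1 v l -> v x @[x --> s^'+] --> v s.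
Proof.
move=> [/derivable1_diffP/differentiable_continuous cv _].
exact: cvg_at_right_filter.
Qed.

(** After the last time [t] at which [v <= M], the function stays above [M] and cannot increase
    there, so it could not have risen above [M]. *)
Lemma barrier v (dv : R -> R) (s1 M : R) : (forall s, s1 <= s -> is_derive s 1 v (dv s)) ->
  (forall s, s1 < s -> M < v s -> dv s <= 0) -> v s1 <= M -> forall s, s1 <= s -> v s <= M.
Proof.
move=> dvE dv_le vs1 s s1s; rewrite leNgt; apply/negP => Mv.
pose S := [set t | [/\ s1 <= t, t <= s & v t <= M]].
have hS : has_sup S by split; [exists s1|exists s => t []].
pose t := sup S.
have t_ge : s1 <= t by apply: ub_le_sup => //; case: hS.
have t_le : t <= s by apply: ge_sup; [case: hS|move=> ? []].
have vt : v t <= M.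
  rewrite leNgt; apply/negP => Mvt.
  have [/derivable1_diffP/differentiable_continuous cv _] := dvE _ t_ge.
  have e0 : 0 < v t - M by rewrite subr_gt0.
  move/cvgrPdist_lt : cv => /(_ _ e0)/nbhs_ballP[d /= d0 hd].
  have [x [x1 x2 x3] tx] := sup_adherent d0 hS.
  have xt : x <= t by apply: ub_le_sup; [case: hS|].
  have := hd x; rewrite /ball /= ger0_norm ?subr_ge0 // => /(_ _); rewrite ltrBlDr -ltrBlDl.
  by move=> /(_ tx); rewrite ltr_norml => /andP[]; lra.
have ts : t < s by rewrite lt_neqAle t_le andbT; apply/eqP => E; move: Mv; rewrite -E ltNge vt.
have [|x tx _|c [tc cs E]] := @MVT_right R v dv t s ts.
- exact: is_derive_cvg_right (dvE _ t_ge).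
- by apply: dvE; exact: le_trans t_ge (ltW tx).
have Mvc : M < v c.
  rewrite ltNge; apply/negP => vc; have : c <= t.
    by apply: ub_le_sup; [case: hS|split=> //; [exact: le_trans t_ge (ltW tc)|exact: ltW]].
  by rewrite leNgt tc.
have := dv_le c (le_lt_trans t_ge tc) Mvc; have := subr_gt0 t s; rewrite ts; nra.
Qed.

Lemma nondecreasing_right v (dv : R -> R) (s1 : R) : (forall s, s1 <= s -> is_derive s 1 v (dv s)) ->
  (forall s, s1 < s -> 0 <= dv s) -> forall s t, s1 <= s -> s <= t -> v s <= v t.
Proof.
move=> dvE dv_ge s t s1s; rewrite le_eqVlt => /orP[/eqP-> //|st].
have [|x tx _|c [tc cs E]] := @MVT_right R v dv s t st.
- exact: is_derive_cvg_right (dvE _ s1s).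
- by apply: dvE; exact: le_trans s1s (ltW tx).
by have := dv_ge c (le_lt_trans s1s tc); nra.
Qed.

Definition idw : R -> R := fun x => x.
Definition sym1 N (m : R) u : Prop := sym idw (fun _ : unit => 1) N m u.

Lemma idw_cont : continuous idw.
Proof. by move=> x; exact: cvg_id. Qed.

Lemma eq_sym1 N m u v : (\forall s \near far idw, u s = v s) -> sym1 N m u -> sym1 N m v.
Proof. exact: (near_eq_sym idw_cont). Qed.

Lemma sym1_step N m u (du : R -> R) : growth idw m u ->
  (\forall s \near far idw, is_derive (s : R) (1 : R) u (du s)) -> sym1 N (m - 1) du -> sym1 N.+1 m u.
Proof.
move=> h1 h2 h3; apply: (sym_step idw_cont (du := fun _ => du)) => //.
by apply: filterS h2 => x dx _.
Qed.

Lemma far_idw (P : set R) : (\forall s \near far idw, P s) -> exists r, forall s, r < s -> P s.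
Proof. by []. Qed.

Lemma far_gt (r : R) : \forall s \near far idw, r < s.
Proof. by exists r. Qed.

(* For [v = z s^k] the equation reads [v' = - (c - k / s) v + e s^k], where the
   damping [c - k / s] is eventually at least [c0 / 2]. *)
Lemma damped_growth (k : nat) (c0 : R) z c e : 0 < c0 ->
  (\forall s \near far idw, is_derive (s : R) (1 : R) z (- c s * z s + e s)) ->
  (\forall s \near far idw, c0 <= c s) ->
  growth idw (- k%:R) e -> growth idw (- k%:R) z.
Proof.
move=> c0_gt0 hz hc [C hC].
have [r hr] : exists r, forall s, r < s -> [/\ is_derive s 1 z (- c s * z s + e s), c0 <= c s,
    `|e s| <= C * s `^ (- k%:R), 1 < s & 2 * k%:R / c0 < s].
  apply: far_idw; near=> s; split; near: s => //; exact: far_gt.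
pose s1 := r + 1; pose v s := z s * s ^+ k.
pose dv s := (- c s * z s + e s) * s ^+ k + z s * (k%:R * s ^+ k.-1 * 1).
have rs s : s1 <= s -> r < s by rewrite /s1; lra.
have dvE s : s1 <= s -> is_derive s 1 v (dv s).
  by move=> /rs/hr[dz _ _ _ _]; rewrite /v; derive_rules.
(* At height [2 C / c0] the damping [c0 / 2] balances the bound [C] of the source; the other entry
   takes care of the starting point. *)
pose M := Num.max `|v s1| (2 * C / c0).
have M_ge : 2 * C / c0 <= M by rewrite /M le_max lexx orbT.
have M0 : 0 <= M by rewrite /M le_max normr_ge0.
have M1 : `|v s1| <= M by rewrite /M le_max lexx.
have dvE' s : s1 < s -> exists2 a, c0 / 2 <= a & `|dv s + a * v s| <= C.
  move=> /ltW/rs/hr[dz hcs he s_gt1 sk].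
  have s0 : 0 < s by lra.
  have sn0 : s != 0 by rewrite gt_eqF.
  exists (c s - k%:R / s).
    have : k%:R / s <= c0 / 2.
      rewrite ler_pdivrMr //; move: sk; rewrite ltr_pdivrMr //; lra.
    lra.
  have -> : dv s + (c s - k%:R / s) * v s = e s * s ^+ k.
    rewrite /dv /v; case: (k) => [|j] /=; first by rewrite expr0; field.
    by rewrite exprS; field.
  rewrite normrM (gtr0_norm (exprn_gt0 k s0)) -ler_pdivlMr ?exprn_gt0 //.
  by rewrite -powR_invn // ltW.
have C0 : C <= c0 / 2 * M.
  by move: M_ge; rewrite ler_pdivrMr //; lra.
have ub s : s1 <= s -> v s <= M.
  apply: (barrier dvE) => [t t1 Mv|]; last exact: le_trans (ler_norm _) M1.
  have [a ca] := dvE' t t1; rewrite ler_norml => /andP[_]; nra.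
have lb s : s1 <= s -> - v s <= M.
  apply: (@barrier (fun s => - v s) (fun s => - dv s) s1 M) => [t t1|t t1 Mv|].
  - by have dvt := dvE _ t1; derive_rules.
  - have [a ca] := dvE' t t1; rewrite ler_norml => /andP[+ _]; nra.
  - by apply: le_trans M1; rewrite -normrN ler_norm.
exists M; exists s1 => s /ltW s1s.
have [_ _ _ s_gt1 _] := hr s (rs s s1s).
have s0 : 0 < s by lra.
have -> : idw s `^ (- k%:R) = (s ^+ k)^-1 by rewrite powR_invn // ltW.
rewrite ler_pdivlMr ?exprn_gt0 //.
rewrite -[X in _ * X](gtr0_norm (exprn_gt0 k s0)) -normrM -/(v s) ler_norml ub // andbT.
by rewrite lerNl lb.
Unshelve. all: by end_near. Qed.

(** The derivative [z'] solves an equation with the same damping and the source [- c' z + e'], whose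
    order is one lower. *)
Lemma damped_sym N (k : nat) (c0 : R) z c e : 0 < c0 ->
  (\forall s \near far idw, is_derive (s : R) (1 : R) z (- c s * z s + e s)) ->
  (\forall s \near far idw, c0 <= c s) ->
  sym1 N 0 c -> sym1 N (- k%:R) e -> sym1 N (- k%:R) z.
Proof.
move=> c0_gt0; elim: N k z e => [|N IH] k z e hz hc sc se.
  by split=> //; apply: damped_growth hz hc _ => //; exact: sym_growth se.
(* The source of the differentiated equation contains [z] itself, so its first [N] derivatives are
   controlled beforehand. *)
have sz := IH k z e hz hc (symS sc) (symS se).
apply: (sym1_step (du := fun s => - c s * z s + e s)) => //; first exact: sym_growth sz.
rewrite (_ : - k%:R - 1 = - k.+1%:R); last by rewrite -natr1 opprD.
have [_ [dc sc']] := sc; have [_ [de se']] := se.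
apply: (IH k.+1 _ (fun s => - ('D_1 c s) * z s + 'D_1 e s)) => //.
- have dcf : \forall s \near far idw, is_derive (s : R) (1 : R) c ('D_1 c s).
    by apply: filterS (sym_derive sc) => s /(_ tt).
  have def : \forall s \near far idw, is_derive (s : R) (1 : R) e ('D_1 e s).
    by apply: filterS (sym_derive se) => s /(_ tt).
  near=> s.
  have dz : is_derive s 1 z (- c s * z s + e s) by near: s.
  have dcs : is_derive s 1 c ('D_1 c s) by near: s.
  have des : is_derive s 1 e ('D_1 e s) by near: s.
  derive_step.
  by rewrite /=; ring.
- exact: symS sc.
- apply: symD; first exact: idw_cont.
  + rewrite (_ : - k.+1%:R = (0 - 1) + - k%:R); last by rewrite -natr1; ring.
    apply: symM; [exact: idw_cont|apply: sym_opp; [exact: idw_cont|exact: sc' tt]|exact: sz].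
  + by rewrite (_ : - k.+1%:R = - k%:R - 1); [exact: se' tt|rewrite -natr1; ring].
Unshelve. all: by end_near. Qed.

Lemma sym1_inv N : sym1 N (-1) (fun s => s^-1).
Proof.
apply: symV; first exact: idw_cont.
  by exists 1 => //; exists 0 => s s0; rewrite powRr1 ?mul1r // ltW.
case: N => [|N].
  by split=> //; exists 1; exists 0 => s s0; rewrite mul1r powRr1 ?gtr0_norm // ltW.
apply: (sym1_step (du := fun=> 1)).
- by exists 1; exists 0 => s s0; rewrite mul1r powRr1 ?gtr0_norm // ltW.
- by exists 0 => s _; exact: is_derive_idf.
- by apply: sym_cst; [exact: idw_cont|rewrite subrr].
Qed.

Lemma sym1M N m1 m2 m u v : sym1 N m1 u -> sym1 N m2 v -> m1 + m2 <= m ->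
  sym1 N m (fun s => u s * v s).
Proof.
by move=> hu hv hm; apply: sym_le hm _; apply: symM => //; exact: idw_cont.
Qed.

Lemma sym1D N m u v : sym1 N m u -> sym1 N m v -> sym1 N m (fun s => u s + v s).
Proof. exact: (symD idw_cont). Qed.

Lemma sym1N N m u : sym1 N m u -> sym1 N m (fun s => - u s).
Proof. exact: (sym_opp idw_cont). Qed.

Lemma sym1_cst N m (a : R) : 0 <= m -> sym1 N m (fun=> a).
Proof. exact: (@sym_cst _ _ _ _ _ idw_cont). Qed.

Lemma sym1_le N m1 m2 u : m1 <= m2 -> sym1 N m1 u -> sym1 N m2 u.
Proof. exact: sym_le. Qed.

Lemma sym1Z N m (a : R) u : sym1 N m u -> sym1 N m (fun s => a * u s).
Proof. exact: (symZ idw_cont). Qed.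

Lemma sym1V0 N (a : R) u : 0 < a -> (forall s, 0 < s -> a <= u s) -> sym1 N 0 u ->
  sym1 N 0 (fun s => (u s)^-1).
Proof.
move=> a0 ua hu; rewrite -[0]oppr0; apply: (symV idw_cont) hu.
by exists a => //; exists 0 => s s0; rewrite powRr0 mulr1 ua.
Qed.

End Barrier.

(** * A priori bounds, the limit of [omega] and the decay of its derivatives *)

Section SolitonAsymptotics.
Context {R : realType} (n : nat) (omega : R -> R).
Context (omega_smooth : half_smooth omega)
  (omega_gt0 : forall s : R, 0 <= s -> 0 < omega s)
  (omega_eq : omega_ode n omega) (omega0 : omega 0 = 1)
  (hn : (3 <= n)%N) (domega0 : half_derive omega 0 < 0).
Implicit Types (s t : R).

Local Notation nu := (n%:R - 2 : R).
Local Notation y := (half_derive omega).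
Local Notation y1 := (half_derive (half_derive omega)).

Let nu_ge1 : 1 <= nu. Proof. by have : 3 <= n%:R :> R; [rewrite (ler_nat R 3)|lra]. Qed.
Let y_lt0 s : 0 <= s -> y s < 0. Proof. by move=> s0; apply: (@domega_lt0 R n omega). Qed.
Let w_le1 s : 0 <= s -> omega s <= 1. Proof. by move=> s0; apply: (@omega_le1 R n omega). Qed.
Let dw s : 0 < s -> is_derive s 1 omega (y s). Proof. by move=> s0; exact: half_smooth_is_derive. Qed.
Let dy s : 0 < s -> is_derive s 1 y (y1 s).
Proof. by move=> s0; apply: half_smooth_is_derive => //; exact: half_smooth_half_derive. Qed.

Lemma ddomegaE s : 0 < s -> y1 s = nu * (omega s - 1) / (2 * s ^+ 2)
  + y s ^+ 2 / (2 * omega s) - y s / (4 * omega s) - nu * y s / (2 * s * omega s).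
Proof.
move=> s0; have := omega_eq (ltW s0); rewrite /= => E.
have w0 := omega_neq0 omega_gt0 (ltW s0); have sn0 : s != 0 by rewrite gt_eqF.
apply: (@mulfI _ (4 * s ^+ 2 * omega s)); first by rewrite !mulf_neq0 ?expf_neq0 // pnatr_eq0.
by rewrite E; field; rewrite w0 sn0.
Qed.

(** For [s >= 16] the equation gives [v' <= nu / 2 - v / 8]: the damping contributes [- v / 4], and
    the factor [s^2] at most [v / 8]. Hence the threshold [4 nu]. *)
Lemma sqr_domega_bound : exists2 C, 0 <= C & forall s, 16 <= s -> - (s ^+ 2 * y s) <= C.
Proof.
pose v s := - (s ^+ 2 * y s).
exists (Num.max (v 16) (4 * nu)); first by have := nu_ge1; rewrite le_max => h; apply/orP; right; lra.
apply: (@barrier _ v (fun s => - (2 * s * y s + s ^+ 2 * y1 s))) => [s s16|s s16|]; last first.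
- by rewrite le_max lexx.
- rewrite gt_max => /andP[_ vs]; have s0 : 0 < s by lra.
  have sn0 : s != 0 by rewrite gt_eqF.
  have w0 := omega_gt0 (ltW s0); have w1 := w_le1 (ltW s0); have ys := y_lt0 (ltW s0).
  have wn0 : omega s != 0 by rewrite gt_eqF.
  have -> : s ^+ 2 * y1 s = nu * (omega s - 1) / 2
      + (2 * s ^+ 2 * y s ^+ 2 - s ^+ 2 * y s - 2 * nu * s * y s) / (4 * omega s).
    by rewrite ddomegaE //; field; rewrite sn0 wn0.
  have k0 : s ^+ 2 * (- y s) / 4 <=
      (2 * s ^+ 2 * y s ^+ 2 - s ^+ 2 * y s - 2 * nu * s * y s) / (4 * omega s).
    rewrite ler_pdivlMr ?mulr_gt0 //.
    have h1 : 0 <= s ^+ 2 * (- y s) by rewrite mulr_ge0 ?sqr_ge0 //; lra.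
    have h2 : 0 <= s ^+ 2 * y s ^+ 2 by rewrite mulr_ge0 ?sqr_ge0.
    have h3 : 0 <= nu * s * (- y s) by rewrite !mulr_ge0 //; [have := nu_ge1; lra|exact: ltW|lra].
    by nra.
  have k1 : - nu / 2 <= nu * (omega s - 1) / 2 by have := nu_ge1; nra.
  have k2 : 16 * (s * (- y s)) <= s ^+ 2 * (- y s).
    by rewrite expr2 -mulrA ler_wpM2r ?mulr_ge0 //; lra.
  by move: vs; rewrite /v; lra.
- have s0 : 0 < s by lra.
  by have dys := dy s0; rewrite /v; derive_step; rewrite /=; ring.
Qed.

(** Dividing by [omega] yields a bound on the logarithmic derivative, which keeps [omega] away from
    0. *)
Lemma sqr_dlog_bound : exists2 K, 0 <= K & exists2 s2, 16 <= s2 &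
  forall s, s2 <= s -> - (s ^+ 2 * y s) <= K * omega s.
Proof.
have [C C0 hC] := sqr_domega_bound.
(* After multiplication by [4 omega^2] the damping is [- s^2 (- omega')], and each of three other
   terms costs at most a quarter of it: one by [s >= 32], one by [u > 8 nu], and the quadratic one
   because [s >= 4 C] makes [- omega' <= 1/8]. *)
pose s2 := 32 + 4 * C; have s2_ge : 32 <= s2 by rewrite /s2; lra.
pose u s := - (s ^+ 2 * y s) / omega s.
pose M := Num.max (u s2) (8 * nu).
have M0 : 0 <= M by have := nu_ge1; rewrite /M le_max => h; apply/orP; right; lra.
exists M => //; exists s2; first by lra.
suff H s : s2 <= s -> u s <= M.
  move=> s ss2; rewrite -ler_pdivrMr ?H //; apply: omega_gt0; lra.
move: s; apply: (@barrier _ u (fun s => - (2 * s * y s + s ^+ 2 * y1 s) / omega s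
   + s ^+ 2 * y s ^+ 2 / omega s ^+ 2)) => [s ss2|s ss2|]; last first.
- by rewrite /M le_max lexx.
- rewrite gt_max => /andP[_ us]; have s0 : 0 < s by lra.
  have sn0 : s != 0 by rewrite gt_eqF.
  have w0 := omega_gt0 (ltW s0); have w1 := w_le1 (ltW s0); have ys := y_lt0 (ltW s0).
  have wn0 : omega s != 0 by rewrite gt_eqF.
  have vC : - (s ^+ 2 * y s) <= C by apply: hC; lra.
  have C4 : 4 * C <= s by move: ss2; rewrite /s2; lra.
  have h1 : 0 <= - y s by lra.
  have vw : 8 * nu * omega s < s ^+ 2 * (- y s).
    by move: us; rewrite /u -mulrN ltr_pdivlMr.
  rewrite -(@pmulr_lle0 _ (4 * omega s ^+ 2)); last by rewrite mulr_gt0 // exprn_gt0.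
  rewrite (_ : _ * (4 * omega s ^+ 2) = 8 * s * (- y s) * omega s + 2 * nu * (1 - omega s) * omega s
     + 2 * s ^+ 2 * y s ^+ 2 - s ^+ 2 * (- y s) - 2 * nu * s * (- y s)); last first.
    by rewrite ddomegaE //; field; rewrite sn0 wn0.
  have a1 : 32 * (s * (- y s)) <= s ^+ 2 * (- y s).
    by rewrite expr2 -mulrA ler_wpM2r ?mulr_ge0 //; lra.
  have a2 : 8 * s * (- y s) * omega s <= 4^-1 * (s ^+ 2 * (- y s)).
    by have : 0 <= s * (- y s) by [rewrite mulr_ge0 // ltW]; nra.
  have a3 : 2 * nu * (1 - omega s) * omega s <= 2 * nu * omega s by have := nu_ge1; nra.
  have a4 : s ^+ 2 * y s ^+ 2 <= 8^-1 * (s ^+ 2 * (- y s)).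
    have : - y s <= 8^-1.
      have : 32 * (- y s) * s <= C.
        by apply: le_trans vC; rewrite -mulrN; lra.
      by move=> h; nra.
    have : 0 <= s ^+ 2 * (- y s) by rewrite mulr_ge0 // sqr_ge0.
    by nra.
  have a5 : 0 <= nu * s * (- y s) by rewrite !mulr_ge0 //; [have := nu_ge1; lra|exact: ltW].
  have a6 : 0 <= s ^+ 2 * (- y s) by rewrite mulr_ge0 // sqr_ge0.
  by lra.
- have s0 : 0 < s by lra.
  have wn0 := omega_neq0 omega_gt0 (ltW s0).
  have dys := dy s0; have dws := dw s0; rewrite /u; derive_step => //=.
  by field.
Qed.

(** By the logarithmic bound [omega (1 - K / s)] is nondecreasing far out, and it is positive as
    soon as [s > K]. *)
Lemma omega_lower_bound : exists2 c, 0 < c & forall s, 0 <= s -> c <= omega s.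
Proof.
have [K K0 [s2 s2_ge hK]] := sqr_dlog_bound.
pose s3 := s2 + K; pose W s := omega s * (1 - K / s).
have s3_gt0 : 0 < s3 by rewrite /s3; lra.
have W_le s t : s3 <= s -> s <= t -> W s <= W t.
  apply: (@nondecreasing_right _ W (fun s => y s * (1 - K / s) + omega s * (K / s ^+ 2)))
    => [x xs|x xs].
    have x0 : 0 < x by lra.
    have dwx := dw x0; rewrite /W; derive_step; rewrite /= ?gt_eqF //.
    by field; rewrite gt_eqF.
  have x0 : 0 < x by lra.
  have := hK x; rewrite /s3 in xs => /(_ _); have -> : s2 <= x by lra.
  move=> /(_ isT) h.
  rewrite (_ : _ + _ = (x ^+ 2 * y x + K * omega x) / x ^+ 2 + (- y x) * K / x); last first.
    by field; rewrite gt_eqF.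
  rewrite addr_ge0 ?divr_ge0 ?mulr_ge0 ?sqr_ge0 //; try lra.
  by have := y_lt0 (ltW x0); lra.
have W3 : 0 < W s3.
  rewrite /W mulr_gt0 // ?omega_gt0 ?ltW // subr_gt0 ltr_pdivrMr // mul1r /s3; lra.
have W_ge t : s3 <= t -> W s3 <= omega t.
  move=> ts; apply: le_trans (W_le _ _ (lexx _) ts) _; rewrite /W.
  have t0 : 0 < t by lra.
  have Kt : 0 <= K / t by rewrite divr_ge0 // ltW.
  have := omega_gt0 (ltW t0); nra.
exists (W s3) => // s s0; have [|ss3] := lerP s3 s; first exact: W_ge.
apply: le_trans (W_ge s3 (lexx _)) _.
have [|x sx _|c [sc _ E]] := @MVT_right R omega y s s3 ss3.
- have [<-|s_gt0] := eqVneq 0 s; first exact: half_smooth_cvg0.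
  by apply: is_derive_cvg_right; apply: dw; rewrite lt_neqAle s_gt0.
- by apply: dw; lra.
- by have := y_lt0 (ltW (le_lt_trans s0 sc)); have : 0 < s3 - s; [lra|nra].
Qed.

(** As [omega] decreases, its infimum is its limit at infinity. *)
Definition omega_limit : R := inf [set omega s | s in [set s | 0 <= s]].
Local Notation ell := omega_limit.

Lemma omega_limit_le s : 0 <= s -> ell <= omega s.
Proof.
move=> s0; apply: ge_inf; last by exists s.
by exists 0 => _ [t t0 <-]; exact/ltW/omega_gt0.
Qed.

Lemma omega_limit_gt0 : 0 < ell.
Proof.
have [c c0 hc] := omega_lower_bound; apply: (lt_le_trans c0).
apply: lb_le_inf; first by exists (omega 0), 0 => /=.
by move=> _ [t t0 <-]; exact: hc.
Qed.

Lemma omega_limit_le1 : ell <= 1.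
Proof. by rewrite -omega0; exact: omega_limit_le. Qed.

Lemma sym_domega0 : sym1 0 (-2) y.
Proof.
split=> //; have [C C0 hC] := sqr_domega_bound; exists C; exists 16 => s; rewrite /idw => s16.
have s0 : 0 < s by lra.
have -> : s `^ (-2) = s ^- 2 by rewrite powR_invn // ltW.
rewrite ltr0_norm ?y_lt0 ?(ltW s0) // ler_pdivlMr ?exprn_gt0 //.
by rewrite mulrC mulrN hC // ltW.
Qed.

(** Since [omega - C / s] is nondecreasing and [omega] decreasing, [omega s - C / s] is a lower
    bound of all values of [omega], hence of their infimum. *)
Lemma omega_cvg_rate : growth idw (-1) (fun s => omega s - ell).
Proof.
have [C C0 hC] := sqr_domega_bound; exists C; exists 16 => s; rewrite /idw => s16.
have s0 : 0 < s by lra.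
have s_ge0 := ltW s0.
rewrite ger0_norm ?subr_ge0 ?omega_limit_le // powR_inv1 //.
suff : omega s - C / s <= ell by lra.
apply: lb_le_inf; first by exists (omega 0), 0 => /=.
have incr a b : 16 <= a -> a <= b -> omega a - C / a <= omega b - C / b.
  apply: (@nondecreasing_right _ (fun s => omega s - C / s) (fun s => y s + C / s ^+ 2))
    => [x xs|x xs].
    have x0 : 0 < x by lra.
    have dwx := dw x0; derive_step; rewrite /= ?gt_eqF //.
    by field; rewrite gt_eqF.
  have x0 : 0 < x by lra.
  rewrite (_ : _ + _ = (x ^+ 2 * y x + C) / x ^+ 2); last by field; rewrite gt_eqF.
  by rewrite divr_ge0 ?sqr_ge0 //; have := hC x (ltW xs); lra.
move=> _ [t t0 <-]; have [st|ts] := lerP s t.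
  have := incr s t (ltW s16) st; have : 0 <= C / t by rewrite divr_ge0.
  by lra.
have : 0 <= C / s by rewrite divr_ge0 // ltW.
suff : omega s <= omega t by lra.
have [|x tx _|c [tc _ E]] := @MVT_right R omega y t s ts.
- have [<-|t_gt0] := eqVneq 0 t; first exact: half_smooth_cvg0.
  by apply: is_derive_cvg_right; apply: dw; rewrite lt_neqAle t_gt0.
- by apply: dw; exact: le_lt_trans t0 tx.
- by have := y_lt0 (ltW (le_lt_trans t0 tc)); have : 0 < s - t; [lra|nra].
Qed.

Lemma sym_omega_sub N : sym1 N (-2) y -> sym1 N.+1 (-1) (fun s => omega s - ell).
Proof.
move=> hy; apply: (sym1_step (du := y)); first exact: omega_cvg_rate.
  exists 0 => s s0; have dws := dw s0; derive_step; rewrite /= ?subr0 //; ring.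
by rewrite (_ : -1 - 1 = -2) //; ring.
Qed.

Lemma sym_omega N : sym1 N (-2) y -> sym1 N 0 omega.
Proof.
move=> /sym_omega_sub /(symS) h.
apply: (@eq_sym1 _ _ _ (fun s => (omega s - ell) + ell)); first by exists 0 => s _; rewrite subrK.
by apply: sym1D; [apply: sym1_le h; lra|exact: sym1_cst].
Qed.

Lemma sym_omega_inv N : sym1 N (-2) y -> sym1 N 0 (fun s => (omega s)^-1).
Proof.
move=> /sym_omega; apply: sym1V0 omega_limit_gt0 _ => s s0.
exact: omega_limit_le (ltW s0).
Qed.

(** Bootstrap: the differentiated equation is a damped linear equation for [omega''] whose
    coefficients involve only [1 / s], [omega] and [omega'], already controlled to order [N]. *)
Lemma sym_domega N : sym1 N (-2) y.
Proof.
elim: N => [|N hy]; first exact: sym_domega0.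
have hw := sym_omega hy; have hwV := sym_omega_inv hy; have hs := @sym1_inv R N.
(* All three terms are nonnegative, and the first is at least [1/4] because [omega <= 1]. *)
pose c s := 4^-1 * (omega s)^-1 + (- y s * (omega s)^-1 + nu / 2 * (s^-1 * (omega s)^-1)).
pose a s := (omega s)^-1 * (omega s)^-1.
pose b s := s^-1 * s^-1.
have ha : sym1 N 0 a by apply: (sym1M hwV hwV); lra.
have hb : sym1 N (-2) b by apply: (sym1M hs hs); lra.
have hyy : sym1 N (-4) (fun s => y s * y s) by apply: (sym1M hy hy); lra.
(* The order -3 is dictated by the term with [omega - 1], which does not decay; the others have
   order at most -4. *)
pose e s := 4^-1 * (y s * y s * a s) + nu / 2 * (y s * b s) + - nu * ((omega s - 1) * (s^-1 * b s))
  + - 2^-1 * (y s * (y s * y s * a s)) + nu / 2 * (y s * b s * (omega s)^-1)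
  + nu / 2 * (y s * y s * a s * s^-1).
have he : sym1 N (-3) e.
  have h1 : sym1 N (-4) (fun s => y s * y s * a s) by apply: (sym1M hyy ha); lra.
  have h2 : sym1 N (-4) (fun s => y s * b s) by apply: (sym1M hy hb); lra.
  rewrite /e; repeat apply: sym1D.
  - by apply: sym1Z; apply: sym1_le h1; lra.
  - by apply: sym1Z; apply: sym1_le h2; lra.
  - apply: sym1Z; apply: (@sym1M _ _ 0 (-3)); last by lra.
      by apply: sym1D hw _; apply: sym1_cst.
    by apply: (sym1M hs hb); lra.
  - by apply: sym1Z; apply: (sym1M hy h1); lra.
  - by apply: sym1Z; apply: (sym1M h2 hwV); lra.
  - by apply: sym1Z; apply: (sym1M h1 hs); lra.
have hc : sym1 N 0 c.
  rewrite /c; repeat apply: sym1D.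
  - exact: sym1Z.
  - by apply: (sym1M (sym1N hy) hwV); lra.
  - by apply: sym1Z; apply: (sym1M hs hwV); lra.
have hy1 : sym1 N (- 3%:R) y1.
  apply: (damped_sym (c0 := 4^-1) _ _ _ hc he) => //.
  - exists 0 => s; rewrite /idw => s0; have sn0 : s != 0 by rewrite gt_eqF.
    have wn0 := omega_neq0 omega_gt0 (ltW s0).
    have dys := dy s0; have dws := dw s0.
    apply: (@near_eq_is_derive _ _ _ (fun s => nu * (omega s - 1) / (2 * s ^+ 2)
      + y s ^+ 2 / (2 * omega s) - y s / (4 * omega s) - nu * y s / (2 * s * omega s))).
      by near=> t; rewrite ddomegaE //; near: t; exact: lt_nbhsr.
    have n1 : 2 * s ^+ 2 != 0 by rewrite mulf_neq0 ?expf_neq0 // pnatr_eq0.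
    have n2 : 2 * omega s != 0 by rewrite mulf_neq0 // pnatr_eq0.
    have n3 : 4 * omega s != 0 by rewrite mulf_neq0 // pnatr_eq0.
    have n4 : 2 * s * omega s != 0 by rewrite !mulf_neq0 // pnatr_eq0.
    derive_step => //.
    rewrite /= /c /e /a /b ddomegaE //; field; by rewrite sn0 wn0.
  - exists 0 => s; rewrite /idw => s0.
    have w0 := omega_gt0 (ltW s0); have w1 := w_le1 (ltW s0); have ys := y_lt0 (ltW s0).
    have wV : 1 <= (omega s)^-1 by rewrite -invr1 lef_pV2 ?posrE.
    have : 0 <= s^-1 * (omega s)^-1 by rewrite mulr_ge0 // invr_ge0 ltW.
    have := nu_ge1; rewrite /c; nra.
apply: (sym1_step (du := y1)); first exact: sym_growth sym_domega0.
  by exists 0 => s; exact: dy.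
by rewrite (_ : -2 - 1 = - 3%:R) //; ring.
Unshelve. all: by end_near. Qed.

End SolitonAsymptotics.

(** * Orders of the curvature, of the potential and of the metric coefficients at the end *)

Section SolitonSymbols.
Context {R : realType} (n : nat) (omega : R -> R).
Context (omega_smooth : half_smooth omega)
  (omega_gt0 : forall s : R, 0 <= s -> 0 < omega s)
  (omega_eq : omega_ode n omega) (omega0 : omega 0 = 1)
  (hn : (3 <= n)%N) (domega0 : half_derive omega 0 < 0).
Implicit Types (s t : R).

Local Notation y := (half_derive omega).
Local Notation ell := (omega_limit omega).
Local Notation q := (curv omega).
Local Notation q' := (dcurv omega).
Local Notation p := (grad_coef n omega).
Local Notation Rs := (scal_coef n omega).
Local Notation phi := (soliton_potential n omega).

Let sy N : sym1 N (-2) y. Proof. exact: (sym_domega omega_smooth omega_gt0 omega_eq omega0). Qed.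
Let sw N : sym1 N 0 omega. Proof. exact: (sym_omega omega_smooth omega_gt0 omega_eq omega0). Qed.
Let swV N : sym1 N 0 (fun s => (omega s)^-1).
Proof. exact: (sym_omega_inv omega_smooth omega_gt0 omega_eq omega0). Qed.
Let w_neq0 s : 0 < s -> omega s != 0. Proof. by move=> s0; rewrite gt_eqF // omega_gt0 // ltW. Qed.
Let p_ge s : 0 < s -> 2^-1 <= p s. Proof. by move=> s0; apply: grad_coef_ge => //; exact: ltW. Qed.
Let p_neq0 s : 0 < s -> p s != 0. Proof. by move=> /p_ge h; rewrite gt_eqF //; lra. Qed.
Let Rs_gt0 s : 0 < s -> 0 < Rs s. Proof. by move=> s0; apply: scal_coef_gt0 => //; exact: ltW. Qed.

Lemma sym_curv N : sym1 N (-1) q.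
Proof.
apply: (@eq_sym1 _ _ _ (fun s => (1 - omega s) * s^-1)).
  exists 0 => s; rewrite /idw => s0; have sn0 : s != 0 by rewrite gt_eqF.
  by apply: (mulIf sn0); rewrite divfK // [omega s in LHS]omegaE //; ring.
apply: (sym1M _ (@sym1_inv R N) (m1 := 0)); last by lra.
by apply: sym1D; [exact: sym1_cst|exact: sym1N].
Qed.

(** Since [s q' = - omega' - q], no separate estimate of [q'] is needed. *)
Lemma sym_s_dcurv N : sym1 N (-1) (fun s => s * q' s).
Proof.
apply: (@eq_sym1 _ _ _ (fun s => - y s + - q s)).
  by exists 0 => s; rewrite /idw => s0; rewrite half_derive_omega // ?ltW //; ring.
apply: sym1D; last exact/sym1N/sym_curv.
by apply: sym1N; apply: sym1_le (sy N); lra.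
Qed.

Lemma sym_grad_coef N : sym1 N (-1) (fun s => p s - 2^-1).
Proof.
apply: (@eq_sym1 _ _ _ (fun s => (n%:R - 1) * q s + s * q' s)).
  by exists 0 => s _; rewrite /grad_coef; ring.
by apply: sym1D; [apply: sym1Z; exact: sym_curv|exact: sym_s_dcurv].
Qed.

Lemma sym_grad_coef0 N : sym1 N 0 p.
Proof.
apply: (@eq_sym1 _ _ _ (fun s => (p s - 2^-1) + 2^-1)); first by exists 0 => s _; rewrite subrK.
by apply: sym1D; [apply: sym1_le (sym_grad_coef N); lra|exact: sym1_cst].
Qed.

Lemma sym_grad_coef_inv N : sym1 N 0 (fun s => (p s)^-1).
Proof. by apply: (@sym1V0 _ _ 2^-1) (sym_grad_coef0 N) => //; lra. Qed.

Lemma sym_rate N : sym1 N 0 (fun s => omega s / p s).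
Proof. by apply: (sym1M (sw N) (sym_grad_coef_inv N)); lra. Qed.

Lemma sym_scal_coef N : sym1 N (-1) Rs.
Proof.
apply: (@eq_sym1 _ _ _ (fun s => (n%:R - 1) * (n%:R * q s + 2 * (s * q' s)))).
  by exists 0 => s _; rewrite /scal_coef; ring.
apply: sym1Z; apply: sym1D; apply: sym1Z; [exact: sym_curv|exact: sym_s_dcurv].
Qed.

(* [4 phi = s * denom / omega] with [denom -> 1]. *)
Let denom s := 4 * (p s * p s) + 4 * (Rs s * (omega s * s^-1)).

Let denom_ge s : 0 < s -> 1 <= denom s.
Proof.
move=> s0; have := p_ge s0 => hp; have w0 := omega_gt0 (ltW s0).
have h1 : 0 <= Rs s * (omega s * s^-1).
  apply: mulr_ge0; first exact/ltW/Rs_gt0.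
  by apply: mulr_ge0; [exact: ltW|rewrite invr_ge0; exact: ltW].
rewrite /denom; nra.
Qed.

Let potentialE s : 0 < s -> phi s = s * denom s / (4 * omega s).
Proof.
by move=> s0; rewrite /soliton_potential /denom; field; rewrite w_neq0 // gt_eqF.
Qed.

Let sym_ws N : sym1 N (-1) (fun s => omega s * s^-1).
Proof. by apply: (sym1M (sw N) (@sym1_inv R N)); lra. Qed.

Let sym_denom N : sym1 N 0 denom.
Proof.
apply: sym1D; apply: sym1Z.
  by apply: (sym1M (sym_grad_coef0 N) (sym_grad_coef0 N)); lra.
by apply: (sym1M (sym_scal_coef N) (sym_ws N)); lra.
Qed.

(** On the end [4 f = r^2], so [s / (4 phi s)] is the tangential coefficient of the pulled-back
    metric. It equals [omega / denom], and [denom - 1] has order -1. *)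
Lemma sym_tangential N : sym1 N (-1) (fun s => s / (4 * phi s) - ell).
Proof.
have sdV : sym1 N 0 (fun s => (denom s)^-1) by exact: (@sym1V0 _ _ 1 _ ltr01 denom_ge (sym_denom N)).
apply: (@eq_sym1 _ _ _ (fun s => (- 4 * ((p s - 2^-1) * (p s + 2^-1)) + - 4 * (Rs s * (omega s * s^-1)))
    * (omega s * (denom s)^-1) + (omega s - ell))).
  exists 0 => s; rewrite /idw => s0; have w0 := w_neq0 s0; have sn0 : s != 0 by rewrite gt_eqF.
  have d0 : denom s != 0 by rewrite gt_eqF // (lt_le_trans _ (denom_ge s0)).
  rewrite potentialE // (_ : s / _ = omega s / denom s); last by field; rewrite w0 sn0 d0.
  rewrite (_ : - 4 * _ + - 4 * _ = 1 - denom s); first by field; rewrite d0.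
  by rewrite /denom; field.
apply: sym1D; last first.
  have h := sym_omega_sub omega_smooth omega_gt0 omega_eq omega0 hn domega0 (sy N).
  exact: symS h.
apply: (@sym1M _ _ (-1) 0); last by lra.
  apply: sym1D; apply: sym1Z.
    apply: (@sym1M _ _ (-1) 0 _ _ _ (sym_grad_coef N)); last by lra.
    by apply: sym1D; [exact: sym_grad_coef0|exact: sym1_cst].
  by apply: (sym1M (sym_scal_coef N) (sym_ws N)); lra.
by apply: (sym1M (sw N) sdV); lra.
Qed.

(** The radial coefficient of the pulled-back metric. Its leading part is exactly 1, because [phi]
    is [p^2 s / omega] plus the scalar curvature. *)
Lemma sym_radial N : sym1 N (-1) (fun s => omega s * phi s / (s * p s ^+ 2) - 1).
Proof.
apply: (@eq_sym1 _ _ _ (fun s => Rs s * (omega s * s^-1) * ((p s)^-1 * (p s)^-1))).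
  exists 0 => s; rewrite /idw => s0; have w0 := w_neq0 s0; have sn0 : s != 0 by rewrite gt_eqF.
  by have pn0 := p_neq0 s0; rewrite /soliton_potential; field; rewrite w0 sn0 pn0.
apply: (@sym1M _ _ (-2) 0); last by lra.
  by apply: (sym1M (sym_scal_coef N) (sym_ws N)); lra.
by apply: (sym1M (sym_grad_coef_inv N) (sym_grad_coef_inv N)); lra.
Qed.

(** Bounds [s] from below by a multiple of [r^2], which converts decay in [s] into decay in [r]. *)
Lemma potential_growth : exists2 K, 0 < K & \forall s \near far idw, phi s <= K * s.
Proof.
have [hd _] : sym1 0 0 (fun s => denom s * (omega s)^-1).
  by apply: (sym1M (sym_denom 0) (swV 0)); lra.
have [C C0 hC] := growth_ge0 hd; exists (C + 1); first by lra.
have [r hr] := hC; exists (Num.max r 0) => s; rewrite gt_max => /andP[rs s0].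
have := hr s rs; rewrite powRr0 mulr1 => /ler_normlP[_ h].
rewrite potentialE // (_ : _ / _ = s / 4 * (denom s * (omega s)^-1)); last first.
  by field; rewrite w_neq0.
rewrite /idw in s0; nra.
Qed.

End SolitonSymbols.

(** * Inverting the potential as a function of [s] *)

Section PotentialInverse.
Context {R : realType} (n : nat) (omega : R -> R).
Context (omega_smooth : half_smooth omega)
  (omega_gt0 : forall s : R, 0 <= s -> 0 < omega s)
  (omega_eq : omega_ode n omega) (omega0 : omega 0 = 1)
  (hn : (3 <= n)%N) (domega0 : half_derive omega 0 < 0).
Implicit Types (s t : R).
Local Notation p := (grad_coef n omega).
Local Notation phi := (soliton_potential n omega).

Lemma is_derive_potential s : 0 < s -> is_derive s 1 phi (p s / (2 * omega s)).
Proof.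
by move=> s0; apply: is_half_derive_gt0 => //; apply: is_half_derive_soliton_potential => //; exact: ltW.
Qed.

Lemma potential_cvg0 : phi x @[x --> 0^'+] --> phi 0.
Proof. by apply: half_smooth_cvg0; exact: soliton_potential_smooth. Qed.

(** The slope [p / (2 omega)] is at least [1/4], since [p >= 1/2] and [omega <= 1]. *)
Lemma potential_grows s t : 0 <= s -> s < t -> phi s + (t - s) / 4 <= phi t.
Proof.
move=> s0 st; have [|x sx _|c [sc _ E]] := @MVT_right R phi (fun s => p s / (2 * omega s)) s t st.
- have [<-|s_gt0] := eqVneq 0 s; first exact: potential_cvg0.
  have {}s_gt0 : 0 < s by rewrite lt_neqAle s_gt0.
  exact: is_derive_cvg_right (is_derive_potential s_gt0).
- by apply: is_derive_potential; exact: le_lt_trans sx.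
have c0 := le_lt_trans s0 sc; have w0 := omega_gt0 (ltW c0).
have : 4^-1 <= p c / (2 * omega c).
  rewrite ler_pdivlMr ?mulr_gt0 //.
  have := omega_le1 omega_smooth omega_gt0 omega_eq omega0 hn domega0 (ltW c0).
  have := grad_coef_ge omega_smooth omega_gt0 omega_eq omega0 hn domega0 (ltW c0); lra.
by have := subr_gt0 s t; rewrite st; nra.
Qed.

Lemma potential_lt s t : 0 <= s -> 0 <= t -> (phi s < phi t) = (s < t).
Proof.
move=> s0 t0; apply/idP/idP => [|st]; last by have := potential_grows s0 st; lra.
apply: contraTT; rewrite -!leNgt le_eqVlt => /orP[/eqP->//|ts].
by have := potential_grows t0 ts; lra.
Qed.

Lemma potential_inj s t : 0 <= s -> 0 <= t -> phi s = phi t -> s = t.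
Proof.
move=> s0 t0 E; case: (ltgtP s t) => // st.
  by have := potential_grows s0 st; lra.
by have := potential_grows t0 st; lra.
Qed.

Lemma potential0_gt0 : 0 < phi 0.
Proof. by rewrite /soliton_potential mulr0 mul0r add0r scal_coef_gt0. Qed.

Lemma potential_gt0 s : 0 <= s -> 0 < phi s.
Proof.
rewrite le_eqVlt => /orP[/eqP<-|s0]; first exact: potential0_gt0.
by have := potential_grows (lexx 0) s0; have := potential0_gt0; lra.
Qed.

Lemma potential_surj t : phi 0 <= t -> exists2 s, 0 <= s & phi s = t.
Proof.
(* With slope at least [1/4] the potential reaches [t] before [b]; the extra 1 keeps the interval
   nondegenerate. *)
move=> t0; pose b := 4 * (t - phi 0) + 1; have b0 : 0 < b by rewrite /b; lra.
have bt : t <= phi b by have := potential_grows (lexx 0) b0; rewrite /b; lra.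
have cont : {within `[0, b], continuous phi}.
  have cphi (x : R) : 0 < x -> phi @ x --> phi x.
    move=> x0; apply/differentiable_continuous/derivable1_diffP.
    by have [] := is_derive_potential x0.
  apply/continuous_within_itvP => //; split.
  - by move=> x; rewrite in_itv /= => /andP[x0 _]; exact: cphi.
  - exact: potential_cvg0.
  - by apply: cvg_at_left_filter; exact: cphi.
have [|c] := IVT (ltW b0) cont (v := t).
  by rewrite ge_min t0 le_max bt orbT.
by rewrite in_itv /= => /andP[c0 _] E; exists c.
Qed.

(** A genuine inverse for [t >= phi 0]; below that the default value 0 is returned. *)
Definition potential_inv t : R := xget 0 [set s | 0 <= s /\ phi s = t].
Local Notation sigma := potential_inv.

Lemma potential_invP t : phi 0 <= t -> 0 <= sigma t /\ phi (sigma t) = t.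
Proof.
move=> /potential_surj[s s0 st].
by have := @xgetPex _ 0 [set s | 0 <= s /\ phi s = t]; apply; exists s.
Qed.

Lemma potential_invK s : 0 <= s -> sigma (phi s) = s.
Proof.
move=> s0; have [|h1 h2] := @potential_invP (phi s); last exact: potential_inj.
by rewrite leNgt potential_lt // -leNgt.
Qed.

Lemma potential_inv_gt0 t : phi 0 < t -> 0 < sigma t.
Proof.
by move=> t0; have [h1 h2] := potential_invP (ltW t0); rewrite -potential_lt // h2.
Qed.

(** The strict inequality keeps [sigma t] positive, where the potential has a two-sided
    derivative. *)
Lemma is_derive_potential_inv t : phi 0 < t ->
  is_derive t 1 sigma (2 * omega (sigma t) / p (sigma t)).
Proof.
move=> t0; have s0 := potential_inv_gt0 t0; have [_ E] := potential_invP (ltW t0).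
have w0 := omega_gt0 (ltW s0).
have p0 := grad_coef_ge omega_smooth omega_gt0 omega_eq omega0 hn domega0 (ltW s0).
have pn0 : p (sigma t) != 0 by rewrite gt_eqF //; lra.
rewrite -[t in is_derive t]E (_ : 2 * _ / _ = (p (sigma t) / (2 * omega (sigma t)))^-1); last first.
  by rewrite invf_div.
apply: is_derive_inverse.
- near=> x; apply: potential_invK; apply: ltW; near: x; exact: lt_nbhsr.
- near=> x; apply/differentiable_continuous/derivable1_diffP.
  have x0 : 0 < x by near: x; exact: lt_nbhsr.
  by have [] := is_derive_potential x0.
- exact: is_derive_potential.
- by rewrite mulf_neq0 // invr_neq0 // mulf_neq0 ?gt_eqF.
Unshelve. all: by end_near. Qed.

End PotentialInverse.

(** * The conical end *)

Section EnormTopology.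
Context {R : realType} {n : nat}.
Implicit Types (x y : 'rV[R]_n) (r : R).

Lemma enorm_continuous : continuous (enorm : 'rV[R]_n -> R).
Proof.
move=> x; rewrite (_ : (enorm : 'rV[R]_n -> R) = Num.sqrt \o (fun y => enorm y ^+ 2)); last first.
  by apply/funext => y; rewrite /= sqrtr_sqr ger0_norm // enorm_ge0.
apply: continuous_comp; last exact: sqrt_continuous.
exact/differentiable_continuous/differentiable_enorm_sqr.
Qed.

Lemma exterior_open r : open (exterior r : set 'rV[R]_n).
Proof.
rewrite openE => x rx; have h : \forall z \near enorm x, r < z by exact: lt_nbhsr.
exact: (@enorm_continuous x _ h).
Qed.

Lemma nonzero_open : open [set x : 'rV[R]_n | x != 0].
Proof.
rewrite (_ : [set x | _] = exterior 0); first exact: exterior_open.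
by apply/seteqP; split=> x; rewrite /exterior /= enorm_gt0.
Qed.

End EnormTopology.

Section PolarMap.
Context {R : realType} (n : nat) (omega : R -> R).
Context (omega_smooth : half_smooth omega)
  (omega_gt0 : forall s : R, 0 <= s -> 0 < omega s)
  (omega_eq : omega_ode n omega) (omega0 : omega 0 = 1)
  (hn : (3 <= n)%N) (domega0 : half_derive omega 0 < 0).
Local Notation pt := 'rV[R]_n.
Implicit Types (s t : R) (x y : pt) (i j : 'I_n) (u : R -> R).
Local Notation p := (grad_coef n omega).
Local Notation phi := (soliton_potential n omega).
Local Notation sigma := (potential_inv n omega).
Local Notation N x := (enorm x ^+ 2).
Local Notation g := (@soliton_metric R n omega).

(** On the end [f = r^2 / 4], so this radius corresponds to the minimum [phi 0] of [f], taken at the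
    origin only; the image of the end misses just that point. *)
Definition end_radius : R := 2 * Num.sqrt (phi 0).
Definition end_map (r : R) (theta : pt) : pt := Num.sqrt (sigma (r ^+ 2 / 4)) *: theta.
(* The squared distance parameter [s] of the image point. *)
Definition end_arg (y : pt) : R := sigma (N y / 4).
Definition end_scale (y : pt) : R := Num.sqrt (end_arg y / N y).

Local Notation r0 := end_radius.
Local Notation S := end_arg.
Local Notation mu := end_scale.

Let phi0_gt0 : 0 < phi 0. Proof. exact: potential0_gt0. Qed.

Lemma end_radius_ge0 : 0 <= r0.
Proof. by rewrite mulr_ge0 ?sqrtr_ge0. Qed.

Lemma end_radiusP r : 0 <= r -> (r0 < r) = (phi 0 < r ^+ 2 / 4).
Proof.
move=> r_ge0; rewrite ltr_pdivlMr // -(@ltr_pXn2r _ 2) ?nnegrE ?end_radius_ge0 //.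
by rewrite /end_radius exprMn sqr_sqrtr ?ltW // mulrC -natrX.
Qed.

Let ext_phi y : exterior r0 y -> phi 0 < N y / 4.
Proof. by rewrite /exterior /= end_radiusP ?enorm_ge0. Qed.

Let ext_neq0 y : exterior r0 y -> y != 0.
Proof. by move=> ry; rewrite -enorm_gt0; exact: le_lt_trans end_radius_ge0 ry. Qed.

Lemma end_arg_gt0 y : exterior r0 y -> 0 < S y.
Proof. by move=> /ext_phi; exact: potential_inv_gt0. Qed.

Lemma potential_end_arg y : exterior r0 y -> phi (S y) = N y / 4.
Proof.
move=> /ext_phi/ltW h; rewrite /end_arg.
by have [] := potential_invP omega_smooth omega_gt0 omega_eq omega0 hn domega0 h.
Qed.

Lemma differentiable_end_arg y : exterior r0 y -> differentiable S y.
Proof.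
move=> /ext_phi h; rewrite /end_arg.
have d : differentiable (fun y : pt => N y / 4) y.
  by apply: differentiableM; [exact: differentiable_enorm_sqr|exact: differentiable_cst].
exact: (differentiable_compf d
  (is_derive_potential_inv omega_smooth omega_gt0 omega_eq omega0 hn domega0 h)).
Qed.

Lemma is_derive_end_arg y i : exterior r0 y ->
  is_derive y (delta_mx 0 i) S (y 0 i * (omega (S y) / p (S y))).
Proof.
move=> ry; have h := ext_phi ry.
have d : differentiable (fun y : pt => N y / 4) y.
  by apply: differentiableM; [exact: differentiable_enorm_sqr|exact: differentiable_cst].
have dN := is_derive_mulf (is_derive_enorm_sqr i y) (is_derive_cstf (4^-1 : R) y (delta_mx 0 i)).
apply: is_derive_eqf.
  exact: (is_derive_compf d dN
    (is_derive_potential_inv omega_smooth omega_gt0 omega_eq omega0 hn domega0 h)).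
have pn0 : p (S y) != 0.
  have := grad_coef_ge omega_smooth omega_gt0 omega_eq omega0 hn domega0 (ltW (end_arg_gt0 ry)).
  by move=> pS; rewrite gt_eqF //; lra.
by rewrite -/(S y) mulr0 addr0; field.
Qed.

Lemma is_derive_comp_end_arg u y i l : exterior r0 y -> is_derive (S y) 1 u l ->
  is_derive y (delta_mx 0 i) (fun y => u (S y)) (y 0 i * (l * (omega (S y) / p (S y)))).
Proof.
move=> ry du; apply: is_derive_eqf.
  exact: (is_derive_compf (differentiable_end_arg ry) (is_derive_end_arg i ry) du).
by ring.
Qed.

Let rate_smooth : half_smooth (fun s => omega s / p s).
Proof.
apply: half_smoothM => //; apply: half_smoothV; last exact: grad_coef_smooth.
move=> s s0; have := grad_coef_ge omega_smooth omega_gt0 omega_eq omega0 hn domega0 s0.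
by move=> pS; rewrite gt_eqF //; lra.
Qed.

(** The i-th partial derivative is [y_i] times a function of the same kind, with [u' omega / p] in
    place of [u], so the induction closes. *)
Lemma smooth_on_end_arg u : half_smooth u -> smooth_on (exterior r0) (fun y => u (S y)).
Proof.
move=> hu; apply/smooth_onE => k; elim: k u hu => [|k IH] u hu.
  split=> // y ry; have := half_smooth_is_derive (end_arg_gt0 ry) hu.
  exact: differentiable_compf (differentiable_end_arg ry).
apply: (@C_on_step _ _ _ _ _
  (fun i y => y 0 i * (half_derive u (S y) * (omega (S y) / p (S y))))).
- exact: exterior_open.
- move=> y ry; have := half_smooth_is_derive (end_arg_gt0 ry) hu.
  exact: differentiable_compf (differentiable_end_arg ry).
- move=> i y ry; apply: is_derive_comp_end_arg => //.
  exact: half_smooth_is_derive (end_arg_gt0 ry) hu.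
- move=> i; apply: C_onM; [exact: exterior_open|exact: C_on_coord|].
  apply: (IH (fun s => half_derive u s * (omega s / p s))).
  by apply: half_smoothM => //; exact: half_smooth_half_derive.
Qed.

Let N_gt0 y : y != 0 -> 0 < N y. Proof. by move=> y0; rewrite exprn_gt0 // enorm_gt0. Qed.

Lemma end_scale_gt0 y : exterior r0 y -> 0 < mu y.
Proof.
by move=> ry; rewrite sqrtr_gt0 divr_gt0 ?end_arg_gt0 // N_gt0 // ext_neq0.
Qed.

Lemma end_scale_sqr y : exterior r0 y -> mu y ^+ 2 = S y / N y.
Proof.
by move=> ry; rewrite sqr_sqrtr // divr_ge0 ?sqr_ge0 // ltW // end_arg_gt0.
Qed.

Lemma polar_end_map y : exterior r0 y -> polar_map end_map y = mu y *: y.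
Proof.
move=> ry; rewrite /polar_map /end_map /direction scalerA; congr (_ *: _).
have S0 := ltW (end_arg_gt0 ry).
by rewrite /end_scale sqrtrM // sqrtrV ?sqr_ge0 // sqrtr_sqr ger0_norm // enorm_ge0.
Qed.

Lemma smooth_on_end_scale : smooth_on (exterior r0) mu.
Proof.
apply: smooth_on_sqrt; first exact: exterior_open.
  by move=> y ry; rewrite divr_gt0 ?end_arg_gt0 // N_gt0 // ext_neq0.
apply: smooth_onM; [exact: exterior_open| |apply: smooth_onV; first exact: exterior_open].
- by apply: (@smooth_on_end_arg id); exact: half_smooth_id.
- by move=> y ry; rewrite gt_eqF // N_gt0 // ext_neq0.
- by apply: (@smooth_on_radial _ _ _ id); [exact: exterior_open|exact: half_smooth_id].
Qed.

Lemma polar_end_map_smooth : smooth_map_on (exterior r0) (polar_map end_map).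
Proof.
move=> j; apply: (@eq_smooth_on _ _ _ (fun y => mu y * y 0 j)); first exact: exterior_open.
  by move=> y ry; rewrite polar_end_map // mxE.
apply: smooth_onM; [exact: exterior_open|exact: smooth_on_end_scale|exact: smooth_on_coord].
Qed.

Lemma enorm_polar_end_map y : exterior r0 y -> N (mu y *: y) = S y.
Proof.
move=> ry; rewrite enormZ (ger0_norm (ltW (end_scale_gt0 ry))) exprMn end_scale_sqr //.
by rewrite divfK // gt_eqF // N_gt0 // ext_neq0.
Qed.

(** The preimage lies on the same ray, at the radius [r] with [r^2 = 4 f(x)]. *)
Definition end_inv (x : pt) : pt := Num.sqrt (4 * phi (N x) / N x) *: x.

Let phi_gt0 s : 0 <= s -> 0 < phi s. Proof. exact: potential_gt0. Qed.

Lemma end_invK y : exterior r0 y -> end_inv (mu y *: y) = y.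
Proof.
move=> ry; rewrite /end_inv enorm_polar_end_map // potential_end_arg // scalerA.
have S0 := end_arg_gt0 ry; have N0 := N_gt0 (ext_neq0 ry).
rewrite /end_scale -sqrtrM; last first.
  apply: divr_ge0; last exact: ltW.
  by rewrite mulr_ge0 // divr_ge0 // sqr_ge0.
rewrite (_ : _ * _ = 1) ?sqrtr1 ?scale1r //.
have en0 : enorm y != 0 by rewrite enorm_eq0 ext_neq0.
by field; rewrite (gt_eqF S0) en0.
Qed.

Lemma end_inv_exterior x : x != 0 -> exterior r0 (end_inv x) /\ polar_map end_map (end_inv x) = x.
Proof.
move=> x0; have N0 := N_gt0 x0; have ph := phi_gt0 (ltW N0).
have c0 : 0 <= 4 * phi (N x) / N x.
  by apply: divr_ge0; [apply: mulr_ge0 => //; exact: ltW|exact: sqr_ge0].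
have NE : N (end_inv x) / 4 = phi (N x).
  rewrite /end_inv enormZ exprMn ger0_norm ?sqrtr_ge0 // sqr_sqrtr // divfK ?gt_eqF //.
  by field.
have re : exterior r0 (end_inv x).
  rewrite /exterior /= end_radiusP ?enorm_ge0 // NE.
  by rewrite (potential_lt omega_smooth omega_gt0 omega_eq omega0 hn domega0) // ltW.
split=> //; rewrite polar_end_map //.
have SE : S (end_inv x) = N x.
  rewrite /end_arg NE.
  exact: (potential_invK omega_smooth omega_gt0 omega_eq omega0 hn domega0 (ltW N0)).
rewrite /end_scale SE /end_inv scalerA -[X in _ = X]scale1r; congr (_ *: _).
have -> : N (Num.sqrt (4 * phi (N x) / N x) *: x) = 4 * phi (N x).
  by rewrite -/(end_inv x); have := NE; lra.
rewrite -sqrtrM; last by apply: divr_ge0; [exact: sqr_ge0|apply: mulr_ge0 => //; exact: ltW].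
rewrite (_ : _ * _ = 1) ?sqrtr1 //.
by field; rewrite enorm_eq0 x0 gt_eqF.
Qed.

Lemma polar_end_map_image : polar_map end_map @` exterior r0 = [set x | x != 0].
Proof.
apply/seteqP; split=> [_ [y ry <-]|x /= x0].
  rewrite /= polar_end_map // scaler_eq0 negb_or gt_eqF ?end_scale_gt0 //=; exact: ext_neq0.
by have [h1 h2] := end_inv_exterior x0; exists (end_inv x).
Qed.

Lemma polar_end_map_diffeo : diffeo_onto_image (exterior r0) (polar_map end_map).
Proof.
split; first exact: polar_end_map_smooth.
  by rewrite polar_end_map_image; exact: nonzero_open.
exists end_inv; rewrite polar_end_map_image; split; last first.
  by move=> y ry; rewrite polar_end_map // end_invK.
move=> j; apply: (@eq_smooth_on _ _ _ (fun x => Num.sqrt (4 * phi (N x) / N x) * x 0 j)).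
- exact: nonzero_open.
- by move=> x _; rewrite mxE.
apply: smooth_onM; [exact: nonzero_open| |exact: smooth_on_coord].
apply: smooth_on_sqrt; first exact: nonzero_open.
  by move=> x x0; rewrite divr_gt0 ?N_gt0 // mulr_gt0 // phi_gt0 // sqr_ge0.
apply: smooth_onM; first exact: nonzero_open.
  apply: smooth_onM; [exact: nonzero_open|exact: smooth_on_cst|].
  apply: smooth_on_radial; first exact: nonzero_open.
  exact: soliton_potential_smooth.
apply: smooth_onV; first exact: nonzero_open.
  by move=> x x0; rewrite gt_eqF // N_gt0.
by apply: (@smooth_on_radial _ _ _ id); [exact: nonzero_open|exact: half_smooth_id].
Qed.

Lemma polar_end_map_compact : compact (~` (polar_map end_map @` exterior r0)).
Proof.
rewrite polar_end_map_image (_ : ~` _ = [set 0]); first exact: compact_set1.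
by apply/seteqP; split=> x /=; [move=> /negP; rewrite negbK => /eqP|move=> ->; rewrite eqxx].
Qed.

(** As [X = p x] and [|X|^2 = p^2 s / omega], both sides are multiples of [theta]; the factors agree
    by the derivative [2 omega / p] of [sigma]. *)
Lemma end_map_flow (r : R) (theta : pt) : r0 < r -> unit_sphere theta ->
  radial phi (end_map r theta) = r ^+ 2 / 4 /\
  let X := grad g (radial phi) (end_map r theta) in
  is_derive r (1 : R) (fun t : R => end_map t theta)
    ((Num.sqrt (radial phi (end_map r theta)) / inner g (end_map r theta) X X) *: X).
Proof.
move=> rr theta1; have r_gt0 : 0 < r := le_lt_trans end_radius_ge0 rr.
have ph : phi 0 < r ^+ 2 / 4 by rewrite -end_radiusP // ltW.
have s0 := potential_inv_gt0 omega_smooth omega_gt0 omega_eq omega0 hn domega0 ph.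
have [_ sE] := potential_invP omega_smooth omega_gt0 omega_eq omega0 hn domega0 (ltW ph).
set s := sigma (r ^+ 2 / 4) in s0 sE *.
have NF : N (end_map r theta) = s.
  by rewrite /end_map -/s enormZ theta1 mulr1 real_normK ?num_real // sqr_sqrtr // ltW.
have fE : radial phi (end_map r theta) = r ^+ 2 / 4 by rewrite /radial NF.
split=> //; cbv zeta; rewrite fE grad_soliton_potential // NF.
have w0 := omega_gt0 (ltW s0); have wn0 : omega s != 0 by rewrite gt_eqF.
have pn0 : p s != 0.
  have := grad_coef_ge omega_smooth omega_gt0 omega_eq omega0 hn domega0 (ltW s0).
  by move=> pS; rewrite gt_eqF //; lra.
have sq0 : Num.sqrt s != 0 by rewrite gt_eqF // sqrtr_gt0.
have sqE : Num.sqrt s ^+ 2 = s by rewrite sqr_sqrtr // ltW.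
have -> : inner g (end_map r theta) (p s *: end_map r theta) (p s *: end_map r theta)
    = p s ^+ 2 * s / omega s.
  have sE' (c : R) (M : 'M[R]_1) : (c *: M) 0 0 = c * M 0 0 by rewrite mxE.
  move: (end_map r theta) NF => F NF.
  rewrite inner_soliton_metric linearZ /= -!scalemxAl -!scalemxAr !sE' dot_self NF.
  transitivity (p s ^+ 2 * s * (1 + metric_coef omega s * s)); first by ring.
  by rewrite omega_metric_coef // ltW.
have -> : Num.sqrt (r ^+ 2 / 4) = r / 2.
  rewrite (_ : r ^+ 2 / 4 = (r / 2) ^+ 2); last by field.
  by rewrite sqrtr_sqr ger0_norm // divr_ge0 // ltW.
rewrite scalerA /end_map -/s scalerA.
have dk : is_derive r (1 : R) (fun t : R => Num.sqrt (sigma (t ^+ 2 / 4)))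
    (r / 2 / (p s ^+ 2 * s / omega s) * p s * Num.sqrt s).
  have dq : is_derive r (1 : R) (fun t : R => t ^+ 2 / 4) (r / 2).
    by derive_step; rewrite /= ?pnatr_eq0 //; field.
  have ddq : differentiable (fun t : R => t ^+ 2 / 4) r.
    by apply/derivable1_diffP; case: dq.
  have ds := is_derive_potential_inv omega_smooth omega_gt0 omega_eq omega0 hn domega0 ph.
  have dsq := is_derive_compf ddq dq ds.
  have dds := differentiable_compf ddq ds.
  apply: is_derive_eqf; first exact: (is_derive_compf dds dsq (is_derive_sqrt s0)).
  rewrite -/s; apply: (@mulIf _ (Num.sqrt s * p s)); first by rewrite mulf_neq0.
  move: (omega s) (p s) (Num.sqrt s) wn0 pn0 sq0 sqE => w P a wn0 pn0 an0 <-; field.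
  by rewrite pn0 an0 wn0.
have dcomp (i : 'I_1) j : is_derive r (1 : R) (fun t : R => (Num.sqrt (sigma (t ^+ 2 / 4)) *: theta) i j)
    (r / 2 / (p s ^+ 2 * s / omega s) * p s * Num.sqrt s * theta i j).
  rewrite (_ : (fun t : R => _) = (fun t : R => Num.sqrt (sigma (t ^+ 2 / 4)) * theta i j)).
    apply: (is_derive_eqf (is_derive_mulf dk (is_derive_cstf (theta i j) r (1 : R)))).
    by rewrite mulr0 addr0.
  by apply/funext => t; rewrite mxE.
have dM : derivable (fun t : R => Num.sqrt (sigma (t ^+ 2 / 4)) *: theta) r 1.
  by apply/derivable_mxP => i j; have [] := dcomp i j.
apply: DeriveDef => //; rewrite derive_mx //; apply/matrixP => i j; rewrite !mxE.
by have [_ ->] := dcomp i j.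
Qed.

End PolarMap.

(** * Symbols on R^n and tensor norms for the conical metric *)

Section ConicalSymbols.
Context {R : realType} {n : nat}.
Local Notation pt := 'rV[R]_n.
Implicit Types (x y : pt) (i j k l : 'I_n) (m : R) (G : pt -> 'M[R]_n).
Local Notation N x := (enorm x ^+ 2).

Definition symn K m (u : pt -> R) : Prop := sym (@enorm R n) (fun i : 'I_n => delta_mx 0 i) K m u.

Let ec := @enorm_continuous R n.

Lemma eq_symn K m u v : (forall x, x != 0 -> u x = v x) -> symn K m u -> symn K m v.
Proof. by move=> uv; apply: (near_eq_sym ec); exists 0 => x; rewrite enorm_gt0; exact: uv. Qed.

Lemma symnM K m1 m2 m u v : symn K m1 u -> symn K m2 v -> m1 + m2 <= m ->
  symn K m (fun x => u x * v x).
Proof. by move=> hu hv hm; apply: sym_le hm _; apply: symM => //; exact: ec. Qed.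

Lemma symnD K m u v : symn K m u -> symn K m v -> symn K m (fun x => u x + v x).
Proof. exact: (symD ec). Qed.

Lemma symn_opp K m u : symn K m u -> symn K m (fun x => - u x).
Proof. exact: (sym_opp ec). Qed.

Lemma symnZ K m (a : R) u : symn K m u -> symn K m (fun x => a * u x).
Proof. exact: (symZ ec). Qed.

Lemma symn_cst K m (a : R) : 0 <= m -> symn K m (fun=> a).
Proof. exact: (@sym_cst _ _ _ _ _ ec). Qed.

Lemma symn_sum K m (J : Type) (r : seq J) (P : pred J) (u : J -> pt -> R) :
  (forall a, symn K m (u a)) -> symn K m (fun x => \sum_(a <- r | P a) u a x).
Proof. exact: (sym_sum ec). Qed.

Lemma symn_prod K (J : Type) (r : seq J) (P : pred J) (u : J -> pt -> R) :
  (forall a, symn K 0 (u a)) -> symn K 0 (fun x => \prod_(a <- r | P a) u a x).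
Proof.
move=> hu; elim: r => [|a r IH].
  by apply: (@eq_symn _ _ (fun=> 1)) => [x _|]; [rewrite big_nil|exact: symn_cst].
have [Pa|Pa] := boolP (P a).
  apply: (@eq_symn _ _ (fun x => u a x * \prod_(b <- r | P b) u b x)) => [x _|].
    by rewrite big_cons Pa.
  by apply: (symnM (hu a) IH); lra.
by apply: eq_symn IH => x _; rewrite big_cons (negPf Pa).
Qed.

Lemma symn_partial K m u i : symn K.+1 m u -> symn K (m - 1) (partial i u).
Proof. by move=> [_ [_ h]]; exact: h i. Qed.

Lemma coord_le_enorm x i : `|x 0 i| <= enorm x.
Proof.
rewrite -(@ler_pXn2r _ 2) ?nnegrE ?enorm_ge0 // real_normK ?num_real // enorm_sqr.
by rewrite (bigD1 i) //= lerDl sumr_ge0 // => j _; exact: sqr_ge0.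
Qed.

Lemma symn_coord K i : symn K 1 (fun x => x 0 i).
Proof.
have h : growth (@enorm R n) 1 (fun x => x 0 i).
  by exists 1; exists 0 => x x0; rewrite mul1r powRr1 ?coord_le_enorm // enorm_ge0.
case: K => [|K]; first by split.
apply: (sym_step ec (du := fun k _ => (k == i)%:R)) => //.
  by exists 0 => x _ k; exact: is_derive_coord.
by move=> k; apply: symn_cst; rewrite subrr.
Qed.

Lemma symn_enorm_sqr_inv K : symn K (-2) (fun x => (N x)^-1).
Proof.
have E x : 0 < enorm x -> enorm x `^ 2 = N x by move=> x0; rewrite powR_mulrn // ltW.
apply: (symV ec); first by exists 1 => //; exists 0 => x x0; rewrite mul1r E.
apply: (@eq_symn _ _ (fun x => \sum_i x 0 i * x 0 i)) => [x _|].
  by rewrite enorm_sqr; apply: eq_bigr => i _; rewrite expr2.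
by apply: symn_sum => i; apply: (symnM (symn_coord K i) (symn_coord K i)); lra.
Qed.

Lemma symn_radial_proj K i j : symn K 0 (fun x => (N x)^-1 * (x 0 i * x 0 j)).
Proof.
apply: (@symnM _ _ 2 _ _ _ (symn_enorm_sqr_inv K)); last by lra.
by apply: (symnM (symn_coord K i) (symn_coord K j)); lra.
Qed.

(** The eigenvalues are 1 along [x] and [1 - alpha] across, so in Cartesian coordinates the cone is
    homogeneous of degree 0, hence a symbol of order 0. *)
Lemma conical_metric_outer (alpha : R) x : x != 0 ->
  conical_metric alpha x = (1 - alpha)%:M + (alpha / N x) *: (x^T *m x).
Proof.
move=> x0; have N0 : N x != 0 by rewrite expf_neq0 // enorm_eq0.
rewrite /conical_metric dr2E // round_metricE // scalerA mulfK // scalerBr scalemx1 scalerA.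
rewrite addrCA -scalerBl; congr (_ + _ *: _).
by rewrite -[X in X - _]mul1r -mulrBl; congr (_ * _); ring.
Qed.

Lemma conical_metric_inv (alpha : R) x : alpha < 1 -> x != 0 ->
  invmx (conical_metric alpha x) =
  (1 - alpha)^-1%:M + ((1 - (1 - alpha)^-1) / N x) *: (x^T *m x).
Proof.
move=> a1 x0; have N0 : N x != 0 by rewrite expf_neq0 // enorm_eq0.
have an0 : 1 - alpha != 0 by rewrite gt_eqF // subr_gt0.
rewrite conical_metric_outer //; apply: invmx_eq; rewrite outer_mul mulfV //.
rewrite (_ : _ + _ + _ = 0) ?scale0r ?addr0 //.
by move: (N x) N0 => t t0; field; rewrite t0 an0.
Qed.

Lemma scalar_outer_entry (a b : R) x i j :
  (a%:M + b *: (x^T *m x)) i j = a * (i == j)%:R + b * (x 0 i * x 0 j).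
Proof. by rewrite mxE [X in X + _]mxE [X in _ + X]mxE outer_entry mulr_natr. Qed.

Let symn_scalar_outer K (a b : R) i j :
  symn K 0 (fun x => a * (i == j)%:R + b * ((N x)^-1 * (x 0 i * x 0 j))).
Proof.
by apply: symnD; [exact: symn_cst|apply: symnZ; exact: symn_radial_proj].
Qed.

Lemma symn_conical_metric K (alpha : R) i j : symn K 0 (fun x => conical_metric alpha x i j).
Proof.
apply: eq_symn (symn_scalar_outer K (1 - alpha) alpha i j) => x x0.
by rewrite conical_metric_outer // scalar_outer_entry -mulrA.
Qed.

Lemma symn_conical_metric_inv K (alpha : R) i j : alpha < 1 ->
  symn K 0 (fun x => invmx (conical_metric alpha x) i j).
Proof.
move=> a1.
apply: eq_symn (symn_scalar_outer K (1 - alpha)^-1 (1 - (1 - alpha)^-1) i j) => x x0.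
by rewrite conical_metric_inv // scalar_outer_entry -mulrA.
Qed.

Lemma symn_christoffel K G : (forall i j, symn K.+1 0 (fun x => G x i j)) ->
  (forall i j, symn K 0 (fun x => invmx (G x) i j)) ->
  forall l i j, symn K (-1) (christoffel G l i j).
Proof.
move=> hG hI l i j; rewrite /christoffel; apply: symnZ; apply: symn_sum => k.
have hP a b c : symn K (-1) (partial a (fun x => G x b c)).
  by rewrite -[-1]add0r; exact: symn_partial.
apply: (@symnM _ 0 (-1)) => //; last by lra.
by apply: symnD; [exact: symnD|exact: symn_opp].
Qed.

Definition tensor_symn K m q (T : tensor q) : Prop := forall I, symn K m (fun x => T x I).

(** Partial derivatives and Christoffel symbols each lower the order by one. *)
Lemma tensor_symn_covariant K m q (T : tensor q) G :
  (forall l i j, symn K (-1) (christoffel G l i j)) ->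
  tensor_symn K.+1 m T -> tensor_symn K (m - 1) (covariant_derivative G T).
Proof.
move=> hG hT I; rewrite /covariant_derivative; apply: symnD.
  exact: symn_partial (hT _).
apply: symn_opp; apply: symn_sum => p; apply: symn_sum => l.
by apply: (symnM (hG _ _ _) (symS (hT _))); lra.
Qed.

Lemma tensor_symn_iter K m q (T : tensor q) G (j : nat) :
  (forall K l i j, symn K (-1) (christoffel G l i j)) ->
  tensor_symn (K + j) m T ->
  tensor_symn K (m - j%:R) (@iter_covariant_derivative R n G q T j).
Proof.
move=> hG; elim: j K => [|j IH] K hT; first by rewrite subr0 -[K]addn0.
rewrite -natr1 opprD addrA /=; apply: tensor_symn_covariant; first exact: hG.
by apply: IH; rewrite addSnnS.
Qed.

Lemma tensor_norm_growth m q (T : tensor q) G :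
  (forall i j, symn 0 0 (fun x => invmx (G x) i j)) -> tensor_symn 0 m T ->
  exists C r1 : R, forall y, r1 < enorm y -> tensor_norm G T y <= C * enorm y `^ m.
Proof.
move=> hI hT.
have [[C [r hC]] _] : symn 0 (m + m) (fun x =>
    \sum_(I : {ffun 'I_q -> 'I_n}) \sum_(J : {ffun 'I_q -> 'I_n})
    (\prod_(p < q) invmx (G x) (I p) (J p)) * T x I * T x J).
  apply: symn_sum => I; apply: symn_sum => J; apply: (@symnM _ m m) => //.
  apply: (@symnM _ 0 m) => //; last by lra.
  by apply: symn_prod => p.
exists (Num.sqrt C), (Num.max r 0) => y; rewrite gt_max => /andP[ry y0].
have yE : enorm y `^ (m + m) = (enorm y `^ m) ^+ 2 by rewrite powRDp // expr2.
rewrite -[X in _ * X](ger0_norm (powR_ge0 _ _)) -sqrtr_sqr.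
have [C0|C0] := lerP 0 C.
  rewrite -sqrtrM // ler_wsqrtr // -yE; apply: le_trans (hC y ry); exact: ler_norm.
(* A negative [C] would bound an absolute value by a negative number. *)
have := le_trans (normr_ge0 _) (hC y ry).
by rewrite nmulr_rge0 // leNgt powR_gt0.
Qed.

End ConicalSymbols.

(** * The pulled-back metric and its distance to the cone *)

Section ConicalEnd.
Context {R : realType} (n : nat) (omega : R -> R).
Context (omega_smooth : half_smooth omega)
  (omega_gt0 : forall s : R, 0 <= s -> 0 < omega s)
  (omega_eq : omega_ode n omega) (omega0 : omega 0 = 1)
  (hn : (3 <= n)%N) (domega0 : half_derive omega 0 < 0).
Local Notation pt := 'rV[R]_n.
Implicit Types (s t : R) (x y : pt) (i j : 'I_n) (u : R -> R).
Local Notation p := (grad_coef n omega).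
Local Notation phi := (soliton_potential n omega).
Local Notation N x := (enorm x ^+ 2).
Local Notation g := (@soliton_metric R n omega).
Local Notation r0 := (end_radius n omega).
Local Notation S := (@end_arg R n omega).
Local Notation mu := (@end_scale R n omega).
Local Notation F := (polar_map (@end_map R n omega)).
Local Notation ell := (omega_limit omega).
Local Notation h := (metric_coef omega).

Let ext_neq0 y : exterior r0 y -> y != 0.
Proof. by move=> ry; rewrite -enorm_gt0; exact: le_lt_trans (end_radius_ge0 _ _) ry. Qed.

Let S_gt0 y : exterior r0 y -> 0 < S y.
Proof. exact: (end_arg_gt0 omega_smooth omega_gt0 omega_eq omega0 hn domega0). Qed.

Let p_neq0 s : 0 <= s -> p s != 0.
Proof.
move=> s0; have := grad_coef_ge omega_smooth omega_gt0 omega_eq omega0 hn domega0 s0.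
by move=> ps; rewrite gt_eqF //; lra.
Qed.

Let mu_gt0 y : exterior r0 y -> 0 < mu y.
Proof. exact: (end_scale_gt0 omega_smooth omega_gt0 omega_eq omega0 hn domega0). Qed.

(** The gradient of [end_scale] is this factor times [y]; it gives the part of the Jacobian of the
    end along [y^T y]. *)
Definition end_shear y : R := (omega (S y) / p (S y) / N y - 2 * S y / N y ^+ 2) / (2 * mu y).
Local Notation kappa := end_shear.

Lemma is_derive_end_scale y i : exterior r0 y -> is_derive y (delta_mx 0 i) mu (y 0 i * kappa y).
Proof.
move=> ry; have N0 : N y != 0 by rewrite expf_neq0 // enorm_eq0 ext_neq0.
have dS := is_derive_end_arg omega_smooth omega_gt0 omega_eq omega0 hn domega0 i ry.
have ddS := differentiable_end_arg omega_smooth omega_gt0 omega_eq omega0 hn domega0 ry.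
have dN := is_derive_enorm_sqr i y.
have dSN := is_derive_mulf dS (is_derive_invf (f := fun y : pt => N y) N0 dN).
have ddSN : differentiable (fun y => S y * (N y)^-1) y.
  by apply: differentiableM => //; apply: differentiableV => //; exact: differentiable_enorm_sqr.
have SN0 : 0 < S y * (N y)^-1.
  by rewrite divr_gt0 ?S_gt0 // lt_neqAle eq_sym N0 sqr_ge0.
apply: (is_derive_eqf (is_derive_compf ddSN dSN (is_derive_sqrt SN0))).
have mu0 := mu_gt0 ry; rewrite /kappa -[Num.sqrt _]/(mu y).
move: (mu y) mu0 => m m0; have pS := p_neq0 (ltW (S_gt0 ry)).
by move: (N y) N0 => t t0; field; rewrite (gt_eqF m0) pS t0.
Qed.

Lemma jacobian_polar_end_map y : exterior r0 y ->
  jacobian F y = (mu y)%:M + kappa y *: (y^T *m y).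
Proof.
move=> ry; have near_ext := open_nbhs_nbhs (conj (@exterior_open R n r0) ry).
have dmu i := is_derive_end_scale i ry.
have FE j : \forall z \near y, mu z * z 0 j = F z 0 j.
  apply: filterS near_ext => z rz.
  by rewrite (polar_end_map omega_smooth omega_gt0 omega_eq omega0 hn domega0 rz) mxE.
apply: jacobianE => [j|i j].
  have := polar_end_map_smooth omega_smooth omega_gt0 omega_eq omega0 hn domega0.
  by move=> /(_ j [::] y ry).
apply: (near_eq_is_derive (FE j)).
apply: (is_derive_eqf (is_derive_mulf (dmu i) (is_derive_coord i j y))).
by rewrite scalar_outer_entry; ring.
Qed.

(** The tangential eigenvalue is [mu^2]. The radial one is [(mu + kappa |y|^2)^2 / omega], where the
    Jacobian factor simplifies to [omega / (2 mu p)]. *)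
Lemma pullback_end_map y : exterior r0 y ->
  pullback F g y = (S y / N y)%:M
    + ((omega (S y) * phi (S y) / (S y * p (S y) ^+ 2) - S y / N y) / N y) *: (y^T *m y).
Proof.
move=> ry; rewrite /pullback jacobian_polar_end_map //.
rewrite (polar_end_map omega_smooth omega_gt0 omega_eq omega0 hn domega0 ry).
rewrite /soliton_metric (enorm_polar_end_map omega_smooth omega_gt0 omega_eq omega0 hn domega0 ry).
have -> : (mu y *: y)^T *m (mu y *: y) = mu y ^+ 2 *: (y^T *m y).
  by rewrite -scalemxAr [(mu y *: y)^T]linearZ /= -scalemxAl scalerA expr2.
have -> : ((mu y)%:M + kappa y *: (y^T *m y))^T = (mu y)%:M + kappa y *: (y^T *m y).
  by rewrite [LHS]linearD /= [X in _ + X]linearZ /= trmx_mul trmxK tr_scalar_mx.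
rewrite scalerA !outer_mul.
have mu0 := mu_gt0 ry; have S0 := S_gt0 ry; have w0 := omega_gt0 (ltW S0).
have mE := end_scale_sqr omega_smooth omega_gt0 omega_eq omega0 hn domega0 ry.
have pE := potential_end_arg omega_smooth omega_gt0 omega_eq omega0 hn domega0 ry.
have hE : 1 + h (S y) * S y = (omega (S y))^-1 by rewrite omega_metric_coef // ltW.
have N0 : N y != 0 by rewrite expf_neq0 // enorm_eq0 ext_neq0.
have kE : mu y + kappa y * N y = omega (S y) / (2 * mu y * p (S y)).
  rewrite /kappa; have pS := p_neq0 (ltW S0).
  have -> : 2 * S y / N y ^+ 2 = 2 * (mu y ^+ 2) / N y by rewrite mE; field; rewrite enorm_eq0 ext_neq0.
  by move: (mu y) mu0 (N y) N0 => m m0 t t0; field; rewrite (gt_eqF m0) pS t0.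
congr (_%:M + _ *: _); first by rewrite mulr1 -expr2 mE.
apply: (mulIf N0); rewrite divfK //.
transitivity ((mu y + kappa y * N y) ^+ 2 * (1 + h (S y) * (mu y ^+ 2 * N y)) - mu y ^+ 2); first by ring.
rewrite mE divfK // hE; congr (_ - _).
rewrite kE pE expr_div_n !exprMn mE; have pS := p_neq0 (ltW S0).
move: (N y) N0 => t t0; field.
by rewrite ?t0 ?pS ?(gt_eqF S0) ?(gt_eqF w0).
Qed.

Lemma far_end_arg (P : R -> Prop) : (\forall s \near far idw, P s) ->
  \forall y \near far (@enorm R n), P (S y).
Proof.
move=> [r hr]; pose r' := Num.max r 0.
have r'0 : 0 <= r' by rewrite le_max lexx orbT.
(* The extra 1 makes [|y| > 1], hence [|y|^2 > |y| > 4 phi r'], which is [phi (S y) > phi r']. *)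
exists (Num.max r0 (4 * phi r' + 1)) => y; rewrite gt_max => /andP[ry y1]; apply: hr.
rewrite /idw; apply: (@le_lt_trans _ _ r'); first by rewrite le_max lexx.
rewrite -(potential_lt omega_smooth omega_gt0 omega_eq omega0 hn domega0 r'0); last first.
  by apply: ltW; exact: S_gt0.
rewrite (potential_end_arg omega_smooth omega_gt0 omega_eq omega0 hn domega0 ry).
have ph : 0 < phi r' by exact: potential_gt0.
by nra.
Qed.

(** [S] grows at least like [|y|^2], which doubles nonpositive orders. A derivative replaces [u] by
    [u' omega / p], of doubled order [2 m - 2], and the factor [y_i] brings one back. *)
Lemma symn_end_arg K m u : m <= 0 -> sym1 K m u -> symn K (2 * m) (fun y => u (S y)).
Proof.
have FF : Filter (far (@enorm R n)) := far_filter _.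
have ext_far : \forall y \near far (@enorm R n), exterior r0 y by exists r0.
have [A A0 hA] := potential_growth omega_smooth omega_gt0 omega_eq omega0 hn domega0.
have S_ge : \forall y \near far (@enorm R n), N y / (4 * A) <= S y.
  have := far_end_arg hA; move=> hA'; near=> y.
  have ry : exterior r0 y by near: y.
  have : phi (S y) <= A * S y by near: y.
  rewrite (potential_end_arg omega_smooth omega_gt0 omega_eq omega0 hn domega0 ry).
  by rewrite ler_pdivrMr ?mulr_gt0 // ler_pdivrMr //; lra.
have hgrow m' v : m' <= 0 -> growth idw m' v -> growth (@enorm R n) (2 * m') (fun y => v (S y)).
  move=> m'0 /growth_ge0[C C0 /far_end_arg hC]; exists (C * (4 * A) `^ (- m')); near=> y.
  apply: (@le_trans _ _ (C * S y `^ m')); first by near: y.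
  rewrite -mulrA ler_wpM2l //.
  have y0 : 0 < enorm y by near: y; exact: far_gt0.
  have NS : N y / (4 * A) <= S y by near: y.
  have N0 : 0 < N y / (4 * A) by rewrite divr_gt0 ?exprn_gt0 // mulr_gt0.
  have E : S y `^ m' <= (N y / (4 * A)) `^ m'.
    rewrite -[m']opprK !(powRN _ (- m')) lef_pV2 ?posrE ?powR_gt0 ?(lt_le_trans N0 NS) //.
    apply: ge0_ler_powR; rewrite ?nnegrE ?oppr_ge0 //; first exact: ltW.
    exact: ltW (lt_le_trans N0 NS).
  have A4 : 0 <= 4 * A by rewrite mulr_ge0 // ltW.
  apply: (le_trans E); rewrite powRM ?invr_ge0 ?sqr_ge0 //.
  rewrite -powR_inv1 // -powRrM mulN1r mulrC.
  by rewrite -powR_mulrn ?enorm_ge0 // -powRrM.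
elim: K m u => [|K IH] m u m0 hu; first by split=> //; exact: hgrow (sym_growth hu).
have du : \forall y \near far (@enorm R n), is_derive (S y) (1 : R) u ('D_1 u (S y)).
  apply: (far_end_arg (P := fun s => is_derive (s : R) (1 : R) u ('D_1 u s))).
  by apply: filterS (sym_derive hu) => s /(_ tt).
apply: (sym_step (@enorm_continuous R n)
  (du := fun i y => y 0 i * ('D_1 u (S y) * (omega (S y) / p (S y))))).
- exact: hgrow (sym_growth hu).
- near=> y => i; apply: (is_derive_comp_end_arg omega_smooth omega_gt0 omega_eq omega0 hn domega0).
    by near: y.
  by near: y.
- move=> i; apply: (@symnM _ _ _ 1 (2 * (m - 1)) _ _ _ (symn_coord K i)); last by lra.
  apply: (IH (m - 1) (fun s => 'D_1 u s * (omega s / p s))); first by lra.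
  have [_ [_ hu']] := hu.
  apply: (@sym1M _ _ (m - 1) 0 _ _ _ (hu' tt)); last by lra.
  exact: (sym_rate omega_smooth omega_gt0 omega_eq omega0 hn domega0).
Unshelve. all: by end_near. Qed.

(** The cone has eigenvalues 1 and [ell], so the error is [b] times the identity plus [a - b] times
    the radial projection, with [a] and [b] the radial and tangential errors. *)
Lemma symn_end_error K i j :
  symn K (-2) (fun y => (pullback F g y - conical_metric (1 - ell) y) i j).
Proof.
pose b s := s / (4 * phi s) - ell; pose a s := omega s * phi s / (s * p s ^+ 2) - 1.
have sb : symn K (-2) (fun y => b (S y)).
  rewrite (_ : -2 = 2 * -1); last by ring.
  by apply: symn_end_arg; [lra|apply: sym_tangential].
have sa : symn K (-2) (fun y => a (S y)).
  rewrite (_ : -2 = 2 * -1); last by ring.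
  by apply: symn_end_arg; [lra|apply: sym_radial].
apply: (@near_eq_sym _ _ _ _ _ (@enorm_continuous R n) _ _ (fun y => (i == j)%:R * b (S y)
  + (a (S y) - b (S y)) * ((N y)^-1 * (y 0 i * y 0 j)))).
  exists r0 => y ry; have y0 := ext_neq0 ry.
  rewrite mxE [X in _ = _ + X]mxE conical_metric_outer // pullback_end_map //.
  rewrite !scalar_outer_entry /a /b.
  rewrite (potential_end_arg omega_smooth omega_gt0 omega_eq omega0 hn domega0 ry).
  have N0 : N y != 0 by rewrite expf_neq0 // enorm_eq0.
  have pS := p_neq0 (ltW (S_gt0 ry)); have S0 := S_gt0 ry.
  by move: (N y) N0 => t t0; field; rewrite (gt_eqF S0) pS t0.
apply: symnD; first exact: symnZ.
apply: (@symnM _ _ _ (-2) 0 _ _ _ _ (symn_radial_proj K i j)); last by lra.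
by apply: symnD => //; exact: symn_opp.
Qed.

Lemma soliton_asymptotically_conical : asymptotically_conical g (radial phi).
Proof.
exists r0, (@end_map R n omega); split.
- exact: end_radius_ge0.
- exact: polar_end_map_diffeo.
- exact: polar_end_map_compact.
- by move=> r theta; exact: end_map_flow.
have l0 := omega_limit_gt0 omega_smooth omega_gt0 omega_eq omega0 hn domega0.
have l1 := omega_limit_le1 omega_gt0 omega0.
(* The error is [O(r^-2)], which is [r^(- 3 eps)] for [eps = 2/3]. *)
exists (1 - ell), (2 / 3); split; [by apply/andP; split; lra|by []|].
move=> galpha k j _.
have -> : - (3 * (2 / 3)) - j%:R = -2 - j%:R :> R by field.
have a1 : 1 - ell < 1 by lra.
apply: tensor_norm_growth => [i i'|]; first exact: symn_conical_metric_inv.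
apply: (@tensor_symn_iter _ _ 0 (-2)) => [K l i i'|I].
  apply: symn_christoffel => a b; first exact: symn_conical_metric.
  exact: symn_conical_metric_inv.
exact: symn_end_error.
Qed.

End ConicalEnd.

(** * Uniqueness of the potential *)

Section PotentialUniqueness.
Context {R : realType} (n : nat) (omega : R -> R).
Context (omega_smooth : half_smooth omega)
  (omega_gt0 : forall s : R, 0 <= s -> 0 < omega s)
  (omega_eq : omega_ode n omega) (omega0 : omega 0 = 1).
Implicit Types (s t : R) (psi : R -> R).
Local Notation phi := (soliton_potential n omega).
Local Notation p := (grad_coef n omega).

Lemma soliton_potential_ode : potential_ode n omega phi.
Proof.
move=> s s0; have dphi := is_half_derive_soliton_potential omega_smooth omega_gt0 omega_eq omega0 s0.
rewrite (is_half_derive_val s0 dphi) half_derive_omega //.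
have w0 := omega_neq0 omega_gt0 s0.
transitivity (2 * p s * s); first by field.
by rewrite /grad_coef [omega s in RHS]omegaE //; field.
Qed.

(** The factor [s] in the equation hides the derivative at 0, which is recovered there by
    continuity. *)
Lemma potential_ode_half_derive psi s : half_smooth psi -> potential_ode n omega psi -> 0 <= s ->
  half_derive psi s = p s / (2 * omega s).
Proof.
have ode_gt0 u t : potential_ode n omega u -> 0 < t -> half_derive u t = half_derive phi t.
  move=> hu t0; have := hu t (ltW t0); rewrite -(soliton_potential_ode (ltW t0)) => E.
  have c0 : t * omega t != 0 by rewrite mulf_neq0 ?omega_neq0 ?gt_eqF // ltW.
  by apply: (mulIf c0); apply: (@mulfI _ 4); [rewrite pnatr_eq0|move: E; rewrite -!mulrA].
move=> hpsi ode s0; have hphi : half_smooth phi by exact: soliton_potential_smooth.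
rewrite -(is_half_derive_val s0 (is_half_derive_soliton_potential _ _ _ _ s0)) //.
move: s0; rewrite le_eqVlt => /orP[/eqP<-|]; last exact: ode_gt0.
apply/eqP; rewrite -subr_eq0; apply/eqP.
apply: (@half_smooth_eq0 _ (fun s => half_derive psi s - half_derive phi s)) => [|t t0].
  apply: half_smoothD; first exact: half_smooth_half_derive.
  by apply: half_smoothN; exact: half_smooth_half_derive.
by rewrite ode_gt0 // subrr.
Qed.

Lemma potential_unique psi : half_smooth psi -> potential_ode n omega psi ->
  forall s, 0 <= s -> psi s = phi s + (psi 0 - phi 0).
Proof.
move=> hpsi ode s; have hphi : half_smooth phi by exact: soliton_potential_smooth.
rewrite le_eqVlt => /orP[/eqP<-|s0]; first by rewrite addrC subrK.
have hd : half_smooth (fun t => psi t - phi t) by apply: half_smoothD => //; exact: half_smoothN.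
have [|t t0 _|c [_ _]] := @MVT_right R (fun t => psi t - phi t) (fun=> 0) 0 s s0.
- exact: half_smooth_cvg0 hd.
- have d1 := half_smooth_is_derive t0 hpsi; have d2 := half_smooth_is_derive t0 hphi.
  derive_step; rewrite (potential_ode_half_derive hpsi) ?(potential_ode_half_derive hphi) ?ltW //.
    by rewrite subrr.
  exact: soliton_potential_ode.
- by rewrite mul0r; lra.
Qed.

End PotentialUniqueness.

Theorem propositionA6 (R : realType) (n : nat) (omega : R -> R)
  (hn : (3 <= n)%N)
  (omega_smooth : half_smooth omega)
  (omega_gt0 : forall s : R, 0 <= s -> 0 < omega s)
  (omega_eq : omega_ode n omega)
  (omega0 : omega 0 = 1)
  (domega0 : half_derive omega 0 < 0) :
  exists (g : 'rV[R]_n -> 'M[R]_n) (phi : R -> R),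
    (forall x : 'rV[R]_n, x != 0 -> g x = polar_metric omega x) /\
    (half_smooth phi /\ potential_ode n omega phi /\
     normalized_potential g (radial phi)) /\
    (forall psi : R -> R, half_smooth psi -> potential_ode n omega psi ->
       (exists c : R, forall s : R, 0 <= s -> psi s = phi s + c) /\
       (normalized_potential g (radial psi) ->
        forall s : R, 0 <= s -> psi s = phi s)) /\
    expanding_gradient_soliton g (radial phi) /\
    rotationally_symmetric g (radial phi) /\
    positive_sectional_curvature g /\
    asymptotically_conical g (radial phi).
Proof.
have q_gt0 := curv_gt0 omega_smooth omega_gt0 omega_eq omega0 hn domega0.
have qr_gt0 := curv_radial_gt0 omega_smooth omega_gt0 omega_eq omega0 hn domega0.
have hphi : half_smooth (soliton_potential n omega) by exact: soliton_potential_smooth.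
have ode := soliton_potential_ode omega_smooth omega_gt0 omega_eq omega0.
have phi_norm := soliton_potential_normalized omega_smooth omega_gt0 omega_eq omega0.
exists (@soliton_metric R n omega), (soliton_potential n omega).
split; first by move=> x x0; exact: soliton_metric_polar.
split; first by [].
split; last split; last split; last split.
- move=> psi hpsi odepsi.
  have psiE := potential_unique omega_smooth omega_gt0 omega_eq omega0 hpsi odepsi.
  split; first by exists (psi 0 - soliton_potential n omega 0).
  move=> psi_norm.
  (* Equal derivatives give equal gradients, so the normalization evaluated at the origin fixes the
     additive constant. *)
  have grad_eq x : grad (@soliton_metric R n omega) (radial psi) x =
      grad (@soliton_metric R n omega) (radial (soliton_potential n omega)) x.
    have d u : half_smooth u -> is_half_derive u (enorm x ^+ 2) (half_derive u (enorm x ^+ 2)).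
      exact: half_smooth_derive (enorm_sqr_ge0 x).
    rewrite (grad_radial_soliton omega_gt0 omega0 (d _ hpsi)).
    rewrite (grad_radial_soliton omega_gt0 omega0 (d _ hphi)).
    have hd := potential_ode_half_derive omega_smooth omega_gt0 omega_eq omega0.
    by rewrite (hd _ _ hpsi odepsi (enorm_sqr_ge0 x)) (hd _ _ hphi ode (enorm_sqr_ge0 x)).
  have psi0 : psi 0 = soliton_potential n omega 0.
    have := psi_norm 0; rewrite grad_eq phi_norm /radial.
    by rewrite (eqP (_ : enorm 0 == 0 :> R)) ?enorm_eq0 // expr0n.
  by move=> s /psiE ->; rewrite psi0 subrr addr0.
- split; [exact: soliton_metric_riemannian| |exact: soliton_equation].
  by apply: smooth_on_radial => //; exact: openT.
- exact: soliton_rotationally_symmetric.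
- exact: soliton_sectional_gt0.
- exact: soliton_asymptotically_conical.
Qed.
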